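(* Let $\lambda\in\mathbb C$ with $|\lambda|=1$, let $s\geq1$ be an integer, fix a sign $\pm$, and let $\alpha(h)=\lambda^{\frac12}e^{\pm ih^s}$. There exists a Moser–Webster triple of involutions $(\tau_1,\tau_2,\rho)$ of $(\mathbb C^2,0)$ that is formally equivalent to the triple $$\tau'_{1}(\xi)=\begin{pmatrix}0&\alpha(h)\\\alpha(h)^{-1}&0\end{pmatrix}\xi,\qquad \tau'_{2}(\xi)=\begin{pmatrix}0&\alpha(h)^{-1}\\\alpha(h)&0\end{pmatrix}\xi,\qquad \rho'(\xi)=\bar\xi,$$ with $h=\xi_1\xi_2$, but not analytically equivalent to it.
   Context: A Moser–Webster triple of involutions $(\tau_1,\tau_2,\rho)$ consists of two holomorphic reflections $\tau_1,\tau_2\in\mathrm{Diff}(\mathbb C^2,0)$ (holomorphic involutions whose linear parts have eigenvalues $\{1,-1\}$) and an antiholomorphic involution $\rho$ of $(\mathbb C^2,0)$ such that $\tau_2=\rho\circ\tau_1\circ\rho$. Two triples are formally (resp. analytically) equivalent if there is a formal (resp. holomorphic) diffeomorphism $\Psi$ of $(\mathbb C^2,0)$ conjugating them componentwise: $\Psi\circ\tau_j=\tau'_j\circ\Psi$, $\Psi\circ\rho=\rho'\circ\Psi$. *)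

(* Defs.v *)
From HB Require Import structures.
From mathcomp Require Import all_boot all_order all_algebra.
From mathcomp Require Import complex.
From mathcomp Require Import Rstruct.
Set Implicit Arguments.
Unset Strict Implicit.
Unset Printing Implicit Defensive.
Import Order.TTheory GRing.Theory Num.Theory.
Local Open Scope ring_scope.

Definition C : numClosedFieldType := (Rdefinitions.R)[i].

(* Formal power series in two variables xi1, xi2 over C:
   p a b is the coefficient of xi1^a xi2^b.                            *)
Definition ser := nat -> nat -> C.

Definition fmap := (ser * ser)%type.

Definition oneS : ser := fun a b => ((a == 0%N) && (b == 0%N))%:R.
Definition X1 : ser := fun a b => ((a == 1%N) && (b == 0%N))%:R.
Definition X2 : ser := fun a b => ((a == 0%N) && (b == 1%N))%:R.

Definition mulS (p q : ser) : ser := fun a b =>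
  \sum_(k < a.+1) \sum_(l < b.+1) p k l * q (a - k)%N (b - l)%N.

Definition powS (p : ser) (n : nat) : ser := iter n (mulS p) oneS.

(* substitution f(g1, g2), meaningful when g1, g2 have no constant term:
   then only the monomials xi1^i xi2^j with i + j <= a + b of f contribute
   to the coefficient of xi1^a xi2^b *)
Definition compS (f : ser) (g : fmap) : ser := fun a b =>
  \sum_(i < (a + b).+1) \sum_(j < (a + b).+1)
     f i j * mulS (powS g.1 i) (powS g.2 j) a b.

Definition compM (f g : fmap) : fmap := (compS f.1 g, compS f.2 g).

Definition conjS (p : ser) : ser := fun a b => (p a b)^*.
Definition conjM (f : fmap) : fmap := (conjS f.1, conjS f.2).

Definition idM : fmap := (X1, X2).

Definition fixes0 (f : fmap) : Prop := f.1 0%N 0%N = 0 /\ f.2 0%N 0%N = 0.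

(* linear part (Jacobian matrix at 0): entry (k, m) = d f_k / d xi_m (0) *)
Definition linpart (f : fmap) : 'M[C]_2 :=
  \matrix_(k < 2, m < 2)
    (if k == ord0 then f.1 else f.2) (m == ord0 : nat) (m != ord0 : nat).

Definition formal_diffeo (f : fmap) : Prop :=
  fixes0 f /\ \det (linpart f) != 0.

Definition convergentS (p : ser) : Prop :=
  exists M r : C, 0 < r /\ forall a b, `|p a b| <= M * r ^+ (a + b).

Definition convergentM (f : fmap) : Prop := convergentS f.1 /\ convergentS f.2.

Definition analytic_diffeo (f : fmap) : Prop := formal_diffeo f /\ convergentM f.

(* Holomorphic maps tau are represented by their series.
   An antiholomorphic germ rho is represented by the holomorphic germ F
   with rho(xi) = F(conj xi).  Then:
     Psi o rho    has series  compM Psi F,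
     rho' o Psi   has series  compM F' (conjM Psi),
     rho o rho    = F o conj(F)          (holomorphic),
     rho o tau o rho = F o conj(tau) o conj(F)   (holomorphic).            *)

Definition reflection (t : fmap) : Prop :=
  convergentM t /\ fixes0 t /\ compM t t = idM /\
  char_poly (linpart t) = 'X ^+ 2 - 1.

Definition anti_involution (F : fmap) : Prop :=
  convergentM F /\ fixes0 F /\ compM F (conjM F) = idM.

(* a triple (tau1, tau2, rho) with rho given by F as above *)
Definition triple := (fmap * fmap * fmap)%type.

Definition MW_triple (T : triple) : Prop :=
  let: (t1, t2, F) := T in
  reflection t1 /\ reflection t2 /\ anti_involution F /\
  t2 = compM F (compM (conjM t1) (conjM F)).

Definition conjugates (Psi : fmap) (T T' : triple) : Prop :=
  let: (t1, t2, F) := T in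
  let: (t1', t2', F') := T' in
  compM Psi t1 = compM t1' Psi /\
  compM Psi t2 = compM t2' Psi /\
  compM Psi F = compM F' (conjM Psi).

Definition formally_equivalent (T T' : triple) : Prop :=
  exists Psi, formal_diffeo Psi /\ conjugates Psi T T'.

Definition analytically_equivalent (T T' : triple) : Prop :=
  exists Psi, analytic_diffeo Psi /\ conjugates Psi T T'.

(* The model triple.  For mu a square root of lambda, sg = +1 or -1 and
   s >= 1, alpha(h) = mu * exp(sg * i * h^s) with h = xi1 xi2, i.e.
   alpha = sum_n mu (sg i)^n / n! (xi1 xi2)^(s n).                       *)
Definition expS (c : C) (s : nat) : ser := fun a b =>
  if (a == b) && (s %| a)%N then c ^+ (a %/ s) / ((a %/ s)`!)%:R else 0.

Definition alphaS (mu sg : C) (s : nat) : ser :=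
  fun a b => mu * expS (sg * 'i) s a b.

Definition alphaInvS (mu sg : C) (s : nat) : ser :=
  fun a b => mu^-1 * expS (- sg * 'i) s a b.

(* tau'_1(xi) = (alpha xi2, alpha^-1 xi1), tau'_2(xi) = (alpha^-1 xi2, alpha xi1),
   rho'(xi) = conj xi, i.e. F' = identity *)
Definition model_triple (mu sg : C) (s : nat) : triple :=
  ((mulS (alphaS mu sg s) X2, mulS (alphaInvS mu sg s) X1),
   (mulS (alphaInvS mu sg s) X2, mulS (alphaS mu sg s) X1),
   idM).

(* Main.v *)
(* Write h = xi1 xi2 and let E = xi1 d_1 - xi2 d_2, so that E h = 0.
   For real t let K_t be the time-one flow of i t h^(s+1) chi(xi1) E with
   chi = sum_(k >= 2) xi1^k. It preserves h and satisfies K_t o conj(K_t) = id, so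
   (tau'_1, K_t tau'_2 K_t^-1, K_t o conj) is a Moser-Webster triple T_t.

   T_t is formally equivalent to the model: looking for Psi in the form
   (r(h) xi1 e^u, r(h) xi2 e^-u), the mode xi1^k of u is found by dividing by
   alpha^(2k) - 1, whose order in h is at most s; the factor h^(s+1) of the vector
   field makes the successive corrections converge h-adically, and the remaining
   change of alpha is absorbed by r(h).

   If Psi is an analytic equivalence, its Jacobian determinant J is convergent,
   tau'_1-invariant, and K_t pulls the form J dxi1 dxi2 back to its conjugate; these
   equations are linear, and once the diagonal part of J is normalised to 1 they have at
   most one solution. The coefficient of h^m xi1^k in J is a polynomial in t of degree
   at most m whose linear coefficient d_(k,m) is given by
   (alpha^(2k) - 1) sum_m d_(k,m) h^m = i k h^(s+1). If all T_t were analytically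
   equivalent to the model, a Baire argument and Lagrange interpolation would bound
   |d_(k,m)| by W^(k+2m+1) with W independent of k. But 1/(1 - alpha^(2k)) has poles
   at distance O(k^(-1/s)) from 0; concretely 1/(1 + alpha^(2k)) is an affine function
   of a solution of the Riccati equation y' = -+ k (1 + y^2) in h^s, whose Taylor
   coefficients grow like (k / sqrt 3)^n at least. *)

Require Import Defs.
From HB Require Import structures.
From mathcomp Require Import all_boot all_order all_algebra.
From mathcomp Require Import complex boolp classical_sets reals Rstruct zify ring.
Set Implicit Arguments.
Unset Strict Implicit.
Unset Printing Implicit Defensive.
Import Order.TTheory GRing.Theory Num.Theory.
Local Open Scope ring_scope.

(** No particular [t] is shown to work. The coefficients of J are nonlinear in [t], and only their
    linear part is explicit enough to be bounded from below; so all real [t] are assumed to fail at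
    once, and uniformity in [t] is what gives access to that linear part. Small divisors are never
    estimated. Each alpha^(2k) - 1 is either a unit or has exact order s in h, so every single mode
    is harmless; divergence is seen only by letting k grow. If mu^(2k) = 1 the quotient by
    alpha^(2k) - 1 is awkward at h = 0. Combining the modes k and 2k leaves 1/(1 + alpha^(2k))
    instead, which is regular unless mu^(2k) = -1, and of two consecutive k at least one avoids that
    value. Since |mu| = 1, conjugation inverts alpha, and this makes the Riccati solution real.
    After sign changes its Taylor coefficients are nonnegative, so nothing cancels in the recursion
    and the lower bound needs no knowledge of the poles. *)

(** * The ring of formal power series in two variables *)

(* [ser] unfolds to a function type, for which the library may infer pointwise
   operations; [ps] carries the Cauchy product instead. *)
Definition ps : Type := ser.

HB.instance Definition _ := gen_eqMixin ps.
HB.instance Definition _ := gen_choiceMixin ps.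

Lemma psP (p q : ps) : (forall a b, p a b = q a b) -> p = q.
Proof. by move=> h; apply: funext => a; apply: funext => b. Qed.

Definition zeroS : ps := fun _ _ => 0.
Definition addS (p q : ps) : ps := fun a b => p a b + q a b.
Definition oppS (p : ps) : ps := fun a b => - p a b.

Lemma addSA : associative addS.
Proof. by move=> p q r; apply: psP => a b; apply: addrA. Qed.
Lemma addSC : commutative addS.
Proof. by move=> p q; apply: psP => a b; apply: addrC. Qed.
Lemma add0S : left_id zeroS addS.
Proof. by move=> p; apply: psP => a b; apply: add0r. Qed.
Lemma addNS : left_inverse zeroS oppS addS.
Proof. by move=> p; apply: psP => a b; apply: addNr. Qed.

HB.instance Definition _ := GRing.isZmodule.Build ps addSA addSC add0S addNS.

(** A coefficient of a product sees only finitely many coefficients of the factors, so the ring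
    axioms for the Cauchy product can be inherited from bivariate polynomials. *)
Lemma mulS_poly (p q : ser) (P Q : {poly {poly C}}) a b :
  (forall i j, (i <= a)%N -> (j <= b)%N -> P`_i`_j = p i j) ->
  (forall i j, (i <= a)%N -> (j <= b)%N -> Q`_i`_j = q i j) ->
  (P * Q)`_a`_b = mulS p q a b.
Proof.
move=> hP hQ; rewrite coefM coef_sum; apply: eq_bigr => i _.
rewrite coefM; apply: eq_bigr => j _.
by rewrite hP ?hQ ?leq_subr // -ltnS.
Qed.

Definition truncP (n : nat) (p : ser) : {poly {poly C}} :=
  \poly_(i < n) \poly_(j < n) p i j.

Lemma truncPE n p i j : (i < n)%N -> (j < n)%N -> (truncP n p)`_i`_j = p i j.
Proof. by move=> hi hj; rewrite coef_poly hi coef_poly hj. Qed.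

Lemma mulS_truncP n (p q : ser) a b : (a < n)%N -> (b < n)%N ->
  (truncP n p * truncP n q)`_a`_b = mulS p q a b.
Proof.
by move=> ha hb; apply: mulS_poly => i j hi hj; rewrite truncPE //; lia.
Qed.

Lemma mulSA : associative (mulS : ps -> ps -> ps).
Proof.
move=> p q r; apply: psP => a b; set n := (a + b).+1.
have hT (f : ser) i j : (i <= a)%N -> (j <= b)%N -> (truncP n f)`_i`_j = f i j.
  by move=> hi hj; rewrite truncPE // /n; lia.
have hM (f g : ser) i j : (i <= a)%N -> (j <= b)%N ->
    (truncP n f * truncP n g)`_i`_j = mulS f g i j.
  by move=> hi hj; rewrite mulS_truncP // /n; lia.
by rewrite -(mulS_poly (hT p) (hM q r)) -(mulS_poly (hM p q) (hT r)) mulrA.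
Qed.

Lemma mulSC : commutative (mulS : ps -> ps -> ps).
Proof.
move=> p q; apply: psP => a b; set n := (a + b).+1.
have la : (a < n)%N by rewrite /n; lia.
have lb : (b < n)%N by rewrite /n; lia.
by rewrite -!(@mulS_truncP n) // mulrC.
Qed.

Lemma mul1S : left_id (oneS : ps) (mulS : ps -> ps -> ps).
Proof.
move=> p; apply: psP => a b; rewrite /mulS /oneS.
rewrite big_ord_recl big_ord_recl /= !subn0 mul1r.
rewrite !big1 ?addr0 // => [i _|i _]; last by rewrite mul0r.
by rewrite big1 // => j _; rewrite mul0r.
Qed.

Lemma mulSDl : left_distributive (mulS : ps -> ps -> ps) addS.
Proof.
move=> p q r; apply: psP => a b; rewrite /mulS /addS -big_split /=.
by apply: eq_bigr => i _; rewrite -big_split /=; apply: eq_bigr => j _; rewrite mulrDl.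
Qed.

Lemma oneS_neq0 : (oneS : ps) != 0.
Proof.
apply/eqP => /(congr1 (fun p : ps => p 0%N 0%N)).
by rewrite /oneS /= => /eqP; rewrite oner_eq0.
Qed.

HB.instance Definition _ :=
  GRing.Zmodule_isComNzRing.Build ps mulSA mulSC mul1S mulSDl oneS_neq0.

Lemma coefSD (p q : ps) a b : (p + q) a b = p a b + q a b. Proof. by []. Qed.
Lemma coefSN (p : ps) a b : (- p) a b = - p a b. Proof. by []. Qed.
Lemma coefSB (p q : ps) a b : (p - q) a b = p a b - q a b. Proof. by []. Qed.
Lemma coefS0 a b : (0 : ps) a b = 0. Proof. by []. Qed.
Lemma coefS1 a b : (1 : ps) a b = ((a == 0%N) && (b == 0%N))%:R. Proof. by []. Qed.
Lemma coefSM (p q : ps) a b : (p * q) a b =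
  \sum_(k < a.+1) \sum_(l < b.+1) p k l * q (a - k)%N (b - l)%N.
Proof. by []. Qed.
Lemma coefS_sum (I : Type) (r : seq I) (P : pred I) (F : I -> ps) a b :
  (\sum_(i <- r | P i) F i) a b = \sum_(i <- r | P i) F i a b.
Proof. by elim/big_rec2: _ => // i x y _ <-. Qed.

Lemma powSE (p : ps) n : powS p n = p ^+ n.
Proof. by elim: n => [|n IH] //; rewrite exprS -IH. Qed.

Definition cS (c : C) : ps := fun a b => if (a == 0%N) && (b == 0%N) then c else 0.

Lemma coef_cM c (p : ps) a b : (cS c * p) a b = c * p a b.
Proof.
rewrite coefSM big_ord_recl big_ord_recl /= !subn0 /cS /=.
rewrite !big1 ?addr0 // => [i _|i _]; last by rewrite mul0r.
by rewrite big1 // => j _; rewrite mul0r.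
Qed.

Lemma cS_is_additive : additive cS.
Proof. by move=> x y; apply: psP => a b; rewrite coefSB /cS; case: ifP => //; rewrite subr0. Qed.
Lemma cS_is_mult : multiplicative cS.
Proof.
split=> [x y|]; apply: psP => a b.
  by rewrite coef_cM /cS; case: ifP => //; rewrite mulr0.
by rewrite coefS1 /cS; case: ifP.
Qed.
HB.instance Definition _ := GRing.isAdditive.Build C ps cS cS_is_additive.
HB.instance Definition _ := GRing.isMultiplicative.Build C ps cS cS_is_mult.

Definition mono (i j : nat) : ps := fun a b => ((a == i) && (b == j))%:R.

Lemma coef_monoM i j (p : ps) a b :
  (mono i j * p) a b = if (i <= a)%N && (j <= b)%N then p (a - i)%N (b - j)%N else 0.
Proof.
rewrite coefSM; case: ifP => [/andP[hi hj]|h].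
  rewrite (bigD1 (Ordinal (hi : (i < a.+1)%N))) //=.
  rewrite (bigD1 (Ordinal (hj : (j < b.+1)%N))) //=.
  rewrite /mono !eqxx mul1r big1 ?addr0 => [|l hl]; last first.
    by rewrite -val_eqE /= in hl; rewrite (negPf hl) mul0r.
  rewrite big1 ?addr0 // => k hk; rewrite -val_eqE /= in hk.
  by rewrite big1 // => l _; rewrite (negPf hk) mul0r.
rewrite big1 // => k _; rewrite big1 // => l _; rewrite /mono.
case: eqP => [ki|]; last by rewrite mul0r.
case: eqP => [lj|]; last by rewrite andbF mul0r.
by move: h; rewrite -ki -lj -ltnS ltn_ord -ltnS ltn_ord.
Qed.

Lemma monoM i j k l : mono i j * mono k l = mono (i + k)%N (j + l)%N.
Proof.
apply: psP => a b; rewrite coef_monoM /mono.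
set e := (a == (i + k)%N) && (b == (j + l)%N); case: ifP => h.
  by have -> : ((a - i)%N == k) && ((b - j)%N == l) = e by rewrite /e; lia.
by have -> : e = false by rewrite /e; lia.
Qed.

Notation x1 := (X1 : ps).
Notation x2 := (X2 : ps).

Lemma monoX i j : mono i j = x1 ^+ i * x2 ^+ j.
Proof.
have h1 k : x1 ^+ k = mono k 0.
  elim: k => [|k IH]; first by [].
  by rewrite exprS IH -[x1]/(mono 1 0) monoM.
have h2 k : x2 ^+ k = mono 0 k.
  elim: k => [|k IH]; first by [].
  by rewrite exprS IH -[x2]/(mono 0 1) monoM.
by rewrite h1 h2 monoM addn0.
Qed.

(** * The adic filtration and continuous linear operators *)

Definition ord (n : nat) (p : ps) : Prop := forall a b, (a + b < n)%N -> p a b = 0.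

Lemma ordW m n p : (m <= n)%N -> ord n p -> ord m p.
Proof. by move=> mn h a b ab; apply: h; lia. Qed.
Lemma ord0n p : ord 0 p. Proof. by []. Qed.
Lemma ordD n p q : ord n p -> ord n q -> ord n (p + q).
Proof. by move=> h1 h2 a b ab; rewrite coefSD h1 ?h2 ?addr0. Qed.
Lemma ordN n p : ord n p -> ord n (- p).
Proof. by move=> h1 a b ab; rewrite coefSN h1 ?oppr0. Qed.
Lemma ordB n p q : ord n p -> ord n q -> ord n (p - q).
Proof. by move=> h1 h2; apply: ordD => //; apply: ordN. Qed.
Lemma ordM m n p q : ord m p -> ord n q -> ord (m + n) (p * q).
Proof.
move=> h1 h2 a b ab; rewrite coefSM big1 // => k _; rewrite big1 // => l _.
have := ltn_ord k; have := ltn_ord l; move=> hl hk.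
have [kl|kl] := ltnP (k + l) m; first by rewrite h1 ?mul0r.
by rewrite h2 ?mulr0 //; lia.
Qed.
Lemma ordMl n p q : ord n q -> ord n (p * q).
Proof. by move=> h; apply: (@ordM 0 n). Qed.
Lemma ordMr n p q : ord n p -> ord n (p * q).
Proof. by rewrite mulrC; apply: ordMl. Qed.
Lemma ordX m p n : ord m p -> ord (n * m) (p ^+ n).
Proof.
by move=> h; elim: n => [|n IH] //; rewrite exprS mulSn; apply: ordM.
Qed.
Lemma ord_sum n (I : Type) (r : seq I) (P : pred I) (F : I -> ps) :
  (forall i, P i -> ord n (F i)) -> ord n (\sum_(i <- r | P i) F i).
Proof. by move=> h; elim/big_rec: _ => // i x hi hx; apply: ordD => //; apply: h. Qed.
Lemma ord_eq p q : (forall n, ord n (p - q)) -> p = q.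
Proof.
move=> h; apply: psP => a b; apply/eqP; rewrite -subr_eq0 -coefSB.
by rewrite (h (a + b).+1).
Qed.
Lemma ord_trans n p q r : ord n (p - q) -> ord n (q - r) -> ord n (p - r).
Proof. by move=> h1 h2; have := ordD h1 h2; rewrite addrA subrK. Qed.
Lemma ord_sym n p q : ord n (p - q) -> ord n (q - p).
Proof. by move=> /ordN; rewrite opprB. Qed.
Lemma ord_coef n (p q : ps) a b : ord n (p - q) -> (a + b < n)%N -> p a b = q a b.
Proof. by move=> h ab; apply/eqP; rewrite -subr_eq0 -coefSB h. Qed.

Lemma ord1I (p : ps) : p 0%N 0%N = 0 -> ord 1 p.
Proof. by move=> h [|a] [|b]. Qed.

Lemma ord1_coef (p : ps) : ord 1 p -> p 0%N 0%N = 0.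
Proof. by apply. Qed.

Lemma coefM00 (p q : ps) : (p * q) 0%N 0%N = p 0%N 0%N * q 0%N 0%N.
Proof. by rewrite coefSM big_ord1 big_ord1. Qed.

Definition trunc n (p : ps) : ps := \sum_(i < n) \sum_(j < n) cS (p i j) * mono i j.

Lemma coef_trunc n p a b :
  trunc n p a b = if (a < n)%N && (b < n)%N then p a b else 0.
Proof.
rewrite /trunc coefS_sum; under eq_bigr do rewrite coefS_sum.
under eq_bigr do under eq_bigr do rewrite coef_cM.
case: ifP => [/andP[ha hb]|h].
  rewrite (bigD1 (Ordinal ha)) //= (bigD1 (Ordinal hb)) //= /mono !eqxx mulr1.
  rewrite big1 ?addr0 => [|j hj]; last first.
    by rewrite -val_eqE /= eq_sym in hj; rewrite (negPf hj) mulr0.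
  rewrite big1 ?addr0 // => i hi; rewrite -val_eqE /= eq_sym in hi.
  by rewrite big1 // => j _; rewrite (negPf hi) mulr0.
rewrite big1 // => i _; rewrite big1 // => j _; rewrite /mono.
have := ltn_ord i; have := ltn_ord j => hj hi.
by have -> : (a == i) && (b == j) = false; [lia | rewrite mulr0].
Qed.

Lemma ord_trunc n p : ord n (p - trunc n p).
Proof.
move=> a b ab; rewrite coefSB coef_trunc.
by have -> : (a < n)%N && (b < n)%N by [lia]; rewrite subrr.
Qed.

(** A fixed loss [c] of order is allowed, so that partial derivatives (loss 1) and the projections
    to the modes of index [k] (loss [k]) count as continuous. *)
Definition cont (F : ps -> ps) :=
  exists c, forall n p, ord (n + c) p -> ord n (F p).

Definition lcont (F : ps -> ps) : Prop :=
  [/\ forall p q, F (p + q) = F p + F q,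
      forall c p, F (cS c * p) = cS c * F p & cont F].

Section Lcont.
Variables (F : ps -> ps) (hF : lcont F).
Lemma lcD p q : F (p + q) = F p + F q. Proof. by case: hF. Qed.
Lemma lcZ c p : F (cS c * p) = cS c * F p. Proof. by case: hF. Qed.
Lemma lc0 : F 0 = 0.
Proof. by have := lcZ 0 0; rewrite raddf0 !mul0r. Qed.
Lemma lcN p : F (- p) = - F p.
Proof. by apply/eqP; rewrite -subr_eq0 opprK -lcD addNr lc0. Qed.
Lemma lcB p q : F (p - q) = F p - F q. Proof. by rewrite lcD lcN. Qed.
Lemma lc_sum (I : Type) (r : seq I) (P : pred I) (G : I -> ps) :
  F (\sum_(i <- r | P i) G i) = \sum_(i <- r | P i) F (G i).
Proof. by apply: (big_morph F lcD lc0). Qed.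
End Lcont.

Lemma lcont_id : lcont id.
Proof. by split=> //; exists 0%N => n p; rewrite addn0. Qed.
Lemma lcont_comp F G : lcont F -> lcont G -> lcont (F \o G).
Proof.
move=> hF hG; split=> [p q|c p|] /=.
- by rewrite (lcD hG) (lcD hF).
- by rewrite (lcZ hG) (lcZ hF).
have [_ _ [c hc]] := hF; have [_ _ [d hd]] := hG.
by exists (c + d)%N => n p; rewrite addnA => /hd /hc.
Qed.
Lemma lcont_add F G : lcont F -> lcont G -> lcont (fun p => F p + G p).
Proof.
move=> hF hG; split=> [p q|c p|] /=.
- by rewrite (lcD hG) (lcD hF) addrACA.
- by rewrite (lcZ hG) (lcZ hF) mulrDr.
have [_ _ [c hc]] := hF; have [_ _ [d hd]] := hG.
exists (c + d)%N => n p h; apply: ordD; [apply: hc | apply: hd]; apply: ordW h; lia.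
Qed.
Lemma lcont_mull r F : lcont F -> lcont (fun p => r * F p).
Proof.
move=> hF; split=> [p q|c p|] /=.
- by rewrite (lcD hF) mulrDr.
- by rewrite (lcZ hF) mulrCA.
have [_ _ [c hc]] := hF.
by exists c => n p h; apply: ordMl; apply: hc.
Qed.
Lemma lcont_mulr r F : lcont F -> lcont (fun p => F p * r).
Proof. by move=> /(lcont_mull r); congr lcont; apply: funext => p; rewrite mulrC. Qed.

(** Polynomials are dense for the adic topology. Identities between operators thereby reduce to
    monomials, and for multiplicative ones to the two variables. *)
Lemma density F G : lcont F -> lcont G ->
  (forall i j, F (mono i j) = G (mono i j)) -> forall p, F p = G p.
Proof.
move=> hF hG h p; have [_ _ [c hc]] := hF; have [_ _ [d hd]] := hG.
apply: ord_eq => n; pose m := (n + c + d)%N.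
have E : F (trunc m p) = G (trunc m p).
  rewrite !(lc_sum hF, lc_sum hG); apply: eq_bigr => i _.
  rewrite !(lc_sum hF, lc_sum hG); apply: eq_bigr => j _.
  by rewrite (lcZ hF) (lcZ hG) h.
have -> : F p - G p = F (p - trunc m p) - G (p - trunc m p).
  by rewrite (lcB hF) (lcB hG) E; ring.
have ht := @ord_trunc m p.
apply: ordB; [apply: hc | apply: hd]; apply: ordW ht; rewrite /m; lia.
Qed.

Lemma mono_ind (P : ps -> Prop) : P 1 -> P x1 -> P x2 ->
  (forall p q, P p -> P q -> P (p * q)) -> forall i j, P (mono i j).
Proof.
move=> h1 hx hy hM i j; rewrite monoX; apply: (hM).
  by elim: i => [|i IH] //; rewrite exprS; apply: (hM).
by elim: j => [|j IH] //; rewrite exprS; apply: (hM).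
Qed.

Definition pshom (F : ps -> ps) : Prop :=
  [/\ lcont F, F 1 = 1 & forall p q, F (p * q) = F p * F q].

Lemma homX F p n : pshom F -> F (p ^+ n) = F p ^+ n.
Proof.
by move=> [_ h1 hM]; elim: n => [|n IH]; rewrite ?expr0 // !exprS hM IH.
Qed.

Lemma homC F c : pshom F -> F (cS c) = cS c.
Proof. by move=> [hl h1 hM]; rewrite -[cS c]mulr1 (lcZ hl) h1. Qed.

Lemma hom_eq F G : pshom F -> pshom G -> F x1 = G x1 -> F x2 = G x2 ->
  forall p, F p = G p.
Proof.
move=> [hF F1 FM] [hG G1 GM] e1 e2; apply: (density hF hG).
apply: (@mono_ind (fun p => F p = G p)) => //; first by rewrite F1 G1.
by move=> p q ep eq; rewrite FM GM ep eq.
Qed.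

(** * Substitution of series *)

Definition cmp (f : ps) (g : fmap) : ps := compS f g.

Lemma sum_ord_widen (n m : nat) (F : nat -> C) : (n <= m)%N ->
  (forall i, (n <= i)%N -> F i = 0) -> \sum_(i < n) F i = \sum_(i < m) F i.
Proof.
move=> nm h; rewrite (big_ord_widen m F nm) big_mkcond; apply: eq_bigr => i _.
by case: ltnP => // /h ->.
Qed.

Section Comp.
Variables (g : fmap) (hg : fixes0 g).
Let g1 : ps := g.1.
Let g2 : ps := g.2.

Lemma fixes0_ord1 : ord 1 g1 /\ ord 1 g2.
Proof. by case: hg => h1 h2; split; apply: ord1I. Qed.

Lemma ord_powg i j : ord (i + j) (g1 ^+ i * g2 ^+ j).
Proof.
have [h1 h2] := fixes0_ord1.
by apply: ordM; [rewrite -[i in ord i _]muln1 | rewrite -[j in ord j _]muln1]; apply: ordX.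
Qed.

(** The truncation inside [compS] depends on the coefficient being read. As [g1 ^+ i * g2 ^+ j] has
    order at least [i + j], every larger box gives the same value, and a common box makes
    substitution visibly linear. *)
Lemma coef_cmp n f a b : (a + b < n)%N ->
  cmp f g a b = \sum_(i < n) \sum_(j < n) f i j * (g1 ^+ i * g2 ^+ j) a b.
Proof.
move=> abn; rewrite /cmp /compS; under eq_bigr do under eq_bigr do rewrite !powSE.
pose F i j := f i j * (g1 ^+ i * g2 ^+ j) a b.
have F0 i j : ((a + b).+1 <= i + j)%N -> F i j = 0.
  by move=> hij; rewrite /F (@ord_powg i j) ?mulr0 //; lia.
rewrite -/g1 -/g2 -[LHS]/(\sum_(i < (a + b).+1) \sum_(j < (a + b).+1) F i j).
rewrite (@sum_ord_widen _ n (fun i => \sum_(j < (a + b).+1) F i j)) //.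
  by apply: eq_bigr => i _; apply: sum_ord_widen => // j hj; apply: F0; lia.
by move=> i hi; apply: big1 => j _; apply: F0; lia.
Qed.

Lemma cmp_ord n f : ord n f -> ord n (cmp f g).
Proof.
move=> hf a b ab; rewrite (coef_cmp _ ab) big1 // => i _; rewrite big1 // => j _.
have [h|h] := ltnP (i + j) n; first by rewrite hf ?mul0r.
by rewrite (@ord_powg i j) ?mulr0 //; lia.
Qed.

Lemma cmp_lcont : lcont (cmp^~ g).
Proof.
split=> [p q|c p|].
- apply: psP => a b; rewrite coefSD !(@coef_cmp (a + b).+1) // -big_split /=.
  by apply: eq_bigr => i _; rewrite -big_split /=; apply: eq_bigr => j _; rewrite mulrDl.
- apply: psP => a b; rewrite coef_cM !(@coef_cmp (a + b).+1) // mulr_sumr.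
  apply: eq_bigr => i _; rewrite mulr_sumr; apply: eq_bigr => j _.
  by rewrite coef_cM mulrA.
by exists 0%N => n p; rewrite addn0; apply: cmp_ord.
Qed.

Lemma cmp_mono i j : cmp (mono i j) g = g1 ^+ i * g2 ^+ j.
Proof.
apply: psP => a b; pose n := (a + b + i + j).+1.
rewrite (@coef_cmp n); last by rewrite /n; lia.
have hi : (i < n)%N by rewrite /n; lia.
have hj : (j < n)%N by rewrite /n; lia.
rewrite (bigD1 (Ordinal hi)) //= (bigD1 (Ordinal hj)) //= /mono !eqxx mul1r.
rewrite big1 ?addr0 => [|k hk]; last first.
  by rewrite -val_eqE /= in hk; rewrite (negPf hk) mul0r.
rewrite big1 ?addr0 // => k hk; rewrite -val_eqE /= in hk.
by rewrite big1 // => l _; rewrite (negPf hk) mul0r.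
Qed.

Lemma cmp_x1 : cmp x1 g = g1.
Proof. by rewrite -[x1]/(mono 1 0) cmp_mono mulr1. Qed.
Lemma cmp_x2 : cmp x2 g = g2.
Proof. by rewrite -[x2]/(mono 0 1) cmp_mono mul1r. Qed.

Lemma cmp_hom : pshom (cmp^~ g).
Proof.
have hl := cmp_lcont.
split=> //; first by rewrite -[1]/(mono 0 0) cmp_mono mulr1.
move=> p q; move: p.
apply: (@density (fun p => cmp (p * q) g) (fun p => cmp p g * cmp q g)).
- exact: (lcont_comp hl (lcont_mulr q lcont_id)).
- exact: lcont_mulr.
move=> i j; move: q.
apply: (@density (fun q => cmp (mono i j * q) g) (fun q => cmp (mono i j) g * cmp q g)).
- exact: (lcont_comp hl (lcont_mull (mono i j) lcont_id)).
- exact: lcont_mull.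
by move=> k l; rewrite monoM !cmp_mono !exprD; ring.
Qed.

Lemma coef00_cmp f : cmp f g 0%N 0%N = f 0%N 0%N.
Proof.
rewrite (@coef_cmp 1) // !big_ord1 !expr0 mulr1 coefS1 /=.
by rewrite mulr1.
Qed.
End Comp.

Lemma fixes0_idM : fixes0 idM. Proof. by []. Qed.

Lemma cmp_id f : cmp f idM = f.
Proof.
move: f; apply: (hom_eq (cmp_hom fixes0_idM)).
- by split=> //; apply: lcont_id.
- by rewrite cmp_x1.
- by rewrite cmp_x2.
Qed.

Lemma fixes0_compM f g : fixes0 f -> fixes0 g -> fixes0 (compM f g).
Proof.
by move=> [h1 h2] hg; split; rewrite /compM /= -/(cmp _ _) coef00_cmp.
Qed.

Lemma hom_comp F G : pshom F -> pshom G -> pshom (F \o G).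
Proof.
move=> [hF F1 FM] [hG G1 GM]; split; first exact: lcont_comp.
- by rewrite /= G1.
- by move=> p q; rewrite /= GM FM.
Qed.

Lemma cmpA f g k : fixes0 g -> fixes0 k -> cmp (cmp f g) k = cmp f (compM g k).
Proof.
move=> hg hk; have hgk := fixes0_compM hg hk; move: f.
apply: (@hom_eq (cmp^~ k \o cmp^~ g) (cmp^~ (compM g k))).
- exact: hom_comp (cmp_hom hk) (cmp_hom hg).
- exact: cmp_hom.
- by rewrite /= !cmp_x1.
- by rewrite /= !cmp_x2.
Qed.

Lemma compMA f g k : fixes0 g -> fixes0 k ->
  compM (compM f g) k = compM f (compM g k).
Proof.
by move=> hg hk; rewrite [LHS]/compM -!/(cmp _ _) /= -!/(cmp _ _) !cmpA.
Qed.

Lemma compM_idr f : compM f idM = f.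
Proof. by case: f => f1 f2; rewrite /compM -!/(cmp _ _) !cmp_id. Qed.
Lemma compM_idl f : fixes0 f -> compM idM f = f.
Proof.
move=> hf; rewrite /compM /= -!/(cmp _ _).
by have -> := cmp_x1 hf; have -> := cmp_x2 hf; case: f hf.
Qed.

(** * Conjugation of the coefficients *)

Definition cj (p : ps) : ps := conjS p.

Lemma cjD p q : cj (p + q) = cj p + cj q.
Proof. by apply: psP => a b; rewrite coefSD /cj /conjS rmorphD. Qed.
Lemma cjN p : cj (- p) = - cj p.
Proof. by apply: psP => a b; rewrite coefSN /cj /conjS rmorphN. Qed.
Lemma cjB p q : cj (p - q) = cj p - cj q. Proof. by rewrite cjD cjN. Qed.
Lemma cjM p q : cj (p * q) = cj p * cj q.
Proof.
apply: psP => a b; rewrite /cj /conjS !coefSM rmorph_sum; apply: eq_bigr => k _.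
by rewrite rmorph_sum; apply: eq_bigr => l _; rewrite rmorphM.
Qed.
Lemma cj1 : cj 1 = 1.
Proof. by apply: psP => a b; rewrite /cj /conjS coefS1 rmorph_nat. Qed.
Lemma cjC c : cj (cS c) = cS c^*.
Proof. by apply: psP => a b; rewrite /cj /conjS /cS; case: ifP => //; rewrite rmorph0. Qed.
Lemma cjK : involutive cj.
Proof. by move=> p; apply: psP => a b; rewrite /cj /conjS conjCK. Qed.
Lemma cj_ord n p : ord n p -> ord n (cj p).
Proof. by move=> h a b ab; rewrite /cj /conjS h // rmorph0. Qed.
Lemma cjX p n : cj (p ^+ n) = cj p ^+ n.
Proof. by elim: n => [|n IH]; rewrite ?cj1 // !exprS cjM IH. Qed.
Lemma cj_x1 : cj x1 = x1.
Proof. by apply: psP => a b; rewrite /cj /conjS rmorph_nat. Qed.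
Lemma cj_x2 : cj x2 = x2.
Proof. by apply: psP => a b; rewrite /cj /conjS rmorph_nat. Qed.

Lemma fixes0_conjM f : fixes0 f -> fixes0 (conjM f).
Proof. by move=> [h1 h2]; split; rewrite /= /conjS ?h1 ?h2 rmorph0. Qed.

Lemma cj_cmp f g : fixes0 g -> cj (cmp f g) = cmp (cj f) (conjM g).
Proof.
move=> hg; apply: psP => a b.
rewrite {1}/cj /conjS (coef_cmp hg _ (ltnSn _)).
rewrite (coef_cmp (fixes0_conjM hg) _ (ltnSn _)) rmorph_sum.
apply: eq_bigr => i _; rewrite rmorph_sum; apply: eq_bigr => j _.
by rewrite rmorphM -[conjM g]/(cj _, cj _) /= -!cjX -cjM.
Qed.

Lemma conjM_compM f g : fixes0 g -> conjM (compM f g) = compM (conjM f) (conjM g).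
Proof.
move=> hg; rewrite [LHS]/conjM /= -!/(cj _) -!/(cmp _ _) !cj_cmp //.
Qed.

Lemma conjMK f : conjM (conjM f) = f.
Proof. by case: f => f1 f2; rewrite /conjM /= -!/(cj _) !cjK. Qed.

(** * Derivations and Jacobian determinants *)

(* Leibniz' rule is read off the coefficients for [w1 = x1 * d1] and [w2 = x2 * d2];
   it follows for [d1] and [d2] by cancellation. *)
Definition w1 (p : ps) : ps := fun a b => a%:R * p a b.
Definition w2 (p : ps) : ps := fun a b => b%:R * p a b.
Definition d1 (p : ps) : ps := fun a b => a.+1%:R * p a.+1 b.
Definition d2 (p : ps) : ps := fun a b => b.+1%:R * p a b.+1.

Definition derivation (d : ps -> ps) : Prop :=
  lcont d /\ forall p q, d (p * q) = d p * q + p * d q.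

Lemma derivation1 d : derivation d -> d 1 = 0.
Proof.
by move=> [hl hM]; have := hM 1 1; rewrite !mulr1 mul1r => /(canLR (addrK _)) <-; rewrite subrr.
Qed.

Lemma w1_deriv : derivation w1.
Proof.
split.
  split=> [p q|c p|].
  - by apply: psP => a b; rewrite /w1 !coefSD mulrDr.
  - by apply: psP => a b; rewrite coef_cM /w1 coef_cM mulrCA.
  by exists 0%N => n p; rewrite addn0 => h a b ab; rewrite /w1 h ?mulr0.
move=> p q; apply: psP => a b; rewrite coefSD /w1 !coefSM mulr_sumr -big_split /=.
apply: eq_bigr => k _; rewrite mulr_sumr -big_split /=; apply: eq_bigr => l _.
have hk : (k <= a)%N by rewrite -ltnS.
by rewrite natrB //; ring.
Qed.

Lemma w2_deriv : derivation w2.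
Proof.
split.
  split=> [p q|c p|].
  - by apply: psP => a b; rewrite /w2 !coefSD mulrDr.
  - by apply: psP => a b; rewrite coef_cM /w2 coef_cM mulrCA.
  by exists 0%N => n p; rewrite addn0 => h a b ab; rewrite /w2 h ?mulr0.
move=> p q; apply: psP => a b; rewrite coefSD /w2 !coefSM mulr_sumr -big_split /=.
apply: eq_bigr => k _; rewrite mulr_sumr -big_split /=; apply: eq_bigr => l _.
have hl : (l <= b)%N by rewrite -ltnS.
by rewrite natrB //; ring.
Qed.

Lemma coef_x1M p a b : (x1 * p) a b = if a is a'.+1 then p a' b else 0.
Proof.
rewrite -[x1]/(mono 1 0) coef_monoM.
by case: a => [|a] //=; rewrite subSS !subn0.
Qed.
Lemma coef_x2M p a b : (x2 * p) a b = if b is b'.+1 then p a b' else 0.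
Proof.
rewrite -[x2]/(mono 0 1) coef_monoM.
by case: b => [|b] //=; rewrite subSS !subn0.
Qed.
Lemma x1_inj p q : x1 * p = x1 * q -> p = q.
Proof.
move=> e; apply: psP => a b; have := congr1 (fun f : ps => f a.+1 b) e.
by rewrite !coef_x1M.
Qed.
Lemma x2_inj p q : x2 * p = x2 * q -> p = q.
Proof.
move=> e; apply: psP => a b; have := congr1 (fun f : ps => f a b.+1) e.
by rewrite !coef_x2M.
Qed.
Lemma x1_d1 p : x1 * d1 p = w1 p.
Proof. by apply: psP => -[|a] b; rewrite coef_x1M /w1 ?mul0r. Qed.
Lemma x2_d2 p : x2 * d2 p = w2 p.
Proof. by apply: psP => a [|b]; rewrite coef_x2M /w2 ?mul0r. Qed.

Lemma d1_deriv : derivation d1.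
Proof.
split.
  split=> [p q|c p|].
  - by apply: psP => a b; rewrite /d1 !coefSD mulrDr.
  - by apply: psP => a b; rewrite coef_cM /d1 coef_cM mulrCA.
  by exists 1%N => n p h a b ab; rewrite /d1 h ?mulr0 //; lia.
move=> p q; apply: x1_inj; rewrite x1_d1.
by case: w1_deriv => _ ->; rewrite -!x1_d1; ring.
Qed.
Lemma d2_deriv : derivation d2.
Proof.
split.
  split=> [p q|c p|].
  - by apply: psP => a b; rewrite /d2 !coefSD mulrDr.
  - by apply: psP => a b; rewrite coef_cM /d2 coef_cM mulrCA.
  by exists 1%N => n p h a b ab; rewrite /d2 h ?mulr0 //; lia.
move=> p q; apply: x2_inj; rewrite x2_d2.
by case: w2_deriv => _ ->; rewrite -!x2_d2; ring.
Qed.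

Lemma d1_d2 p : d1 (d2 p) = d2 (d1 p).
Proof. by apply: psP => a b; rewrite /d1 /d2 mulrCA. Qed.

Lemma d1_x1 : d1 x1 = 1.
Proof. by apply: psP => -[|a] b; rewrite /d1 coefS1 /X1 /= ?mul1r ?mulr0. Qed.
Lemma d1_x2 : d1 x2 = 0.
Proof. by apply: psP => a b; rewrite /d1 coefS0 /X2 /= mulr0. Qed.
Lemma d2_x2 : d2 x2 = 1.
Proof. by apply: psP => a [|b]; rewrite /d2 coefS1 /X2 /= ?andbT ?andbF ?mul1r ?mulr0. Qed.
Lemma d2_x1 : d2 x1 = 0.
Proof. by apply: psP => a b; rewrite /d2 coefS0 /X1 /= andbF mulr0. Qed.

(** Both sides are continuous and linear in [f] and obey the same product rule, so the two variables
    suffice. An arbitrary derivation [d] covers both partial derivatives at once. *)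
Lemma chain_rule d f g : derivation d -> fixes0 g ->
  d (cmp f g) = cmp (d1 f) g * d g.1 + cmp (d2 f) g * d g.2.
Proof.
move=> hd hg; have [hdl hdM] := hd; have [hl h1 hM] := cmp_hom hg.
have [h1l h1M] := d1_deriv; have [h2l h2M] := d2_deriv.
move: f; apply: (@density (fun f => d (cmp f g))
  (fun f => cmp (d1 f) g * d g.1 + cmp (d2 f) g * d g.2)).
- exact: (lcont_comp hdl hl).
- by apply: lcont_add; apply: lcont_mulr; [apply: (lcont_comp hl h1l) | apply: (lcont_comp hl h2l)].
apply: (@mono_ind (fun f => d (cmp f g) =
  cmp (d1 f) g * d g.1 + cmp (d2 f) g * d g.2)).
- by rewrite h1 (derivation1 hd) (derivation1 d1_deriv) (derivation1 d2_deriv) (lc0 hl) !mul0r addr0.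
- by rewrite cmp_x1 // d1_x1 d2_x1 h1 (lc0 hl) mul1r mul0r addr0.
- by rewrite cmp_x2 // d1_x2 d2_x2 h1 (lc0 hl) mul1r mul0r add0r.
move=> p q hp hq; rewrite hM hdM hp hq h1M h2M !(lcD hl) !hM; ring.
Qed.

Definition jac (p q : ps) : ps := d1 p * d2 q - d2 p * d1 q.

Lemma jac_cmp f1 f2 g : fixes0 g ->
  jac (cmp f1 g) (cmp f2 g) = cmp (jac f1 f2) g * jac g.1 g.2.
Proof.
move=> hg; have [hl h1 hM] := cmp_hom hg.
rewrite /jac !(chain_rule _ d1_deriv hg) !(chain_rule _ d2_deriv hg).
by rewrite (lcB hl) !hM; ring.
Qed.

(** Banach's fixed point theorem for the adic metric: the coefficient of index [(a, b)] no longer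
    changes after [a + b + 1] iterations from 0. *)
Lemma adic_fixpoint (Phi : ps -> ps) :
  (forall n p q, ord n (p - q) -> ord n.+1 (Phi p - Phi q)) ->
  exists p, Phi p = p.
Proof.
move=> h; pose u n := iter n Phi 0.
have u_step n : ord n (u n.+1 - u n).
  by elim: n => [|n IH] //; apply: h.
have u_cauchy n m : ord n (u (n + m)%N - u n).
  elim: m => [|m IH]; first by rewrite addn0 subrr.
  rewrite addnS; apply: ord_trans IH; apply: ordW (u_step _); lia.
pose p : ps := fun a b => u (a + b).+1 a b.
have hp n : ord n (p - u n).
  move=> a b ab; rewrite coefSB /p; apply/eqP; rewrite subr_eq0 eq_sym; apply/eqP.
  have -> : n = ((a + b).+1 + (n - (a + b).+1))%N by lia.
  exact: (ord_coef (u_cauchy _ _)).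
exists p; apply: ord_eq => n.
apply: (@ord_trans _ _ (u n.+1)); first by apply: (ordW _ (h _ _ _ (hp n))).
by apply: ord_sym; apply: ordW (hp n.+1).
Qed.

(** * Exponentials of operators *)

(** The sum of a series whose [n]-th term has order at least [n]; under that condition the omitted
    terms do not reach the coefficient being read. *)
Definition psum (u : nat -> ps) : ps := fun a b => \sum_(n < (a + b).+1) u n a b.

Lemma ord_psum m (u : nat -> ps) : (forall n, ord n (u n)) ->
  ord m (psum u - \sum_(n < m) u n).
Proof.
move=> h a b ab; rewrite coefSB coefS_sum /psum.
rewrite (@sum_ord_widen (a + b).+1 m (fun n => u n a b)) ?subrr //.
by move=> i hi; apply: h; lia.
Qed.

Definition ifact (n : nat) : C := (n`!%:R)^-1.
Lemma fact_neq0 n : (n`!%:R : C) != 0.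
Proof. by rewrite pnatr_eq0 -lt0n fact_gt0. Qed.

Definition expo (A : ps -> ps) (f : ps) : ps :=
  psum (fun n => cS (ifact n) * iter n A f).

Definition raises (k : nat) (A : ps -> ps) : Prop :=
  forall n p, ord n p -> ord (n + k) (A p).

Lemma raises_iter k A n m p : raises k A -> ord m p -> ord (m + n * k) (iter n A p).
Proof.
move=> h hp; elim: n => [|n IH]; first by rewrite addn0.
by rewrite mulSnr addnA; apply: h.
Qed.

Lemma raises_ord k A n p : (0 < k)%N -> raises k A -> ord n (iter n A p).
Proof.
move=> k0 h; have := raises_iter (n := n) h (@ord0n p); apply: ordW.
by rewrite add0n -{1}(muln1 n) leq_mul2l k0 orbT.
Qed.

Lemma lcont_iter A n : lcont A -> lcont (iter n A).
Proof.
move=> hA; elim: n => [|n IH]; first exact: lcont_id.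
exact: (lcont_comp hA IH).
Qed.

Lemma sum_triangle (V : nmodType) (F : nat -> nat -> V) m :
  \sum_(i < m) \sum_(j < m - i) F i j = \sum_(n < m) \sum_(i < n.+1) F i (n - i)%N.
Proof.
elim: m => [|m IH]; first by rewrite !big_ord0.
rewrite [RHS]big_ord_recr /= -IH.
have -> : \sum_(i < m) \sum_(j < m - i) F i j = \sum_(i < m.+1) \sum_(j < m - i) F i j.
  by rewrite [RHS]big_ord_recr /= subnn big_ord0 addr0.
rewrite -big_split /=; apply: eq_bigr => i _.
have hi : (i <= m)%N by rewrite -ltnS.
by rewrite subSn // big_ord_recr.
Qed.

Lemma ord_sum_triangle (F : nat -> nat -> ps) m : (forall i j, ord (i + j) (F i j)) ->
  ord m (\sum_(i < m) \sum_(j < m) F i j - \sum_(n < m) \sum_(i < n.+1) F i (n - i)%N).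
Proof.
move=> h; rewrite -sum_triangle -sumrB; apply: ord_sum => i _.
rewrite (big_ord_widen m (F i) (leq_subr i m)) [X in _ - X]big_mkcond -sumrB.
apply: ord_sum => j _; case: ltnP => hj; first by rewrite subrr.
by rewrite subr0; apply: ordW (h i j); lia.
Qed.

Lemma pascal_sum n (f : nat -> ps) :
  \sum_(i < n.+2) f i *+ 'C(n.+1, i) =
  \sum_(i < n.+1) f i *+ 'C(n, i) + \sum_(i < n.+1) f i.+1 *+ 'C(n, i).
Proof.
rewrite big_ord_recl bin0.
under eq_bigr do rewrite lift0 binS mulrnDr.
rewrite big_split /= addrA; congr (_ + _).
have -> : \sum_(i < n.+1) f i *+ 'C(n, i) = \sum_(i < n.+2) f i *+ 'C(n, i).
  by rewrite [RHS]big_ord_recr /= bin_small // mulr0n addr0.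
by rewrite [RHS]big_ord_recl bin0.
Qed.

Section Core.
Variables (L : ps -> ps) (hL : lcont L).

Lemma binomial_array n (a : nat -> nat -> ps) :
  (forall i j, a i.+1 j + a i j.+1 = L (a i j)) ->
  \sum_(i < n.+1) a i (n - i)%N *+ 'C(n, i) = iter n L (a 0 0)%N.
Proof.
elim: n a => [|n IH] a h; first by rewrite big_ord1.
rewrite (@pascal_sum n (fun i => a i (n.+1 - i)%N)) iterSr -h addrC.
rewrite (lcD (lcont_iter n hL)); congr (_ + _).
  have := IH (fun i j => a i.+1 j) (fun i j => h i.+1 j).
  by move=> <-; apply: eq_bigr => i _; rewrite subSS.
have := IH (fun i j => a i j.+1) (fun i j => h i j.+1).
by move=> <-; apply: eq_bigr => i _; rewrite subSn // -ltnS.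
Qed.

Lemma ifact_bin n i : (i <= n)%N -> ifact i * ifact (n - i) = ifact n * 'C(n, i)%:R.
Proof.
move=> hi; rewrite /ifact -(bin_fact hi) !natrM.
have h1 := fact_neq0 i; have h2 := fact_neq0 (n - i).
have h3 : ('C(n, i)%:R : C) != 0 by rewrite pnatr_eq0 -lt0n bin_gt0.
by field; rewrite h1 h2 h3.
Qed.

(** An abstract form of exp(X + Y) = exp X exp Y for commuting X and Y: [a i j] stands for X^i Y^j
    applied to a starting value and [L] for X + Y. It yields the multiplicativity of the exponential
    of a derivation, the addition law for [expp], the inverse of a flow, and the transport of
    Jacobians by a flow. *)
Lemma exp_array (a : nat -> nat -> ps) :
  (forall i j, a i.+1 j + a i j.+1 = L (a i j)) ->
  (forall i j, ord (i + j) (a i j)) ->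
  forall m, ord m (\sum_(i < m) \sum_(j < m) cS (ifact i) * (cS (ifact j) * a i j)
                   - expo L (a 0 0)%N).
Proof.
move=> h ha m.
pose F i j := cS (ifact i) * (cS (ifact j) * a i j).
have hF i j : ord (i + j) (F i j) by do 2 apply: ordMl.
apply: ord_trans (ord_sum_triangle (m := m) hF) _.
have E n : \sum_(i < n.+1) F i (n - i)%N = cS (ifact n) * iter n L (a 0 0)%N.
  rewrite -binomial_array // mulr_sumr; apply: eq_bigr => i _.
  have hi : (i <= n)%N by rewrite -ltnS.
  rewrite /F mulrA -rmorphM ifact_bin // rmorphM rmorph_nat -mulrA; congr (_ * _).
  by rewrite mulr_natl.
under eq_bigr do rewrite E.
apply: ord_sym; apply: ord_psum => n; rewrite -E; apply: ord_sum => i _.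
by apply: ordW (hF i (n - i)%N); have := ltn_ord i; lia.
Qed.
End Core.

Section Expo.
Variables (A : ps -> ps) (hA : lcont A) (kA : raises 1 A).

Lemma expo_term_ord f n : ord n (cS (ifact n) * iter n A f).
Proof. by apply: ordMl; apply: (raises_ord _ (ltn0Sn 0) kA). Qed.

Lemma ord_expo m f : ord m (expo A f - \sum_(n < m) cS (ifact n) * iter n A f).
Proof. by apply: ord_psum; apply: expo_term_ord. Qed.

Lemma expo_ord n f : ord n f -> ord n (expo A f).
Proof.
move=> hf; have h := @ord_expo n f.
have -> : expo A f = (expo A f - \sum_(k < n) cS (ifact k) * iter k A f) +
   \sum_(k < n) cS (ifact k) * iter k A f by rewrite subrK.
apply: ordD => //; apply: ord_sum => k _; apply: ordMl.
by apply: ordW (raises_iter (n := k) kA hf); lia.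
Qed.

Lemma expo_lcont : lcont (expo A).
Proof.
split=> [p q|c p|]; last by exists 0%N => n p; rewrite addn0; apply: expo_ord.
  apply: psP => a b; rewrite coefSD /expo /psum -big_split /=.
  by apply: eq_bigr => n _; rewrite (lcD (lcont_iter n hA)) !coef_cM coefSD mulrDr.
apply: psP => a b; rewrite coef_cM /expo /psum mulr_sumr.
by apply: eq_bigr => n _; rewrite (lcZ (lcont_iter n hA)) !coef_cM mulrCA.
Qed.

Lemma expo_fix f : A f = 0 -> expo A f = f.
Proof.
move=> h; apply: ord_eq => m; apply: (ord_trans (@ord_expo m f)).
case: m => [|m] //; rewrite big_ord_recl /= big1 ?addr0.
  by rewrite /ifact fact0 invr1 rmorph1 mul1r subrr.
move=> i _; rewrite -iterS iterSr h.
by rewrite (lc0 (lcont_iter i hA)) mulr0.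
Qed.
End Expo.

(** [c] is the order that [B] may lose: 0 for the product, 1 for the Jacobian. The last hypothesis
    asks that the iterates regain whatever order [B] has lost. *)
Lemma expo_bil (B : ps -> ps -> ps) (A A' L : ps -> ps) c f g :
  (forall q, lcont (B^~ q)) -> (forall p, lcont (B p)) ->
  (forall n p q, ord (n + c) p -> ord n (B p q)) ->
  (forall n p q, ord (n + c) q -> ord n (B p q)) ->
  lcont A -> raises 1 A -> lcont A' -> raises 1 A' -> lcont L ->
  (forall p q, B (A p) q + B p (A' q) = L (B p q)) ->
  (forall i j, ord (i + j) (B (iter i A f) (iter j A' g))) ->
  B (expo A f) (expo A' g) = expo L (B f g).
Proof.
move=> B1 B2 c1 c2 hA kA hA' kA' hL hB ho; apply: ord_eq => m.
pose M := (m + c)%N.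
pose SA := \sum_(i < M) cS (ifact i) * iter i A f.
pose SA' := \sum_(i < M) cS (ifact i) * iter i A' g.
have e1 : ord m (B (expo A f) (expo A' g) - B SA SA').
  have -> : B (expo A f) (expo A' g) - B SA SA' =
    B (expo A f - SA) (expo A' g) + B SA (expo A' g - SA').
    by rewrite (lcB (B1 _)) (lcB (B2 _)); ring.
  by apply: ordD; [apply: c1 | apply: c2]; apply: ord_expo.
apply: (ord_trans e1).
have -> : B SA SA' = \sum_(i < M) \sum_(j < M)
    cS (ifact i) * (cS (ifact j) * B (iter i A f) (iter j A' g)).
  rewrite /SA (lc_sum (B1 _)); apply: eq_bigr => i _.
  rewrite (lcZ (B1 _)) /SA' (lc_sum (B2 _)) mulr_sumr; apply: eq_bigr => j _.
  by rewrite (lcZ (B2 _)).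
apply: (@ordW _ M); first by rewrite /M; lia.
apply: (@exp_array L hL (fun i j => B (iter i A f) (iter j A' g))) => //.
by move=> i j; rewrite !iterS hB.
Qed.

Lemma expo_inverse A A' f :
  lcont A -> raises 1 A -> lcont A' -> raises 1 A' ->
  (forall p, A' p = - A p) -> expo A (expo A' f) = f.
Proof.
move=> hA kA hA' kA' hN; apply: ord_eq => m.
pose S := \sum_(j < m) cS (ifact j) * iter j A' f.
have hl := expo_lcont hA kA.
have e1 : ord m (expo A (expo A' f) - expo A S).
  by rewrite -(lcB hl); apply: expo_ord => //; apply: ord_expo.
apply: (ord_trans e1); apply: (ord_trans (@ord_expo A kA m S)).
have -> : \sum_(n < m) cS (ifact n) * iter n A S =
  \sum_(i < m) \sum_(j < m) cS (ifact i) * (cS (ifact j) * iter i A (iter j A' f)).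
  apply: eq_bigr => i _; rewrite /S (lc_sum (lcont_iter i hA)) mulr_sumr.
  by apply: eq_bigr => j _; rewrite (lcZ (lcont_iter i hA)).
(* The two generators cancel, so the array obeys the recursion of [exp_array] for the zero operator,
   whose exponential is the identity. *)
have h0 : lcont (fun=> 0 : ps).
  by split=> [p q|c p|]; rewrite ?addr0 ?mulr0 //; exists 0%N.
have e0 : expo (fun=> 0) f = f by rewrite (expo_fix h0).
rewrite -[X in _ - X]e0.
apply: (@exp_array (fun=> 0) h0 (fun i j => iter i A (iter j A' f))) => i j.
  rewrite iterSr -(lcD (lcont_iter i hA)) /= hN addrN.
  by rewrite (lc0 (lcont_iter i hA)).
have := raises_iter (n := i) kA (raises_ord (n := j) f (ltn0Sn 0) kA').
by apply: ordW; lia.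
Qed.

Lemma expo_hom D : derivation D -> raises 1 D -> pshom (expo D).
Proof.
move=> [hD DM] kD; split; first exact: expo_lcont.
  by apply: expo_fix => //; apply: derivation1.
move=> p q; symmetry; apply: (@expo_bil (fun p q => p * q) D D D 0) => //.
- by move=> r; apply: lcont_mulr lcont_id.
- by move=> r; apply: lcont_mull lcont_id.
- by move=> n r t; rewrite addn0; apply: ordMr.
- by move=> n r t; rewrite addn0; apply: ordMl.
- by move=> i j; apply: ordM; apply: (raises_ord _ (ltn0Sn 0) kD).
Qed.

(** * Exponentials and logarithms of series *)

Definition expp (p : ps) : ps := psum (fun n => cS (ifact n) * p ^+ n).

Lemma iter_mul (p : ps) n f : iter n ( *%R p) f = p ^+ n * f.
Proof. by elim: n => [|n IH]; rewrite ?mul1r // iterS IH mulrA -exprS. Qed.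

Lemma mul_raises p : ord 1 p -> raises 1 ( *%R p).
Proof. by move=> h n q hq; rewrite addnC; apply: ordM. Qed.

Lemma mul_lcont p : lcont ( *%R p).
Proof. exact: lcont_mull lcont_id. Qed.

Lemma expp_expo p f : ord 1 p -> expo ( *%R p) f = expp p * f.
Proof.
move=> hp; apply: ord_eq => m; apply: (ord_trans (@ord_expo _ (mul_raises hp) m f)).
under eq_bigr do rewrite iter_mul mulrA.
rewrite -mulr_suml -mulrBl; apply: ordMr; apply: ord_sym; apply: ord_psum => n.
by apply: ordMl; rewrite -[n in ord n _]muln1; apply: ordX.
Qed.

Lemma ord_expp m p : ord 1 p -> ord m (expp p - \sum_(n < m) cS (ifact n) * p ^+ n).
Proof.
by move=> hp; apply: ord_psum => n; apply: ordMl; rewrite -[n in ord n _]muln1; apply: ordX.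
Qed.

Lemma exppE p : ord 1 p -> expp p = expo ( *%R p) 1.
Proof. by move=> hp; rewrite expp_expo // mulr1. Qed.

Lemma exppD p q : ord 1 p -> ord 1 q -> expp (p + q) = expp p * expp q.
Proof.
move=> hp hq; rewrite !exppE //; last exact: ordD.
rewrite (@expo_bil (fun p q => p * q) _ _ ( *%R (p + q)) 0) ?mulr1 //.
- by move=> r; apply: lcont_mulr lcont_id.
- exact: mul_lcont.
- by move=> n r t; rewrite addn0; apply: ordMr.
- by move=> n r t; rewrite addn0; apply: ordMl.
- exact: mul_lcont.
- exact: mul_raises.
- exact: mul_lcont.
- exact: mul_raises.
- exact: mul_lcont.
- by move=> r t; ring.
- by move=> i j; apply: ordM; apply: (raises_ord _ (ltn0Sn 0)); apply: mul_raises.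
Qed.

Lemma expp0 : expp 0 = 1.
Proof.
by rewrite exppE // expo_fix ?mul0r //; [apply: mul_lcont | apply: mul_raises].
Qed.

Lemma exppNK p : ord 1 p -> expp p * expp (- p) = 1.
Proof. by move=> hp; rewrite -exppD ?subrr ?expp0 //; apply: ordN. Qed.

Lemma exppMn p n : ord 1 p -> expp (p *+ n) = expp p ^+ n.
Proof.
move=> hp; have hn k : ord 1 (p *+ k).
  by elim: k => [|k IH] //; rewrite mulrS; apply: ordD.
by elim: n => [|n IH]; rewrite ?mulr0n ?expp0 // mulrS exppD // IH exprS.
Qed.

Lemma coef00_expp p : expp p 0%N 0%N = 1.
Proof.
by rewrite /expp /psum big_ord1 coef_cM /ifact fact0 invr1 mul1r expr0 coefS1.
Qed.

Lemma hom_expp F p : pshom F -> (forall n q, ord n q -> ord n (F q)) -> ord 1 p ->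
  F (expp p) = expp (F p).
Proof.
move=> hF Fo hp; have [hl _ _] := hF; apply: ord_eq => m.
have := Fo _ _ (@ord_expp m p hp); rewrite (lcB hl) => h.
apply: (ord_trans h); rewrite (lc_sum hl); apply: ord_sym.
under eq_bigr do rewrite (lcZ hl) homX //.
by apply: ord_expp; apply: Fo.
Qed.

Lemma cmp_expp g p : fixes0 g -> ord 1 p -> cmp (expp p) g = expp (cmp p g).
Proof.
by move=> hg; apply: (hom_expp (cmp_hom hg)) => n q; apply: (cmp_ord hg).
Qed.

Lemma cj_sum (I : Type) (r : seq I) (P : pred I) (F : I -> ps) :
  cj (\sum_(i <- r | P i) F i) = \sum_(i <- r | P i) cj (F i).
Proof. by apply: (big_morph cj cjD); apply: psP => a b; rewrite /cj /conjS coefS0 rmorph0. Qed.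

Lemma conj_ifact n : (ifact n)^* = ifact n.
Proof. by rewrite /ifact fmorphV rmorph_nat. Qed.

Lemma cj_expp p : ord 1 p -> cj (expp p) = expp (cj p).
Proof.
move=> hp; apply: ord_eq => m.
have := cj_ord (@ord_expp m p hp); rewrite cjB cj_sum => h.
apply: (ord_trans h); apply: ord_sym.
under eq_bigr do rewrite cjM cjX cjC conj_ifact.
by apply: ord_expp; apply: cj_ord.
Qed.

(** Near 0 the exponential minus 1 is its argument times a unit. Injectivity of [expp], existence of
    logarithms and their order in [hh] all rest on this factorisation. *)
Lemma expp_unit_factor p : ord 1 p -> exists q : ps, q 0%N 0%N = 1 /\ expp p = 1 + p * q.
Proof.
move=> hp; exists (psum (fun n => cS (ifact n.+1) * p ^+ n)); split.
  by rewrite /psum big_ord1 coef_cM /ifact invr1 mul1r expr0 coefS1.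
apply: ord_eq => m; apply: (ord_trans (@ordW m m.+1 _ (leqnSn m) (@ord_expp m.+1 p hp))).
set T := psum _; pose S := \sum_(i < m) cS (ifact i.+1) * p ^+ i.
have -> : \sum_(n < m.+1) cS (ifact n) * p ^+ n = 1 + p * S.
  rewrite big_ord_recl /= {1}/ifact fact0 invr1 rmorph1 mul1r expr0; congr (_ + _).
  by rewrite mulr_sumr; apply: eq_bigr => i _; rewrite exprS mulrCA.
have -> : 1 + p * S - (1 + p * T) = p * (S - T) by ring.
apply: ordMl; apply: ord_sym; apply: ord_psum => n.
by apply: ordMl; rewrite -[n in ord n _]muln1; apply: ordX.
Qed.

Lemma unit_inv1 (q : ps) : q 0%N 0%N = 1 -> exists r : ps, q * r = 1.
Proof.
move=> h1; have hq : ord 1 (1 - q) by apply: ord1I; rewrite coefSB coefS1 h1 subrr.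
have [|r hr] := @adic_fixpoint (fun r => 1 + (1 - q) * r).
  move=> n p t h; have -> : 1 + (1 - q) * p - (1 + (1 - q) * t) = (1 - q) * (p - t) by ring.
  exact: (ordM hq h).
exists r; have -> : q * r = 1 + r - (1 + (1 - q) * r) by ring.
by rewrite hr addrK.
Qed.

Lemma unit_inv (q : ps) : q 0%N 0%N != 0 -> exists r : ps, q * r = 1.
Proof.
move=> h; have [|r hr] := @unit_inv1 (cS (q 0%N 0%N)^-1 * q).
  by rewrite coef_cM mulVf.
by exists (cS (q 0%N 0%N)^-1 * r); rewrite mulrCA mulrA.
Qed.

Lemma expp_eq1 p : ord 1 p -> expp p = 1 -> p = 0.
Proof.
move=> hp; have [q [q1 ->]] := expp_unit_factor hp.
move=> /(canRL (addKr _)); rewrite addNr => pq.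
have [r qr] := unit_inv1 q1.
by rewrite -[p]mulr1 -qr mulrA pq mul0r.
Qed.

Lemma expp_inj p q : ord 1 p -> ord 1 q -> expp p = expp q -> p = q.
Proof.
move=> hp hq e; apply/eqP; rewrite -subr_eq0; apply/eqP; apply: expp_eq1.
  exact: ordB.
by rewrite exppD // ?e ?exppNK //; apply: ordN.
Qed.

(* [L] is a fixed point of the adic contraction [L |-> L - (expp L - V)]. *)
Lemma log_exists (V : ps) : V 0%N 0%N = 1 -> exists L : ps, ord 1 L /\ expp L = V.
Proof.
move=> hV; pose pr (p : ps) : ps := p - cS (p 0%N 0%N).
have hpr p : ord 1 (pr p) by apply: ord1I; rewrite /pr coefSB /cS /= subrr.
have [|L hL] := @adic_fixpoint (fun p => pr p - (expp (pr p) - V)).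
  move=> n p q h; set P := pr p; set Q := pr q.
  have hP : ord 1 P by apply: hpr.
  have hQ : ord 1 Q by apply: hpr.
  have hd1 : ord 1 (P - Q) by apply: ordB.
  have hd : ord n (P - Q).
    case: n h => [|n] h //; rewrite /P /Q /pr.
    suff -> : p 0%N 0%N = q 0%N 0%N by rewrite opprB addrA subrK.
    exact: (ord_coef h).
  have -> : P - (expp P - V) - (Q - (expp Q - V)) = (P - Q) - (expp P - expp Q) by ring.
  have -> : expp P = expp Q * expp (P - Q) by rewrite -exppD // addrC subrK.
  have [r [r1 ->]] := expp_unit_factor hd1.
  have [t [t1 ->]] := expp_unit_factor hQ.
  have -> : P - Q - ((1 + Q * t) * (1 + (P - Q) * r) - (1 + Q * t)) =
    (P - Q) * (1 - r - Q * t * r) by ring.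
  (* The cofactor of [P - Q] vanishes at the origin because [r] has constant term 1 and [Q] none:
     this is the gain of one order. *)
  rewrite -addn1; apply: ordM => //; apply: ord1I.
  by rewrite !coefSB !coefM00 r1 (ord1_coef hQ) coefS1 subrr !mul0r subrr.
have hL0 : ord 1 L.
  apply: ord1I; rewrite -hL !coefSB coef00_expp hV subrr subr0.
  exact: ord1_coef.
have prL : pr L = L by rewrite /pr (ord1_coef hL0) raddf0 subr0.
exists L; split=> //; move: hL; rewrite prL.
by move=> /(canRL (addKr _)); rewrite addNr => /eqP; rewrite oppr_eq0 subr_eq0 => /eqP.
Qed.

(** * Convergence *)

(** A truncated weighted l1 norm. It is submultiplicative for a fixed radius, which the coefficient
    bound in [convergentS] is not; convergence means that it stays bounded in [n] for some positive
    radius. *)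
Definition nrm (r : C) (n : nat) (p : ps) : C :=
  \sum_(a < n) \sum_(b < n) `|p a b| * r ^+ (a + b).

Definition bounded (p : ps) : Prop :=
  exists r B : C, 0 < r /\ forall n, nrm r n p <= B.

Lemma nrm_ge0 r n p : 0 <= r -> 0 <= nrm r n p.
Proof.
by move=> r0; apply: sumr_ge0 => a _; apply: sumr_ge0 => b _; rewrite mulr_ge0 // exprn_ge0.
Qed.

Lemma nrm_coef r n (p : ps) a b : 0 <= r -> (a < n)%N -> (b < n)%N ->
  `|p a b| * r ^+ (a + b) <= nrm r n p.
Proof.
move=> r0 ha hb.
have t0 (i j : nat) : 0 <= `|p i j| * r ^+ (i + j) by rewrite mulr_ge0 // exprn_ge0.
rewrite /nrm (bigD1 (Ordinal ha)) //= (bigD1 (Ordinal hb)) //= -addrA lerDl addr_ge0 //.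
  by apply: sumr_ge0.
by apply: sumr_ge0 => i _; apply: sumr_ge0.
Qed.

Lemma geo_half n : \sum_(a < n) (2%:R^-1 : C) ^+ a <= 2%:R.
Proof.
have -> : \sum_(a < n) (2%:R^-1 : C) ^+ a = 2%:R - 2%:R * 2%:R^-1 ^+ n.
  elim: n => [|n IH]; first by rewrite big_ord0 expr0 mulr1 subrr.
  by rewrite big_ord_recr /= IH exprS; field.
by rewrite lerBlDr lerDl mulr_ge0 // exprn_ge0 // invr_ge0.
Qed.

Lemma bounded_conv (p : ps) : bounded p <-> convergentS p.
Proof.
split=> [[r [B [r0 h]]]|[M [r [r0 h]]]].
  exists B, r^-1; split; first by rewrite invr_gt0.
  move=> a b; rewrite exprVn ler_pdivlMr ?exprn_gt0 //.
  by apply: le_trans (h (a + b).+1); apply: nrm_coef; rewrite ?(ltW r0) //; lia.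
have M0 : 0 <= M by have := h 0%N 0%N; rewrite expr0 mulr1; apply: le_trans.
exists (2%:R^-1 * r^-1), (M * (2%:R * 2%:R)); split.
  by rewrite mulr_gt0 ?invr_gt0.
(* Half of the radius of the coefficient bound turns the double sum into a product of two geometric
   series, each at most 2. *)
move=> n; pose e : C := 2%:R^-1.
apply: (@le_trans _ _ (\sum_(a < n) \sum_(b < n) M * (e ^+ a * e ^+ b))).
  apply: ler_sum => a _; apply: ler_sum => b _.
  rewrite -exprD exprMn mulrCA [leRHS]mulrC; apply: ler_wpM2l.
    by rewrite exprn_ge0 // invr_ge0.
  by rewrite exprVn ler_pdivrMr ?exprn_gt0.
under eq_bigr do rewrite -mulr_sumr -mulr_sumr.
rewrite -mulr_sumr -mulr_suml; apply: ler_wpM2l => //.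
by apply: ler_pM; rewrite ?geo_half //; apply: sumr_ge0 => i _; rewrite exprn_ge0 // invr_ge0.
Qed.

Lemma le_nrm_radius r r' n p : 0 <= r' -> r' <= r -> nrm r' n p <= nrm r n p.
Proof.
move=> r0 h; apply: ler_sum => a _; apply: ler_sum => b _.
by apply: ler_wpM2l => //; apply: lerXn2r => //; rewrite nnegrE // (le_trans r0).
Qed.

Lemma common_radius (r r' : C) : 0 < r -> 0 < r' ->
  exists t, [/\ 0 < t, t <= r & t <= r'].
Proof.
move=> h h'; exists (r^-1 + r'^-1)^-1.
have s0 : 0 < r^-1 + r'^-1 by rewrite addr_gt0 ?invr_gt0.
split; first by rewrite invr_gt0.
  by rewrite -[leRHS]invrK lef_pV2 ?posrE ?invr_gt0 // lerDl invr_ge0 ltW.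
by rewrite -[leRHS]invrK lef_pV2 ?posrE ?invr_gt0 // lerDr invr_ge0 ltW.
Qed.

Lemma nrmD r n p q : 0 <= r -> nrm r n (p + q) <= nrm r n p + nrm r n q.
Proof.
move=> r0; rewrite /nrm -big_split; apply: ler_sum => a _.
rewrite -big_split; apply: ler_sum => b _ /=.
by rewrite -mulrDl; apply: ler_wpM2r; [rewrite exprn_ge0 | apply: ler_normD].
Qed.

Lemma nrm_sum r n (I : Type) (s : seq I) (F : I -> ps) : 0 <= r ->
  nrm r n (\sum_(i <- s) F i) <= \sum_(i <- s) nrm r n (F i).
Proof.
move=> r0; elim: s => [|i s IH].
  rewrite !big_nil /nrm big1 // => a _; rewrite big1 // => b _.
  by rewrite normr0 mul0r.
by rewrite !big_cons; apply: (le_trans (nrmD _ _ _ r0)); rewrite lerD2l.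
Qed.

Lemma nrm_cM r n c p : nrm r n (cS c * p) = `|c| * nrm r n p.
Proof.
rewrite /nrm mulr_sumr; apply: eq_bigr => a _; rewrite mulr_sumr.
by apply: eq_bigr => b _; rewrite coef_cM normrM mulrA.
Qed.

Lemma nrmN r n p : nrm r n (- p) = nrm r n p.
Proof. by apply: eq_bigr => a _; apply: eq_bigr => b _; rewrite coefSN normrN. Qed.

Lemma le_sum_triangle (f : nat -> nat -> C) n : (forall i j, 0 <= f i j) ->
  \sum_(a < n) \sum_(k < a.+1) f k (a - k)%N <= \sum_(k < n) \sum_(j < n) f k j.
Proof.
move=> f0; rewrite -sum_triangle; apply: ler_sum => i _.
rewrite (big_ord_widen n (f i) (leq_subr i n)) big_mkcond; apply: ler_sum => j _.
by case: ifP.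
Qed.

Lemma nrmM r n p q : 0 <= r -> nrm r n (p * q) <= nrm r n p * nrm r n q.
Proof.
move=> r0; pose P k l := `|p k l| * r ^+ (k + l); pose Q k l := `|q k l| * r ^+ (k + l).
have P0 k l : 0 <= P k l by rewrite mulr_ge0 // exprn_ge0.
have Q0 k l : 0 <= Q k l by rewrite mulr_ge0 // exprn_ge0.
pose g k i := \sum_(l < n) \sum_(j < n) P k l * Q i j.
have -> : nrm r n p * nrm r n q = \sum_(k < n) \sum_(i < n) g k i.
  rewrite mulr_suml; apply: eq_bigr => k _; rewrite mulr_sumr; apply: eq_bigr => i _.
  by rewrite mulr_suml; apply: eq_bigr => l _; rewrite mulr_sumr.
apply: le_trans (le_sum_triangle n _); last first.
  by move=> k i; apply: sumr_ge0 => l _; apply: sumr_ge0 => j _; rewrite mulr_ge0.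
apply: ler_sum => a _.
apply: (@le_trans _ _ (\sum_(b < n) \sum_(k < a.+1) \sum_(l < b.+1) P k l * Q (a - k)%N (b - l)%N)).
  apply: ler_sum => b _; rewrite coefSM.
  apply: (@le_trans _ _ ((\sum_(k < a.+1) \sum_(l < b.+1) `|p k l| * `|q (a - k)%N (b - l)%N|) * r ^+ (a + b))).
    apply: ler_wpM2r; first exact: exprn_ge0.
    apply: (le_trans (ler_norm_sum _ _ _)); apply: ler_sum => k _.
    apply: (le_trans (ler_norm_sum _ _ _)); apply: ler_sum => l _.
    by rewrite normrM.
  rewrite mulr_suml; apply: ler_sum => k _; rewrite mulr_suml; apply: ler_sum => l _.
  have := ltn_ord k; have := ltn_ord l => hl hk.
  have -> : (a + b)%N = ((k + l) + ((a - k) + (b - l)))%N by lia.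
  by rewrite exprD /P /Q mulrACA.
rewrite exchange_big /=; apply: ler_sum => k _.
apply: (@le_sum_triangle (fun l j => P k l * Q (a - k)%N j)).
by move=> l j; rewrite mulr_ge0.
Qed.

Lemma nrm1 r n : nrm r n 1 <= 1.
Proof.
case: n => [|n]; first by rewrite /nrm big_ord0.
rewrite /nrm big_ord_recl big_ord_recl /= coefS1 /= normr1 mul1r expr0.
rewrite !big1 ?addr0 // => [i _|i _]; last by rewrite coefS1 normr0 mul0r.
by rewrite big1 // => j _; rewrite coefS1 normr0 mul0r.
Qed.

Lemma nrmX r n p i B : 0 <= r -> 0 <= B -> nrm r n p <= B -> nrm r n (p ^+ i) <= B ^+ i.
Proof.
move=> r0 B0 h; elim: i => [|i IH]; first by rewrite !expr0 nrm1.
rewrite !exprS; apply: (le_trans (nrmM _ _ _ r0)).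
by apply: ler_pM => //; apply: nrm_ge0.
Qed.

Lemma bounded_mul p q : bounded p -> bounded q -> bounded (p * q).
Proof.
move=> [r [B [r0 h]]] [r' [B' [r0' h']]].
have [t [t0 tr tr']] := common_radius r0 r0'.
exists t, (B * B'); split=> // n; apply: (le_trans (nrmM _ _ _ (ltW t0))).
apply: ler_pM; rewrite ?nrm_ge0 ?(ltW t0) //.
  exact: le_trans (le_nrm_radius _ _ (ltW t0) tr) (h n).
exact: le_trans (le_nrm_radius _ _ (ltW t0) tr') (h' n).
Qed.

Lemma bounded_add p q : bounded p -> bounded q -> bounded (p + q).
Proof.
move=> [r [B [r0 h]]] [r' [B' [r0' h']]].
have [t [t0 tr tr']] := common_radius r0 r0'.
exists t, (B + B'); split=> // n; apply: (le_trans (nrmD _ _ _ (ltW t0))).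
apply: lerD.
  exact: le_trans (le_nrm_radius _ _ (ltW t0) tr) (h n).
exact: le_trans (le_nrm_radius _ _ (ltW t0) tr') (h' n).
Qed.

Lemma bounded_opp p : bounded p -> bounded (- p).
Proof. by move=> [r [B [r0 h]]]; exists r, B; split=> // n; rewrite nrmN. Qed.

Lemma bounded_sub p q : bounded p -> bounded q -> bounded (p - q).
Proof. by move=> h1 h2; apply: bounded_add => //; apply: bounded_opp. Qed.

Lemma bounded_le1 (p : ps) : (forall a b, `|p a b| <= 1) -> bounded p.
Proof.
move=> h; apply/bounded_conv; exists 1, 1; split=> // a b.
by rewrite expr1n mulr1.
Qed.

Lemma bounded_x1 : bounded x1.
Proof. by apply: bounded_le1 => a b; rewrite /X1; case: (_ && _); rewrite ?normr1 ?normr0. Qed.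
Lemma bounded_x2 : bounded x2.
Proof. by apply: bounded_le1 => a b; rewrite /X2; case: (_ && _); rewrite ?normr1 ?normr0. Qed.

Lemma bounded_cj p : bounded p -> bounded (cj p).
Proof.
move=> [r [B [r0 h]]]; exists r, B; split=> // n.
have -> : nrm r n (cj p) = nrm r n p by
  [apply: eq_bigr => a _; apply: eq_bigr => b _; rewrite /cj /conjS norm_conjC].
exact: h.
Qed.

Lemma bounded_d1 p : bounded p -> bounded (d1 p).
Proof.
move=> /bounded_conv[M [r [r0 h]]]; apply/bounded_conv.
have M0 : 0 <= M by have := h 0%N 0%N; rewrite expr0 mulr1; apply: le_trans.
exists (M * r), (2%:R * r); split; first by rewrite mulr_gt0.
move=> a b; rewrite /d1 normrM normr_nat exprMn.
have -> : M * r * (2%:R ^+ (a + b) * r ^+ (a + b)) = 2%:R ^+ (a + b) * (M * r ^+ (a.+1 + b)).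
  by rewrite addSn exprS; ring.
apply: ler_pM => //; rewrite -natrX ler_nat.
by apply: (@leq_trans (2 ^ a)); [apply: ltn_expl | rewrite leq_exp2l //; lia].
Qed.

Lemma bounded_d2 p : bounded p -> bounded (d2 p).
Proof.
move=> /bounded_conv[M [r [r0 h]]]; apply/bounded_conv.
have M0 : 0 <= M by have := h 0%N 0%N; rewrite expr0 mulr1; apply: le_trans.
exists (M * r), (2%:R * r); split; first by rewrite mulr_gt0.
move=> a b; rewrite /d2 normrM normr_nat exprMn.
have -> : M * r * (2%:R ^+ (a + b) * r ^+ (a + b)) = 2%:R ^+ (a + b) * (M * r ^+ (a + b.+1)).
  by rewrite addnS exprS; ring.
apply: ler_pM => //; rewrite -natrX ler_nat.
by apply: (@leq_trans (2 ^ b)); [apply: ltn_expl | rewrite leq_exp2l //; lia].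
Qed.

Lemma bounded_jac p q : bounded p -> bounded q -> bounded (jac p q).
Proof.
move=> hp hq; apply: bounded_sub; apply: bounded_mul;
  by [apply: bounded_d1 | apply: bounded_d2].
Qed.

(** Shrinking the radius by a factor [x <= 1] multiplies each term of positive degree by at most
    [x]; for [x = e / (e + B)] the product [x * B] is at most [e]. *)
Lemma nrm_small p e : bounded p -> ord 1 p -> 0 < e ->
  exists r, 0 < r /\ forall n, nrm r n p <= e.
Proof.
move=> [r [B [r0 h]]] hp e0.
have B0 : 0 <= B by apply: le_trans (h 0%N); rewrite /nrm big_ord0.
have s0 : 0 < e + B by rewrite ltr_wpDr.
pose x := e / (e + B).
have x0 : 0 < x by rewrite divr_gt0.
have x1' : x <= 1 by rewrite ler_pdivrMr // mul1r lerDl.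
exists (x * r); split; first by rewrite mulr_gt0.
move=> n; apply: (@le_trans _ _ (x * nrm r n p)).
  rewrite /nrm mulr_sumr; apply: ler_sum => a _; rewrite mulr_sumr; apply: ler_sum => b _.
  have [ab|ab] := posnP (a + b)%N.
    by rewrite hp ?ab // normr0 !mul0r mulr0.
  rewrite exprMn mulrCA; apply: ler_wpM2r; first by rewrite mulr_ge0 // exprn_ge0 // ltW.
  rewrite -(prednK ab) exprS; apply: ler_piMr; first exact: ltW.
  by apply: exprn_ile1 => //; apply: ltW.
apply: (@le_trans _ _ (x * B)); first by rewrite ler_wpM2l // ltW.
by rewrite /x mulrAC ler_pdivrMr // ler_wpM2l ?(ltW e0) // lerDr ltW.
Qed.

(** On a small enough radius both components of [g] have norm at most the radius on which [f] is
    bounded, and the norm of [f] then majorises that of the composite. *)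
Lemma bounded_cmp f g : bounded f -> fixes0 g -> bounded g.1 -> bounded g.2 ->
  bounded (cmp f g).
Proof.
move=> [rf [B [rf0 h]]] hg b1 b2; have [o1 o2] := fixes0_ord1 hg.
have [r1 [r10 h1]] := nrm_small b1 o1 rf0.
have [r2 [r20 h2]] := nrm_small b2 o2 rf0.
have [t [t0 tr1 tr2]] := common_radius r10 r20.
have {}h1 n : nrm t n g.1 <= rf.
  exact: le_trans (le_nrm_radius _ _ (ltW t0) tr1) (h1 n).
have {}h2 n : nrm t n g.2 <= rf.
  exact: le_trans (le_nrm_radius _ _ (ltW t0) tr2) (h2 n).
exists t, B; split=> // n.
(* A box of side [2 n] holds every monomial of [f] that reaches a coefficient with both indices
   below [n]. *)
pose S : ps := \sum_(i < n + n) \sum_(j < n + n)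
  cS (f i j) * ((g.1 : ps) ^+ i * (g.2 : ps) ^+ j).
have -> : nrm t n (cmp f g) = nrm t n S.
  apply: eq_bigr => a _; apply: eq_bigr => b _; congr (`|_| * _).
  rewrite (@coef_cmp g hg (n + n)%N); last by have := ltn_ord a; have := ltn_ord b; lia.
  rewrite /S coefS_sum; apply: eq_bigr => i _; rewrite coefS_sum.
  by apply: eq_bigr => j _; rewrite coef_cM.
apply: le_trans (h (n + n)%N); apply: (le_trans (nrm_sum _ _ _ (ltW t0))).
apply: ler_sum => i _; apply: (le_trans (nrm_sum _ _ _ (ltW t0))).
apply: ler_sum => j _; rewrite nrm_cM; apply: ler_wpM2l => //.
apply: (le_trans (nrmM _ _ _ (ltW t0))); rewrite exprD.
by apply: ler_pM; rewrite ?nrm_ge0 ?(ltW t0) //; apply: nrmX; rewrite // ltW.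
Qed.

Lemma bounded_cst c : bounded (cS c).
Proof.
apply/bounded_conv; exists `|c|, 1; split=> // a b.
by rewrite expr1n mulr1 /cS; case: ifP; rewrite ?normr0.
Qed.

Lemma bounded_inv (q r : ps) : bounded q -> q * r = 1 -> bounded r.
Proof.
move=> hq qr; set c := q 0%N 0%N.
have c0 : c != 0.
  apply/eqP => c0; have := congr1 (fun p : ps => p 0%N 0%N) qr.
  by rewrite /= coefM00 -/c c0 mul0r coefS1 => /eqP; rewrite eq_sym oner_eq0.
pose q' := cS c^-1 * q; pose r' := cS c * r.
have qr' : q' * r' = 1.
  by rewrite /q' /r' mulrACA -rmorphM mulVf // rmorph1 mul1r.
have e : r' = 1 + (1 - q') * r' by rewrite mulrBl qr' mul1r addrC subrK.
have b1 : bounded (1 - q').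
  by apply: bounded_sub; [rewrite -(rmorph1 cS); apply: bounded_cst
    | apply: bounded_mul => //; apply: bounded_cst].
have o1 : ord 1 (1 - q').
  by apply: ord1I; rewrite coefSB /q' coef_cM -/c mulVf // coefS1 subrr.
have h2 : 0 < 2%:R^-1 :> C by rewrite invr_gt0.
have [t [t0 ht]] := nrm_small b1 o1 h2.
have br' : bounded r'.
  exists t, 2%:R; split=> // n.
  (* [r' = 1 + (1 - q') * r'] with [1 - q'] of norm at most 1/2; the truncated norm of [r'] is a
     finite number, so the inequality can be solved for it. *)
  have h : nrm t n r' <= 1 + 2%:R^-1 * nrm t n r'.
    rewrite {1}e; apply: (le_trans (nrmD _ _ _ (ltW t0))); apply: lerD; first exact: nrm1.
    apply: (le_trans (nrmM _ _ _ (ltW t0))); apply: ler_wpM2r => //.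
    by apply: nrm_ge0; apply: ltW.
  have : 2%:R^-1 * nrm t n r' <= 1.
    have -> : 2%:R^-1 * nrm t n r' = nrm t n r' - 2%:R^-1 * nrm t n r' by field.
    by rewrite lerBlDr.
  by rewrite mulrC ler_pdivrMr // mul1r.
have -> : r = cS c^-1 * r' by rewrite /r' mulrA -rmorphM mulVf // rmorph1 mul1r.
by apply: bounded_mul => //; apply: bounded_cst.
Qed.

(** * Diagonal series and modes *)

(** [isdiag] singles out the series in [hh] alone, and [hord n] the multiples of [hh ^+ n]. *)
Definition isdiag (p : ps) : Prop := forall a b, a != b -> p a b = 0.
Definition hord (n : nat) (p : ps) : Prop := forall a b, (minn a b < n)%N -> p a b = 0.
Definition hh : ps := x1 * x2.

Lemma hhX n : hh ^+ n = mono n n.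
Proof. by rewrite /hh exprMn -monoX. Qed.

Lemma coef_hhXM n p a b : (hh ^+ n * p) a b =
  if (n <= a)%N && (n <= b)%N then p (a - n)%N (b - n)%N else 0.
Proof. by rewrite hhX coef_monoM. Qed.

Lemma hordW m n p : (m <= n)%N -> hord n p -> hord m p.
Proof. by move=> mn h a b ab; apply: h; lia. Qed.
Lemma hordD n p q : hord n p -> hord n q -> hord n (p + q).
Proof. by move=> h1 h2 a b ab; rewrite coefSD h1 ?h2 ?addr0. Qed.
Lemma hordN n p : hord n p -> hord n (- p).
Proof. by move=> h1 a b ab; rewrite coefSN h1 ?oppr0. Qed.
Lemma hordB n p q : hord n p -> hord n q -> hord n (p - q).
Proof. by move=> h1 h2; apply: hordD => //; apply: hordN. Qed.
Lemma hordM m n p q : hord m p -> hord n q -> hord (m + n) (p * q).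
Proof.
move=> h1 h2 a b ab; rewrite coefSM big1 // => k _; rewrite big1 // => l _.
have := ltn_ord k; have := ltn_ord l; move=> hl hk.
have [kl|kl] := ltnP (minn k l) m; first by rewrite h1 ?mul0r.
by rewrite h2 ?mulr0 //; lia.
Qed.
Lemma hord0n p : hord 0 p. Proof. by []. Qed.
Lemma hordMl n p q : hord n q -> hord n (p * q).
Proof. by move=> h; apply: (@hordM 0 n). Qed.
Lemma hordMr n p q : hord n p -> hord n (p * q).
Proof. by rewrite mulrC; apply: hordMl. Qed.
Lemma hord_hhX n : hord n (hh ^+ n).
Proof. by move=> a b ab; rewrite hhX /mono; case: eqP; case: eqP => //=; lia. Qed.
Lemma hord_ord n p : hord n p -> ord n.*2 p.
Proof. by move=> h a b ab; apply: h; lia. Qed.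
Lemma hord_cj n p : hord n p -> hord n (cj p).
Proof. by move=> h a b ab; rewrite /cj /conjS h // rmorph0. Qed.
Lemma hord_eq p q : (forall n, hord n (p - q)) -> p = q.
Proof.
move=> h; apply: psP => a b; apply/eqP; rewrite -subr_eq0 -coefSB.
by rewrite (h (minn a b).+1).
Qed.
Lemma hord_trans n p q r : hord n (p - q) -> hord n (q - r) -> hord n (p - r).
Proof. by move=> h1 h2; have := hordD h1 h2; rewrite addrA subrK. Qed.
Lemma hord_factor n p : hord n p -> exists q, p = hh ^+ n * q.
Proof.
move=> h; exists (fun a b => p (a + n)%N (b + n)%N : C); apply: psP => a b.
rewrite coef_hhXM; case: ifP => [/andP[h1 h2]|h']; first by rewrite !subnK.
by apply: h; lia.
Qed.
Lemma hhX_inj n p q : hh ^+ n * p = hh ^+ n * q -> p = q.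
Proof.
move=> e; apply: psP => a b; have := congr1 (fun f : ps => f (a + n)%N (b + n)%N) e.
by rewrite !coef_hhXM !leq_addl /= !addnK.
Qed.

Lemma coef_diagM d p a b : isdiag d ->
  (d * p) a b = \sum_(i < (minn a b).+1) d i i * p (a - i)%N (b - i)%N.
Proof.
move=> hd; rewrite coefSM.
pose F (i : nat) := d i i * (if (i <= b)%N then p (a - i)%N (b - i)%N else 0).
have E (k : 'I_a.+1) : \sum_(l < b.+1) d k l * p (a - k)%N (b - l)%N = F k.
  rewrite /F; case: ifP => hk.
    rewrite (bigD1 (Ordinal (hk : (k < b.+1)%N))) //= big1 ?addr0 // => l hl.
    by rewrite hd ?mul0r //; move: hl; rewrite -val_eqE eq_sym.
  rewrite mulr0 big1 // => l _; rewrite hd ?mul0r //.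
  by apply/eqP => e; move: hk; rewrite e -ltnS ltn_ord.
under eq_bigr do rewrite E.
have -> : \sum_(i < (minn a b).+1) d i i * p (a - i)%N (b - i)%N =
   \sum_(i < (minn a b).+1) F i.
  apply: eq_bigr => i _; rewrite /F; have := ltn_ord i => hi.
  by have -> : (i <= b)%N by lia.
rewrite [RHS](big_ord_widen a.+1 F); last by lia.
rewrite [RHS]big_mkcond; apply: eq_bigr => i _; rewrite /F.
have := ltn_ord i => hi; have [hb|hb] := leqP i b.
  by have -> : (i < (minn a b).+1)%N by lia.
by have -> : (i < (minn a b).+1)%N = false; [lia | rewrite mulr0].
Qed.

Lemma isdiagM p q : isdiag p -> isdiag q -> isdiag (p * q).
Proof.
move=> hp hq a b ab; rewrite coef_diagM // big1 // => i _.
by rewrite hq ?mulr0 //; have := ltn_ord i; lia.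
Qed.
Lemma isdiagD p q : isdiag p -> isdiag q -> isdiag (p + q).
Proof. by move=> hp hq a b ab; rewrite coefSD hp ?hq ?addr0. Qed.
Lemma isdiagN p : isdiag p -> isdiag (- p).
Proof. by move=> hp a b ab; rewrite coefSN hp ?oppr0. Qed.
Lemma isdiagB p q : isdiag p -> isdiag q -> isdiag (p - q).
Proof. by move=> hp hq; apply: isdiagD => //; apply: isdiagN. Qed.
Lemma isdiag_mono n : isdiag (mono n n).
Proof. by move=> a b ab; rewrite /mono; case: eqP; case: eqP => // *; lia. Qed.
Lemma isdiag1 : isdiag 1. Proof. exact: (isdiag_mono 0). Qed.
Lemma isdiagX p n : isdiag p -> isdiag (p ^+ n).
Proof.
by move=> h; elim: n => [|n IH]; [apply: isdiag1 | rewrite exprS; apply: isdiagM].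
Qed.
Lemma isdiag_hhX n : isdiag (hh ^+ n).
Proof. by rewrite hhX; apply: isdiag_mono. Qed.
Lemma isdiagC c : isdiag (cS c).
Proof. by move=> a b ab; rewrite /cS; case: eqP; case: eqP => //= *; lia. Qed.

(* The two families of modes: [p] is the sum of the [md k p * x1 ^+ k] for [k >= 0]
   and of the [mdn k p * x2 ^+ k] for [k > 0]. *)
Definition md k (p : ps) : ps := fun a b => if a == b then p (a + k)%N a else 0.
Definition mdn k (p : ps) : ps := fun a b => if a == b then p a (a + k)%N else 0.

Lemma isdiag_md k p : isdiag (md k p).
Proof. by move=> a b ab; rewrite /md (negPf ab). Qed.
Lemma isdiag_mdn k p : isdiag (mdn k p).
Proof. by move=> a b ab; rewrite /mdn (negPf ab). Qed.

Lemma md_diagM k d p : isdiag d -> md k (d * p) = d * md k p.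
Proof.
move=> hd; apply: psP => a b; rewrite [LHS]/md; case: eqP => [<-|/eqP ab]; last first.
  by rewrite (isdiagM hd (@isdiag_md k p)).
rewrite !coef_diagM //.
have -> : minn (a + k) a = a by lia.
rewrite minnn; apply: eq_bigr => i _; rewrite /md eqxx; congr (_ * p _ _).
by have := ltn_ord i; lia.
Qed.
Lemma mdn_diagM k d p : isdiag d -> mdn k (d * p) = d * mdn k p.
Proof.
move=> hd; apply: psP => a b; rewrite [LHS]/mdn; case: eqP => [<-|/eqP ab]; last first.
  by rewrite (isdiagM hd (@isdiag_mdn k p)).
rewrite !coef_diagM //.
have -> : minn a (a + k) = a by lia.
rewrite minnn; apply: eq_bigr => i _; rewrite /mdn eqxx; congr (_ * p _ _).
by have := ltn_ord i; lia.
Qed.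

Lemma md_lcont k : lcont (md k).
Proof.
split=> [p q|c p|].
- by apply: psP => a b; rewrite coefSD /md; case: eqP; rewrite ?addr0.
- by rewrite md_diagM //; apply: isdiagC.
exists k => n p h a b ab; rewrite /md; case: eqP => // e; apply: h; lia.
Qed.
Lemma mdn_lcont k : lcont (mdn k).
Proof.
split=> [p q|c p|].
- by apply: psP => a b; rewrite coefSD /mdn; case: eqP; rewrite ?addr0.
- by rewrite mdn_diagM //; apply: isdiagC.
exists k => n p h a b ab; rewrite /mdn; case: eqP => // e; apply: h; lia.
Qed.

Lemma md_coef k (p : ps) a : md k p a a = p (a + k)%N a.
Proof. by rewrite /md eqxx. Qed.
Lemma mdn_coef k (p : ps) a : mdn k p a a = p a (a + k)%N.
Proof. by rewrite /mdn eqxx. Qed.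

Lemma md0_mdn p : mdn 0 p = md 0 p.
Proof. by apply: psP => a b; rewrite /mdn /md addn0. Qed.

Lemma modes_eq p q : (forall k, md k p = md k q) ->
  (forall k, (0 < k)%N -> mdn k p = mdn k q) -> p = q.
Proof.
move=> h1 h2; apply: psP => a b; have [ab|ab] := leqP b a.
  have := congr1 (fun f : ps => f b b) (h1 (a - b)%N).
  by rewrite !md_coef subnKC.
have ba : (0 < b - a)%N by lia.
have := congr1 (fun f : ps => f a a) (h2 _ ba).
by rewrite !mdn_coef subnKC // ltnW.
Qed.

Lemma md_mono k i j : md k (mono i j) = if i == (j + k)%N then mono j j else 0.
Proof.
apply: psP => a b; rewrite /md; case: (eqVneq a b) => [<-|ab].
  rewrite /mono; case: (eqVneq a j) => [->|aj].
    by rewrite eq_sym andbT; case: ifP => // _; rewrite eqxx.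
  by rewrite andbF; case: ifP => // _; rewrite (negPf aj).
by case: ifP => // _; rewrite (@isdiag_mono j _ _ ab).
Qed.
Lemma mdn_mono k i j : mdn k (mono j i) = if i == (j + k)%N then mono j j else 0.
Proof.
apply: psP => a b; rewrite /mdn; case: (eqVneq a b) => [<-|ab].
  rewrite /mono; case: (eqVneq a j) => [->|aj].
    by rewrite eq_sym; case: ifP => // _; rewrite eqxx.
  by case: ifP => // _; rewrite (negPf aj).
by case: ifP => // _; rewrite (@isdiag_mono j _ _ ab).
Qed.

Lemma cj_md k p : cj (md k p) = md k (cj p).
Proof. by apply: psP => a b; rewrite /cj /conjS /md; case: eqP; rewrite ?rmorph0. Qed.
Lemma cj_mdn k p : cj (mdn k p) = mdn k (cj p).
Proof. by apply: psP => a b; rewrite /cj /conjS /mdn; case: eqP; rewrite ?rmorph0. Qed.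

Lemma md_diag k d : isdiag d -> md k d = if k == 0%N then d else 0.
Proof.
move=> hd; apply: psP => a b; rewrite /md; case: (eqVneq a b) => [<-|ab].
  case: (eqVneq k 0%N) => [->|k0]; first by rewrite addn0.
  by apply: hd; lia.
by case: ifP => // _; rewrite hd.
Qed.
Lemma mdn_diag k d : (0 < k)%N -> isdiag d -> mdn k d = 0.
Proof.
move=> k0 hd; apply: psP => a b; rewrite /mdn; case: eqP => // _.
by apply: hd; lia.
Qed.

Lemma hord_md n k p : hord n p -> hord n (md k p).
Proof. by move=> h a b ab; rewrite /md; case: eqP => // e; apply: h; lia. Qed.
Lemma hord_mdn n k p : hord n p -> hord n (mdn k p).
Proof. by move=> h a b ab; rewrite /mdn; case: eqP => // e; apply: h; lia. Qed.

(** A series in [hh] of exact order [v], that is [hh ^+ v] times a unit: it can be cancelled, and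
    division by it costs [v] orders in [hh]. *)
Definition dval (v : nat) (d : ps) : Prop :=
  [/\ isdiag d, forall i, (i < v)%N -> d i i = 0 & d v v != 0].

Lemma dval_factor v d : dval v d -> exists e, d = hh ^+ v * e /\ e 0%N 0%N != 0.
Proof.
move=> [hd h0 hv]; have [|e he] := @hord_factor v d.
  move=> a b ab; have [e|ab'] := eqVneq a b; last exact: hd.
  by rewrite -e in ab *; rewrite minnn in ab; apply: h0.
by exists e; split=> //; move: hv; rewrite he coef_hhXM !leqnn /= subnn.
Qed.

Lemma dval_cancel v d p q : dval v d -> d * p = d * q -> p = q.
Proof.
move=> /dval_factor[e [-> e0]]; rewrite -!mulrA => /hhX_inj h.
have [r er] := unit_inv e0.
have E x : r * (e * x) = x by rewrite mulrA [r * e]mulrC er mul1r.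
by rewrite -[p]E h E.
Qed.

Lemma dval_div v d p n : dval v d -> hord (n + v) p ->
  exists q, d * q = p /\ hord n q.
Proof.
move=> /dval_factor[e [-> e0]] hp; have [r er] := unit_inv e0.
have [q ->] := hord_factor hp.
exists (hh ^+ n * (r * q)); split; last by apply: hordMr; apply: hord_hhX.
rewrite exprD.
have -> : hh ^+ v * e * (hh ^+ n * (r * q)) = e * r * (hh ^+ n * hh ^+ v * q) by ring.
by rewrite er mul1r.
Qed.

Lemma dval_diag v d p q : dval v d -> d * q = p -> isdiag p -> isdiag q.
Proof.
move=> hd e hp; have [d1 _ _] := hd.
have : d * q = d * md 0 q by rewrite -md_diagM // e md_diag.
by move=> /(dval_cancel hd) ->; apply: isdiag_md.
Qed.

(** The common shape of both model involutions. When [A] and [A'] are diagonal and inverse to each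
    other it fixes [hh] and exchanges the modes in [x1 ^+ k] and [x2 ^+ k] up to powers of [A] and
    [A']. *)
Definition swap (A A' : ps) : fmap := (A * x2, A' * x1).

Section Swap.
Variables (A A' : ps) (hA : isdiag A) (hA' : isdiag A') (AA' : A * A' = 1).

Lemma fixes0_swap : fixes0 (swap A A').
Proof. by split; rewrite /swap /= coefM00 mulr0. Qed.

Lemma cmp_swap_mono i j : cmp (mono i j) (swap A A') = A ^+ i * A' ^+ j * mono j i.
Proof. by rewrite (cmp_mono fixes0_swap) /swap /= !exprMn monoX; ring. Qed.

Lemma mdn_cmp_swap k f : mdn k (cmp f (swap A A')) = A ^+ k * md k f.
Proof.
move: f; apply: (@density (fun f => mdn k (cmp f _)) (fun f => A ^+ k * md k f)).
- exact: (lcont_comp (mdn_lcont k) (cmp_lcont fixes0_swap)).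
- exact: (lcont_mull _ (md_lcont k)).
move=> i j; rewrite cmp_swap_mono mdn_diagM; last by apply: isdiagM; apply: isdiagX.
rewrite mdn_mono md_mono; case: eqP => [->|_]; last by rewrite !mulr0.
by rewrite exprD -[A ^+ j * _ * _]mulrA [A ^+ k * _]mulrC mulrA -exprMn AA' expr1n mul1r.
Qed.

Lemma md_cmp_swap k f : md k (cmp f (swap A A')) = A' ^+ k * mdn k f.
Proof.
move: f; apply: (@density (fun f => md k (cmp f _)) (fun f => A' ^+ k * mdn k f)).
- exact: (lcont_comp (md_lcont k) (cmp_lcont fixes0_swap)).
- exact: (lcont_mull _ (mdn_lcont k)).
move=> i j; rewrite cmp_swap_mono md_diagM; last by apply: isdiagM; apply: isdiagX.
rewrite md_mono mdn_mono; case: eqP => [->|_]; last by rewrite !mulr0.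
by rewrite exprD mulrA -exprMn AA' expr1n mul1r.
Qed.

Lemma cmp_swap_diag d : isdiag d -> cmp d (swap A A') = d.
Proof.
move=> hd; apply: modes_eq => [k|k k0].
  rewrite md_cmp_swap; case: k => [|k]; first by rewrite mul1r md0_mdn.
  by rewrite mdn_diag // mulr0 md_diag.
by rewrite mdn_cmp_swap mdn_diag // md_diag //; case: k k0 => // k _; rewrite mulr0.
Qed.

Lemma hord_cmp_swap n f : hord n f -> hord n (cmp f (swap A A')).
Proof.
move=> /hord_factor[q ->]; have [_ _ hM] := cmp_hom fixes0_swap.
rewrite hM cmp_swap_diag; last exact: isdiag_hhX.
by apply: hordMr; apply: hord_hhX.
Qed.

Lemma swap_involutive : compM (swap A A') (swap A A') = idM.
Proof.
have [_ _ hM] := cmp_hom fixes0_swap.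
have c1 := cmp_x1 fixes0_swap; have c2 := cmp_x2 fixes0_swap.
rewrite {1}/compM /= -!/(cmp _ _) !hM (cmp_swap_diag hA) (cmp_swap_diag hA') c1 c2 /=.
by rewrite !mulrA AA' [A' * A]mulrC AA' !mul1r.
Qed.

(** The derivatives of [A] and [A'] drop out: [x1 * d1] and [x2 * d2] agree on diagonal series, and
    [A * A'] is constant. *)
Lemma jac_swap : jac (A * x2) (A' * x1) = -1.
Proof.
have [l1 M1] := d1_deriv; have [l2 M2] := d2_deriv.
rewrite /jac !M1 !M2 d1_x1 d1_x2 d2_x1 d2_x2 !mulr0 !mulr1 !addr0.
have w_eq (d : ps) : isdiag d -> x1 * d1 d = x2 * d2 d.
  move=> hd; rewrite x1_d1 x2_d2; apply: psP => a b; rewrite /w1 /w2.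
  by have [->//|ab] := eqVneq a b; rewrite hd // !mulr0.
have e := w_eq _ hA; have e' := w_eq _ hA'.
have e1 : w1 (A * A') = 0 by rewrite AA' (derivation1 w1_deriv).
move: e1; case: w1_deriv => _ ->; rewrite -!x1_d1 => e1.
have -> : d1 A * x2 * (d2 A' * x1) - (d2 A * x2 + A) * (d1 A' * x1 + A') =
  (x1 * d1 A) * (x2 * d2 A') - (x2 * d2 A + A) * (x1 * d1 A' + A') by ring.
rewrite -e -e'.
have -> : x1 * d1 A * (x1 * d1 A') - (x1 * d1 A + A) * (x1 * d1 A' + A') =
  - (A * A') - (x1 * d1 A * A' + A * (x1 * d1 A')) by ring.
by rewrite e1 AA' subr0.
Qed.
End Swap.

(** * Flows preserving [hh] *)

Definition Ed (p : ps) : ps := fun a b => (a%:R - b%:R) * p a b.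

Lemma EdE p : Ed p = x1 * d1 p - x2 * d2 p.
Proof. by rewrite x1_d1 x2_d2; apply: psP => a b; rewrite coefSB /Ed /w1 /w2 mulrBl. Qed.

Lemma Ed_deriv : derivation Ed.
Proof.
have [l1 M1] := d1_deriv; have [l2 M2] := d2_deriv; split.
  split=> [p q|c p|].
  - by apply: psP => a b; rewrite coefSD /Ed coefSD mulrDr.
  - by apply: psP => a b; rewrite coef_cM /Ed coef_cM mulrCA.
  by exists 0%N => n p; rewrite addn0 => h a b ab; rewrite /Ed h ?mulr0.
by move=> p q; rewrite !EdE M1 M2; ring.
Qed.

Lemma Ed_diag d : isdiag d -> Ed d = 0.
Proof.
move=> hd; apply: psP => a b; rewrite /Ed; have [->|ab] := eqVneq a b.
  by rewrite subrr mul0r.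
by rewrite hd // mulr0.
Qed.

Lemma Ed_x1 : Ed x1 = x1.
Proof. by rewrite EdE d1_x1 d2_x1 mulr0 mulr1 subr0. Qed.

Lemma Ed_diagM d p : isdiag d -> Ed (d * p) = d * Ed p.
Proof. by move=> hd; case: Ed_deriv => _ ->; rewrite Ed_diag // mul0r add0r. Qed.

Lemma ord_Ed n p : ord n p -> ord n (Ed p).
Proof. by move=> h a b ab; rewrite /Ed h ?mulr0. Qed.
Lemma hord_Ed n p : hord n p -> hord n (Ed p).
Proof. by move=> h a b ab; rewrite /Ed h ?mulr0. Qed.
Lemma cj_Ed p : cj (Ed p) = Ed (cj p).
Proof. by apply: psP => a b; rewrite /cj /conjS /Ed rmorphM rmorphB !rmorph_nat. Qed.

(** The Lie derivatives along the vector field w E: [fl w] acts on functions and [lie w] on area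
    forms p dx1 dx2. The latter has this form because E is divergence free. *)
Definition fl (w p : ps) : ps := w * Ed p.
Definition lie (w p : ps) : ps := Ed (w * p).

Lemma fl_deriv w : derivation (fl w).
Proof.
have [l M] := Ed_deriv; split; first exact: lcont_mull.
by move=> p q; rewrite /fl M; ring.
Qed.
Lemma lie_lcont w : lcont (lie w).
Proof. by have [l M] := Ed_deriv; apply: (lcont_comp l (lcont_mull w lcont_id)). Qed.

Lemma fl_raises k w : ord k w -> raises k (fl w).
Proof. by move=> hw n p hp; rewrite addnC; apply: ordM => //; apply: ord_Ed. Qed.
Lemma lie_raises k w : ord k w -> raises k (lie w).
Proof. by move=> hw n p hp; apply: ord_Ed; rewrite addnC; apply: ordM. Qed.

Lemma raisesW k m A : (k <= m)%N -> raises m A -> raises k A.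
Proof. by move=> km h n p hp; apply: ordW (h n p hp); rewrite leq_add2l. Qed.

Lemma jac_fl w f g : jac (fl w f) g + jac f (fl w g) = lie w (jac f g).
Proof.
have [l1 M1] := d1_deriv; have [l2 M2] := d2_deriv.
rewrite /lie /fl /jac !EdE !(M1, M2, lcB l1, lcB l2).
by rewrite !d1_x1 !d1_x2 !d2_x1 !d2_x2 !d1_d2; ring.
Qed.

Lemma ord_d1 n p : ord n p -> ord n.-1 (d1 p).
Proof. by move=> h a b ab; rewrite /d1 h ?mulr0 //; lia. Qed.
Lemma ord_d2 n p : ord n p -> ord n.-1 (d2 p).
Proof. by move=> h a b ab; rewrite /d2 h ?mulr0 //; lia. Qed.
Lemma ord_jac m n p q : ord m p -> ord n q -> ord (m.-1 + n.-1) (jac p q).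
Proof.
by move=> hp hq; apply: ordB; apply: ordM; by [apply: ord_d1 | apply: ord_d2].
Qed.

Lemma jac_lcontl q : lcont (jac^~ q).
Proof.
have [l1 _] := d1_deriv; have [l2 _] := d2_deriv.
have -> : jac^~ q = (fun p => d1 p * d2 q + d2 p * (- d1 q)).
  by apply: funext => p; rewrite /jac mulrN.
by apply: lcont_add; apply: lcont_mulr.
Qed.
Lemma jac_lcontr p : lcont (jac p).
Proof.
have [l1 _] := d1_deriv; have [l2 _] := d2_deriv.
have -> : jac p = (fun q => d1 p * d2 q + (- d2 p) * d1 q).
  by apply: funext => q; rewrite /jac mulNr.
by apply: lcont_add; apply: lcont_mull.
Qed.

(** Each application of [fl w] gains three orders, which pays for those lost by differentiating in
    the Jacobian. *)
Lemma jac_expo_fl w f g : ord 3 w ->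
  jac (expo (fl w) f) (expo (fl w) g) = expo (lie w) (jac f g).
Proof.
move=> hw; have [hD _] := fl_deriv w; have k3 := fl_raises hw.
have k1 := raisesW (isT : (1 <= 3)%N) k3.
apply: (@expo_bil jac (fl w) (fl w) (lie w) 1) => //.
- exact: jac_lcontl.
- exact: jac_lcontr.
- by move=> n p q hp; have := ord_jac hp (@ord0n q); apply: ordW; lia.
- by move=> n p q hq; have := ord_jac (@ord0n p) hq; apply: ordW; lia.
- exact: lie_lcont.
- exact: jac_fl.
move=> i j.
have := ord_jac (raises_iter (n := i) k3 (@ord0n f)) (raises_iter (n := j) k3 (@ord0n g)).
by apply: ordW; lia.
Qed.

Lemma expo_hord A N n p : (forall m q, hord m q -> hord (m + N) (A q)) ->
  hord n p -> hord (n + N) (expo A p - p).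
Proof.
move=> hA hp a b ab; rewrite coefSB /expo /psum big_ord_recl /= coef_cM.
rewrite {1}/ifact fact0 invr1 mul1r addrAC subrr add0r big1 // => i _.
have h : hord (n + N) (iter i.+1 A p).
  elim: (val i) => [|j IH] /=; first exact: hA.
  by apply: (@hordW _ (n + N + N)); [lia | apply: hA].
by rewrite coef_cM [X in _ * X](h a b ab) mulr0.
Qed.

Lemma expo_comm A d p : raises 1 A -> (forall q, A (d * q) = d * A q) ->
  expo A (d * p) = d * expo A p.
Proof.
move=> kA h; apply: ord_eq => m; apply: (ord_trans (@ord_expo A kA m _)).
have E n : iter n A (d * p) = d * iter n A p by elim: n => [|n /= ->].
under eq_bigr do rewrite E mulrCA.
by rewrite -mulr_sumr -mulrBr; apply: ordMl; apply: ord_sym; apply: ord_expo.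
Qed.

Lemma cj_expo A A' f : (forall p, cj (A p) = A' (cj p)) -> cj (expo A f) = expo A' (cj f).
Proof.
move=> h; have E n : cj (iter n A f) = iter n A' (cj f) by elim: n => [|n /= <-].
apply: psP => a b; rewrite /cj /conjS /expo /psum rmorph_sum.
by apply: eq_bigr => n _; rewrite !coef_cM rmorphM /= conj_ifact -E.
Qed.

Definition flowM (w : ps) : fmap := (expo (fl w) x1, expo (fl w) x2).

Section Flow.
Variables (w : ps) (N : nat) (N0 : (0 < N)%N) (w3 : ord 3 w) (wN : hord N w) (wc : cj w = - w).

Lemma fl_raises1 v : ord 3 v -> raises 1 (fl v).
Proof. by move=> hv; apply: (raisesW (isT : (1 <= 3)%N)); apply: fl_raises. Qed.

Lemma ordN3 : ord 3 (- w). Proof. exact: ordN. Qed.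

Lemma fl_hom v : ord 3 v -> pshom (expo (fl v)).
Proof. by move=> hv; apply: expo_hom; [apply: fl_deriv | apply: fl_raises1]. Qed.

Lemma fl_expo_ord v n p : ord 3 v -> ord n p -> ord n (expo (fl v) p).
Proof. by move=> hv; apply: expo_ord; apply: fl_raises1. Qed.

Lemma fixes0_flow v : ord 3 v -> fixes0 (flowM v).
Proof.
by move=> hv; split; apply: (@fl_expo_ord v 1) => //; apply: ord1I.
Qed.

Lemma cmp_flow v f : ord 3 v -> cmp f (flowM v) = expo (fl v) f.
Proof.
move=> hv; move: f; apply: hom_eq.
- exact: cmp_hom (fixes0_flow hv).
- exact: fl_hom.
- exact: cmp_x1 (fixes0_flow hv).
- exact: cmp_x2 (fixes0_flow hv).
Qed.

Lemma cj_fl p : cj (fl w p) = fl (- w) (cj p).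
Proof. by rewrite /fl cjM wc cj_Ed. Qed.

Lemma conjM_flow : conjM (flowM w) = flowM (- w).
Proof.
rewrite /conjM /flowM /= -!/(cj _).
by rewrite !(cj_expo (A' := fl (- w))) ?cj_x1 ?cj_x2 //; apply: cj_fl.
Qed.

Lemma expo_flK p : expo (fl w) (expo (fl (- w)) p) = p.
Proof.
have [h1 _] := fl_deriv w; have [h2 _] := fl_deriv (- w).
apply: expo_inverse => //; [exact: fl_raises1 | exact: (fl_raises1 ordN3) |].
by move=> q; rewrite /fl mulNr.
Qed.
Lemma expo_flNK p : expo (fl (- w)) (expo (fl w) p) = p.
Proof.
have [h1 _] := fl_deriv w; have [h2 _] := fl_deriv (- w).
apply: expo_inverse => //; [exact: (fl_raises1 ordN3) | exact: fl_raises1 |].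
by move=> q; rewrite /fl mulNr opprK.
Qed.

Lemma flow_anti_involution : compM (flowM w) (conjM (flowM w)) = idM.
Proof.
rewrite conjM_flow {1}/compM /= -!/(cmp _ _) !(cmp_flow _ ordN3).
by rewrite !expo_flNK.
Qed.

Lemma fl_hord m q : hord m q -> hord (m + N) (fl w q).
Proof. by move=> h; rewrite addnC; apply: hordM => //; apply: hord_Ed. Qed.

Lemma expo_fl_hord n p : hord n p -> hord (n + N) (expo (fl w) p - p).
Proof. by apply: expo_hord; apply: fl_hord. Qed.

Lemma expo_fl_diag d : isdiag d -> expo (fl w) d = d.
Proof.
move=> hd; have [hl _] := fl_deriv w.
by apply: expo_fix => //; [apply: fl_raises1 | rewrite /fl Ed_diag // mulr0].
Qed.

(** The flow preserves [hh], so it multiplies [x1] and [x2] by reciprocal units, and [L] is the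
    logarithm of the first. The last identity expresses that the flow composed with its conjugate is
    the identity. *)
Lemma flow_log : exists L : ps, [/\ ord 1 L, hord N L,
  expo (fl w) x1 = x1 * expp L, expo (fl w) x2 = x2 * expp (- L) &
  L + expo (fl w) (cj L) = 0].
Proof.
(* [G] is [fl w] conjugated by multiplication by [x1], so that [expo G 1] is the quotient of
   [expo (fl w) x1] by [x1]. *)
pose G (q : ps) := w * (q + Ed q).
have [hEl hEM] := Ed_deriv; have [hfl hfM] := fl_deriv w.
have k1 := fl_raises1 w3; have [hel he1 heM] := fl_hom w3.
have kG : raises 1 G.
  move=> n p hp; apply: (@ordW _ (n + 3)); first by lia.
  by rewrite addnC; apply: ordM => //; apply: ordD => //; apply: ord_Ed.
have E n q : iter n (fl w) (x1 * q) = x1 * iter n G q.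
  elim: n => [|n /= ->] //; rewrite /fl hEM Ed_x1 /G; ring.
have EV : expo (fl w) x1 = x1 * expo G 1.
  rewrite (_ : expo (fl w) x1 = expo (fl w) (x1 * 1)); last by rewrite mulr1.
  apply: ord_eq => m; apply: (ord_trans (@ord_expo _ k1 m _)).
  under eq_bigr do rewrite E mulrCA.
  by rewrite -mulr_sumr -mulrBr; apply: ordMl; apply: ord_sym; apply: ord_expo.
set V := expo G 1 in EV.
have VN : hord N (V - 1).
  have := @expo_hord G N 0 1; rewrite add0n; apply=> // m q hq.
  by rewrite addnC; apply: hordM => //; apply: hordD => //; apply: hord_Ed.
have V1 : V 0%N 0%N = 1.
  by have := VN 0%N 0%N; rewrite coefSB coefS1 minnn /= => /(_ N0) /eqP; rewrite subr_eq0 => /eqP.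
have [L [L1 eL]] := log_exists V1.
have LN : hord N L.
  have [q [q1 eq]] := expp_unit_factor L1; have [r qr] := unit_inv1 q1.
  have -> : L = r * (V - 1) by rewrite -eL eq addrC addKr mulrCA [r * q]mulrC qr mulr1.
  exact: hordMl.
have e1 : expo (fl w) x1 = x1 * expp L by rewrite eL.
exists L; split=> //.
  have : expo (fl w) (x1 * x2) = x1 * x2.
    by apply: expo_fl_diag; have := isdiag_hhX 1; rewrite expr1.
  rewrite heM e1 -mulrA => /x1_inj e2.
  by rewrite -{2}e2 mulrAC exppNK // mul1r.
have cL1 : ord 1 (cj L) by apply: cj_ord.
have oL : ord 1 (expo (fl w) (cj L)) by apply: fl_expo_ord.
apply: expp_eq1; first exact: ordD.
rewrite exppD //.
have := expo_flK x1; have -> : expo (fl (- w)) x1 = cj (expo (fl w) x1).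
  by rewrite (cj_expo (A' := fl (- w))) ?cj_x1 //; apply: cj_fl.
rewrite e1 cjM cj_x1 cj_expp // heM e1.
rewrite (hom_expp (fl_hom w3)) //; last by move=> n q; apply: fl_expo_ord.
by move=> e3; apply: x1_inj; rewrite mulrA e3 mulr1.
Qed.

(** [Ed] annihilates diagonal coefficients, so only the zeroth term of the exponential has a
    diagonal part. *)
Lemma md0_expo_lie p : md 0 (expo (lie w) p) = md 0 p.
Proof.
have k1 : raises 1 (lie w) by apply: (raisesW (isT : (1 <= 3)%N)); apply: lie_raises.
apply: psP => a b; rewrite /md; case: eqP => // _; rewrite addn0.
rewrite /expo /psum big_ord_recl /= coef_cM {1}/ifact fact0 invr1 mul1r.
rewrite big1 ?addr0 // => i _; rewrite coef_cM.
have h : iter i.+1 (lie w) p a a = 0 by rewrite /= {1}/lie /Ed subrr mul0r.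
by rewrite [X in _ * X]h mulr0.
Qed.

Lemma expo_lie_diagM d p : isdiag d -> expo (lie w) (d * p) = d * expo (lie w) p.
Proof.
move=> hd; apply: expo_comm.
  by apply: (raisesW (isT : (1 <= 3)%N)); apply: lie_raises.
by move=> q; rewrite /lie mulrCA (Ed_diagM _ hd).
Qed.
End Flow.

(** * The perturbation *)

Definition chi : ps := fun a b => ((1 < a)%N && (b == 0%N))%:R.

(** [chi] is x1^2 / (1 - x1), hence multiplication by it takes partial sums, which [hockey_stick]
    bounds when the summands are binomial coefficients. *)
Lemma coef_chiM q a b : (chi * q) a b = \sum_(i < a.-1) q i b.
Proof.
rewrite coefSM.
have E (k : 'I_a.+1) : \sum_(l < b.+1) chi k l * q (a - k)%N (b - l)%N =
    (if (1 < k)%N then q (a - k)%N b else 0).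
  rewrite big_ord_recl /= subn0 big1 ?addr0 => [|l _]; last first.
    by rewrite /chi andbF mul0r.
  by rewrite /chi andbT; case: ifP; rewrite ?mul1r ?mul0r.
under eq_bigr do rewrite E.
rewrite (reindex_inj rev_ord_inj) /=.
rewrite (big_ord_widen a.+1 (fun i => q i b)); last by lia.
rewrite [RHS]big_mkcond; apply: eq_bigr => i _; have := ltn_ord i => hi.
have -> : (1 < a.+1 - i.+1)%N = (i < a.-1)%N by lia.
by case: ifP => // h; congr (q _ _); lia.
Qed.

Lemma cj_chi : cj chi = chi.
Proof. by apply: psP => a b; rewrite /cj /conjS rmorph_nat. Qed.

Lemma ord_chi : ord 2 chi.
Proof. by move=> a b ab; rewrite /chi; have -> : (1 < a)%N = false by lia. Qed.

(* The power [N = s + 1] of [hh] outweighs the order, at most [s], of the divisors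
   [alpha^(2k) - 1]. *)
Definition pert (t : C) (N : nat) : ps := cS ('i * t) * hh ^+ N * chi.

Section Pert.
Variables (t : C) (N : nat) (N0 : (0 < N)%N) (tr : t^* = t).

Lemma ord_hhX n : ord n.*2 (hh ^+ n).
Proof. exact: hord_ord (@hord_hhX n). Qed.

Lemma pert_ord : ord 3 (pert t N).
Proof.
apply: (@ordW _ (N.*2 + 2)); first by lia.
by apply: ordM; [apply: ordMl; apply: ord_hhX | apply: ord_chi].
Qed.
Lemma pert_hord : hord N (pert t N).
Proof. by apply: hordMr; apply: hordMl; apply: hord_hhX. Qed.
Lemma cj_hhX n : cj (hh ^+ n) = hh ^+ n.
Proof. by rewrite cjX /hh cjM cj_x1 cj_x2. Qed.
Lemma cj_pert : cj (pert t N) = - pert t N.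
Proof.
rewrite /pert !cjM cjC cj_hhX cj_chi rmorphM /= conjCi tr mulNr rmorphN /=.
by rewrite !mulNr.
Qed.

(** What is left of the generator once [t] and [hh], which commute with it, have been pulled out of
    its powers. *)
Definition ce (p : ps) : ps := chi * Ed p.

Lemma iter_fl_pert n p : iter n (fl (pert t N)) p =
  cS (('i * t) ^+ n) * hh ^+ (N * n) * iter n ce p.
Proof.
elim: n => [|n /= ->]; first by rewrite muln0 !expr0 rmorph1 !mul1r.
rewrite /fl Ed_diagM; last by apply: isdiagM; [apply: isdiagC | apply: isdiag_hhX].
by rewrite /pert /ce mulnS exprS rmorphM exprD; ring.
Qed.
End Pert.

(** The odd double factorial 1 . 3 ... (2n - 1), the rate at which the iterates of [ce] grow.
    Against the [n]! in the exponential it leaves only [2 ^ n], whence the convergence of the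
    flow. *)
Definition dfact n : nat := \prod_(i < n) (i.*2.+1).

Lemma dfactS n : dfact n.+1 = (dfact n * n.*2.+1)%N.
Proof. by rewrite /dfact big_ord_recr. Qed.

Lemma dfact_le n : (dfact n <= 2 ^ n * n`!)%N.
Proof.
elim: n => [|n IH]; first by rewrite /dfact big_ord0.
rewrite dfactS expnS factS.
have : (dfact n * n.*2.+1 <= 2 ^ n * n`! * (2 * n.+1))%N by apply: leq_mul => //; lia.
by move=> h; apply: leq_trans h _; lia.
Qed.

Lemma hockey_stick a r : (\sum_(i < a.-1) 'C(i.+2, r) <= 'C(a.+1, r.+1))%N.
Proof.
elim: a => [|a IH]; first by rewrite big_ord0.
case: a IH => [|a] IH; first by rewrite big_ord0.
rewrite big_ord_recr /= binS leq_add2r; exact: IH.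
Qed.

Lemma bin_le_exp n k : ('C(n, k) <= 2 ^ n)%N.
Proof.
elim: n k => [|n IH] [|k] //; first by rewrite bin0 expn_gt0.
by rewrite binS expnS mul2n -addnn leq_add.
Qed.

(** Degree at most one in [x2], as for the two coordinates and all their images under [ce]. There
    the eigenvalue [a - b] of [Ed] is at most [a + 1] in modulus. *)
Definition thin (p : ps) : Prop := forall a b, (1 < b)%N -> p a b = 0.

Lemma ce_bound n (p : ps) : thin p -> (forall a b, `|p a b| <= 1) ->
  thin (iter n ce p) /\
  forall a b, `|iter n ce p a b| <= (dfact n * 'C(a.+1, n.*2))%:R.
Proof.
move=> tp bp; elim: n => [|n [IHt IHb]].
  by split=> // a b; rewrite bin0 /dfact big_ord0 muln1.
split=> a b; rewrite /= {1}/ce coef_chiM.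
  by move=> hb; rewrite big1 // => i _; rewrite /Ed IHt ?mulr0.
apply: (le_trans (ler_norm_sum _ _ _)).
have := leq_mul (leqnn (dfact n * n.*2.+1)) (hockey_stick a n.*2.+1).
rewrite dfactS doubleS => h; rewrite -(ler_nat C) in h; apply: le_trans h.
rewrite natrM natr_sum mulr_sumr; apply: ler_sum => i _.
have [hb|hb] := ltnP 1 b.
  by rewrite /Ed IHt // mulr0 normr0 mulr_ge0.
rewrite /Ed normrM.
apply: (@le_trans _ _ (i.+1%:R * (dfact n * 'C(i.+1, n.*2))%:R)).
  apply: ler_pM => //; case: b hb => [|[|b]] // _.
    by rewrite subr0 normr_nat ler_nat.
  apply: (le_trans (ler_normB _ _)).
  by rewrite normr_nat normr1 -natr1.
rewrite -!natrM ler_nat.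
(* The eigenvalue bound [i.+1], enlarged to [i.+2], is absorbed by raising the binomial, at the
   price of the factor [n.*2.+1] of the double factorial. *)
have := mul_bin_diag i.+2 n.*2; rewrite /= => e.
rewrite -mulnA -e mulnCA leq_mul2l; apply/orP; right.
by rewrite leq_mul2r leqnSn orbT.
Qed.

Lemma flow_bounded (t : C) N (p : ps) : (0 < N)%N -> thin p ->
  (forall a b, `|p a b| <= 1) -> bounded (expo (fl (pert t N)) p).
Proof.
move=> N0 tp bp; apply/bounded_conv.
pose T : C := 2%:R * (`|t| + 1).
have t0 : 0 <= `|t| by [].
have T1 : 1 <= T.
  rewrite /T; apply: (@le_trans _ _ (1 * 1)); first by rewrite mulr1.
  by apply: ler_pM; rewrite ?ler01 ?ler1n // lerDr.
have T0 : 0 < T by apply: lt_le_trans T1.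
(* [T] dominates twice the modulus of [t], the 2 coming from the double factorial. In the factor 4,
   one 2 pays for the binomial coefficient and one for the [a + b + 1] terms of the sum. *)
exists 2%:R, (4%:R * T); split; first by rewrite mulr_gt0.
move=> a b; rewrite /expo /psum; apply: (le_trans (ler_norm_sum _ _ _)).
apply: (@le_trans _ _ (\sum_(n < (a + b).+1) T ^+ (a + b) * (2 ^ a.+1)%:R)); last first.
  rewrite sumr_const card_ord -[X in X <= _]mulr_natr [(4%:R * T) ^+ _]exprMn.
  have -> : 2%:R * (4%:R ^+ (a + b) * T ^+ (a + b)) =
     T ^+ (a + b) * (2%:R * 4%:R ^+ (a + b)) by ring.
  rewrite -mulrA; apply: ler_wpM2l; first by rewrite exprn_ge0 // ltW.
  rewrite -natrX -!natrM ler_nat expnS -mulnA leq_mul2l /=.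
  have -> : (4 ^ (a + b) = 2 ^ (a + b) * 2 ^ (a + b))%N by rewrite -expnMn.
  apply: leq_mul; first by rewrite leq_exp2l //; lia.
  exact: ltn_expl.
apply: ler_sum => n _; rewrite coef_cM iter_fl_pert -mulrA coef_cM !normrM.
rewrite coef_hhXM; have [_ hb] := ce_bound n tp bp.
have F0 : 0 < (n`!%:R : C) by rewrite ltr0n fact_gt0.
have ni : `|('i * t) ^+ n| = `|t| ^+ n by rewrite normrX normrM normCi mul1r.
rewrite ni; have hi : `|ifact n| = (n`!%:R)^-1 by rewrite /ifact normfV normr_nat.
rewrite hi mulrC ler_pdivrMr //.
apply: (@le_trans _ _ (`|t| ^+ n * (2 ^ n * n`! * 2 ^ a.+1)%:R)).
  apply: ler_wpM2l; first by rewrite exprn_ge0.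
  case: ifP => _; last by rewrite normr0.
  apply: (le_trans (hb _ _)); rewrite ler_nat; apply: leq_mul; first exact: dfact_le.
  apply: (@leq_trans (2 ^ (a - N * n).+1)); last by rewrite leq_exp2l //; lia.
  exact: bin_le_exp.
have h : (2%:R * `|t|) ^+ n <= T ^+ (a + b).
  apply: (@le_trans _ _ (T ^+ n)).
    have h2 : 2%:R * `|t| <= T by apply: ler_wpM2l; rewrite ?lerDl.
    by apply: lerXn2r => //; rewrite nnegrE ?(ltW T0) // mulr_ge0.
  by apply: ler_weXn2l => //; rewrite -ltnS.
have -> : `|t| ^+ n * (2 ^ n * n`! * 2 ^ a.+1)%:R =
    (2%:R * `|t|) ^+ n * ((2 ^ a.+1)%:R * n`!%:R).
  by rewrite !natrM exprMn (natrX _ 2 n); ring.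
by rewrite -mulrA; apply: ler_wpM2r => //; rewrite mulr_ge0.
Qed.

(** * The model and its perturbations *)

Lemma expS_expp c s : (0 < s)%N -> (expS c s : ps) = expp (cS c * hh ^+ s).
Proof.
move=> s0; apply: psP => a b; rewrite /expp /psum.
have E n : (cS (ifact n) * (cS c * hh ^+ s) ^+ n) a b =
    ifact n * (c ^+ n * ((a == s * n) && (b == s * n))%N%:R).
  by rewrite exprMn -rmorphXn -exprM hhX !coef_cM.
under eq_bigr do rewrite E.
rewrite /expS; case: (boolP (_ && _)) => [/andP[/eqP <- sa]|h].
  have hq : (a %/ s < (a + a).+1)%N by apply: leq_ltn_trans (leq_div a s) _; lia.
  rewrite (bigD1 (Ordinal hq)) //= mulnC divnK // eqxx mulr1 big1 ?addr0 => [|n hn].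
    by rewrite /ifact mulrC.
  rewrite -val_eqE /= in hn; rewrite andbb.
  case: eqP => [e|_]; last by rewrite !mulr0.
  have e' : (a %/ s)%N = n by rewrite [X in (X %/ s)%N]e mulKn.
  by rewrite e' eqxx in hn.
rewrite big1 // => n _; case: eqP => [ea|_]; last by rewrite !mulr0.
case: eqP => [eb|_]; last by rewrite !mulr0.
case/negP: h; apply/andP; split; first by apply/eqP; rewrite [LHS]ea [RHS]eb.
by rewrite [X in (_ %| X)%N]ea dvdn_mulr.
Qed.

Definition alp (mu sg : C) s : ps := alphaS mu sg s.
Definition alpi (mu sg : C) s : ps := alphaInvS mu sg s.

Lemma conjM_swap A A' : conjM (swap A A') = swap (cj A) (cj A').
Proof. by rewrite /conjM /swap /= -!/(cj _) !cjM cj_x1 cj_x2. Qed.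

Lemma model_tripleE mu sg s : model_triple mu sg s =
  (swap (alp mu sg s) (alpi mu sg s), swap (alpi mu sg s) (alp mu sg s), idM).
Proof. by []. Qed.

Section Model.
Variables (mu sg : C) (s : nat).
Hypotheses (s0 : (0 < s)%N) (mu1 : `|mu| = 1) (sg1 : sg = 1 \/ sg = -1).

Lemma mu_neq0 : mu != 0.
Proof. by rewrite -normr_eq0 mu1 oner_eq0. Qed.

Lemma conj_mu : mu^* = mu^-1.
Proof. by have := invC_norm mu; rewrite mu1 expr1n invr1 mul1r => ->. Qed.

Lemma sg_neq0 : sg != 0.
Proof. by case: sg1 => ->; rewrite ?oppr_eq0 oner_eq0. Qed.

Lemma conj_sg : sg^* = sg.
Proof. by case: sg1 => ->; rewrite ?rmorphN rmorph1. Qed.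

Definition phase : ps := cS (sg * 'i) * hh ^+ s.

Lemma phase_ord : ord 1 phase.
Proof.
by apply: ordMl; apply: ordW (hord_ord (@hord_hhX s)); lia.
Qed.

Lemma alpE : alp mu sg s = cS mu * expp phase.
Proof.
by rewrite /phase -expS_expp //; apply: psP => a b; rewrite coef_cM.
Qed.
Lemma alpiE : alpi mu sg s = cS mu^-1 * expp (- phase).
Proof.
have -> : - phase = cS (- sg * 'i) * hh ^+ s by rewrite /phase mulNr rmorphN mulNr.
by rewrite -expS_expp //; apply: psP => a b; rewrite coef_cM.
Qed.

Lemma alpK : alp mu sg s * alpi mu sg s = 1.
Proof.
rewrite alpE alpiE mulrACA -rmorphM mulfV ?mu_neq0 // rmorph1 mul1r.
exact: exppNK phase_ord.
Qed.

Lemma alp_diag : isdiag (alp mu sg s).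
Proof. by move=> a b ab; rewrite /alp /alphaS /expS (negPf ab) mulr0. Qed.
Lemma alpi_diag : isdiag (alpi mu sg s).
Proof. by move=> a b ab; rewrite /alpi /alphaInvS /expS (negPf ab) mulr0. Qed.

Lemma cj_phase : cj phase = - phase.
Proof. by rewrite /phase cjM cjC cj_hhX rmorphM /= conj_sg conjCi mulrN rmorphN mulNr. Qed.

Lemma cj_alp : cj (alp mu sg s) = alpi mu sg s.
Proof. by rewrite alpE alpiE cjM cjC cj_expp ?cj_phase ?conj_mu //; apply: phase_ord. Qed.
Lemma cj_alpi : cj (alpi mu sg s) = alp mu sg s.
Proof. by rewrite -cj_alp cjK. Qed.

Lemma norm_sgi : `|sg * 'i| = 1.
Proof. by rewrite normrM normCi mulr1; case: sg1 => ->; rewrite ?normrN normr1. Qed.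

Lemma expS_le1 c a b : `|c| = 1 -> `|expS c s a b| <= 1.
Proof.
move=> c1; rewrite /expS; case: ifP => _; last by rewrite normr0.
rewrite normrM normrX c1 expr1n mul1r normfV normr_nat invf_le1 ?ler1n ?ltr0n ?fact_gt0 //.
Qed.

Lemma alp_bounded : bounded (alp mu sg s).
Proof.
apply: bounded_le1 => a b; rewrite /alp /alphaS normrM mu1 mul1r.
by apply: expS_le1; rewrite norm_sgi.
Qed.
Lemma alpi_bounded : bounded (alpi mu sg s).
Proof. by rewrite -cj_alp; apply: bounded_cj alp_bounded. Qed.

Let tau := swap (alp mu sg s) (alpi mu sg s).
Let taui := swap (alpi mu sg s) (alp mu sg s).

Lemma alpKi : alpi mu sg s * alp mu sg s = 1. Proof. by rewrite mulrC alpK. Qed.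

Lemma conjM_tau : conjM tau = taui.
Proof. by rewrite conjM_swap cj_alp cj_alpi. Qed.

Lemma linpart_compM f g : fixes0 g ->
  linpart (compM f g) = linpart f *m linpart g.
Proof.
move=> hg; apply/matrixP => i j; rewrite !mxE big_ord_recl big_ord1 !mxE /=.
have cA (p : ps) : (cmp p g : ps) 1%N 0%N = p 1%N 0%N * g.1 1%N 0%N + p 0%N 1%N * g.2 1%N 0%N.
  have := congr1 (fun q : ps => q 0%N 0%N) (chain_rule p d1_deriv hg).
  by rewrite /= coefSD !coefM00 !(coef00_cmp hg) /d1 /d2 !mul1r.
have cB (p : ps) : (cmp p g : ps) 0%N 1%N = p 1%N 0%N * g.1 0%N 1%N + p 0%N 1%N * g.2 0%N 1%N.
  have := congr1 (fun q : ps => q 0%N 0%N) (chain_rule p d2_deriv hg).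
  by rewrite /= coefSD !coefM00 !(coef00_cmp hg) /d1 /d2 !mul1r.
case: (i == ord0); case: (j == ord0) => /=; rewrite -/(cmp _ _); by [rewrite cA | rewrite cB].
Qed.

Lemma det2 (R : comNzRingType) (M : 'M[R]_2) :
  \det M = M ord0 ord0 * M ord_max ord_max - M ord0 ord_max * M ord_max ord0.
Proof.
rewrite (expand_det_row _ ord0) big_ord_recl big_ord1 /cofactor !det_mx11 !mxE /=.
rewrite expr0 expr1 mul1r mulN1r mulrN.
by congr (_ * M _ _ - M _ _ * M _ _); apply: val_inj.
Qed.

Lemma char_poly_swap (A A' : ps) : A * A' = 1 ->
  char_poly (linpart (swap A A')) = 'X ^+ 2 - 1.
Proof.
move=> AA'; rewrite /char_poly det2 /char_poly_mx !mxE /=.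
have e : A 0%N 0%N * A' 0%N 0%N = 1 by rewrite -coefM00 AA' coefS1.
rewrite ![_ * x2]mulrC ![_ * x1]mulrC !coef_x1M !coef_x2M /=.
by rewrite !mulr1n !mulr0n !sub0r subr0 mulrNN -polyCM e expr2 polyC1.
Qed.

Section Triple.
Variables (t : C) (N : nat) (N0 : (0 < N)%N) (tr : t^* = t).
Let w := pert t N.
Let K := flowM w.
Let w3 : ord 3 w := @pert_ord t N N0.
Let wN : hord N w := @pert_hord t N.
Let wc : cj w = - w := @cj_pert t N tr.

Definition pert_triple : triple :=
  (tau, compM K (compM (conjM tau) (conjM K)), K).

Lemma K_fixes0 : fixes0 K. Proof. exact: fixes0_flow. Qed.

Lemma K_bounded : bounded K.1 /\ bounded K.2.
Proof.
split; apply: flow_bounded => //.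
- by move=> a b hb; rewrite /X1; case: b hb => // b _; rewrite andbF.
- by move=> a b; rewrite /X1; case: (_ && _); rewrite ?normr1 ?normr0.
- by move=> a b hb; rewrite /X2; case: b hb => [|[|b]] // _; rewrite andbF.
- by move=> a b; rewrite /X2; case: (_ && _); rewrite ?normr1 ?normr0.
Qed.

Lemma linpart_K : linpart K = 1%:M.
Proof.
have h (p : ps) a b : (a + b < 2)%N -> expo (fl w) p a b = p a b.
  move=> ab; apply: (@ord_coef 2) => //.
  apply: ordW (hord_ord (@expo_fl_hord w N wN 0 p (hord0n p))); lia.
apply/matrixP => i j; rewrite !mxE.
case: i => [[|[|i]] hi] //; case: j => [[|[|j]] hj] //=; rewrite h //=.
Qed.

Lemma compM_bounded f g : fixes0 g -> bounded f.1 -> bounded f.2 ->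
  bounded g.1 -> bounded g.2 -> bounded (compM f g).1 /\ bounded (compM f g).2.
Proof. by move=> hg f1 f2 g1 g2; split; apply: bounded_cmp. Qed.

Lemma conjM_bounded f : bounded f.1 -> bounded f.2 ->
  bounded (conjM f).1 /\ bounded (conjM f).2.
Proof. by move=> h1 h2; split; apply: bounded_cj. Qed.

Lemma tau_bounded : bounded tau.1 /\ bounded tau.2.
Proof.
split; apply: bounded_mul;
  by [apply: alp_bounded | apply: alpi_bounded | apply: bounded_x1 | apply: bounded_x2].
Qed.

Lemma K_cjK : compM K (conjM K) = idM.
Proof. exact: flow_anti_involution. Qed.

Lemma cjK_K : compM (conjM K) K = idM.
Proof.
have := congr1 conjM K_cjK.
by rewrite conjM_compM ?conjMK; [rewrite /conjM /idM /= -!/(cj _) cj_x1 cj_x2 | apply: fixes0_conjM K_fixes0].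
Qed.

Lemma MW_pert_triple : MW_triple pert_triple.
Proof.
have fK := K_fixes0; have fK' := fixes0_conjM fK.
have ft : fixes0 tau by apply: fixes0_swap.
have fti : fixes0 taui by apply: fixes0_swap.
have [K1 K2] := K_bounded; have [K1' K2'] := conjM_bounded K1 K2.
have [t1 t2] := tau_bounded; have [t1' t2'] := conjM_bounded t1 t2.
split; [|split; [|split]] => //.
- split; first by split; apply/bounded_conv.
  split=> //; split; first exact: (swap_involutive alp_diag alpi_diag alpK).
  exact: char_poly_swap alpK.
- have fc : fixes0 (compM (conjM tau) (conjM K)).
    by apply: fixes0_compM => //; apply: fixes0_conjM.
  have [c1 c2] := compM_bounded fK' t1' t2' K1' K2'.
  have [c3 c4] := compM_bounded fc K1 K2 c1 c2.
  split; first by split; apply/bounded_conv.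
  split; first exact: fixes0_compM.
  rewrite conjM_tau in fc *.
  have ti2 : compM taui taui = idM := swap_involutive alpi_diag alp_diag alpKi.
  have fc2 := fixes0_compM fti fK'.
  split.
    (* [conjM K] is the inverse of [K], so the square telescopes to [taui] composed with itself. *)
    rewrite (compMA _ fc2 (fixes0_compM fK fc2)) (compMA _ fK' (fixes0_compM fK fc2)).
    rewrite -(compMA (conjM K) fK fc2) cjK_K compM_idl //.
    rewrite -(compMA taui fti fK') ti2 compM_idl //.
    exact: K_cjK.
  rewrite (linpart_compM _ fc2) (linpart_compM _ fK') linpart_K mul1mx.
  have -> : linpart (conjM K) = 1%:M.
    have := linpart_compM (conjM K) fK; rewrite cjK_K linpart_K mulmx1 => <-.
    by apply/matrixP => i j; rewrite !mxE; case: i => [[|[|i]] hi] //; case: j => [[|[|j]] hj].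
  by rewrite mulmx1; apply: char_poly_swap alpKi.
- by split; [split; apply/bounded_conv | split; [|exact: K_cjK]].
Qed.
End Triple.
End Model.

(** * Formal equivalence *)

Section Formal.
Variables (mu sg : C) (s : nat).
Hypotheses (s0 : (0 < s)%N) (mu1 : `|mu| = 1) (sg1 : sg = 1 \/ sg = -1).
Let A := alp mu sg s.
Let A' := alpi mu sg s.
Let AA' : A * A' = 1 := alpK sg s0 mu1.
Let hA : isdiag A := @alp_diag mu sg s.
Let hA' : isdiag A' := @alpi_diag mu sg s.
Let tau := swap A A'.

Lemma alpX n : A ^+ n = cS (mu ^+ n) * (expS (n%:R * (sg * 'i)) s : ps).
Proof.
rewrite /A alpE // exprMn -rmorphXn /= -exppMn; last exact: phase_ord.
rewrite expS_expp // /phase; congr (_ * expp _).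
by rewrite [cS (n%:R * _)]rmorphM rmorph_nat -mulrA mulr_natl.
Qed.

Lemma coef_alpX n i : (A ^+ n) i i =
  mu ^+ n * (if (s %| i)%N then (n%:R * (sg * 'i)) ^+ (i %/ s) / ((i %/ s)`!)%:R else 0).
Proof. by rewrite alpX coef_cM /expS eqxx. Qed.

(** If mu^k differs from 1 the constant term survives; otherwise the leading term is the first
    nonconstant one of alpha^k, namely k sg i h^s. *)
Lemma dval_alp k : (0 < k)%N -> exists2 v, (v <= s)%N & dval v (A ^+ k - 1).
Proof.
move=> k0; have hd : isdiag (A ^+ k - 1) by apply: isdiagB; [apply: isdiagX | apply: isdiag1].
have c0 : (A ^+ k - 1) 0%N 0%N = mu ^+ k - 1.
  by rewrite coefSB coefS1 coef_alpX dvdn0 div0n expr0 fact0 divr1 mulr1.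
have [e|ne] := eqVneq (mu ^+ k) 1; last first.
  by exists 0%N => //; split=> //; rewrite c0 subr_eq0.
exists s => //; split=> // [i hi|].
  case: i hi => [|i] hi; first by rewrite c0 e subrr.
  rewrite coefSB coefS1 coef_alpX subr0.
  by case: ifP => [/dvdn_leq|_]; [lia | rewrite mulr0].
rewrite coefSB coefS1 coef_alpX dvdnn divnn s0 /= divr1 e mul1r.
have -> : (s == 0%N) = false by lia.
rewrite subr0 !mulf_neq0 //; first by rewrite pnatr_eq0 -lt0n.
  exact: sg_neq0.
exact: neq0Ci.
Qed.

Lemma alpX_conj k : cj (A ^+ k) = A' ^+ k.
Proof. by rewrite cjX cj_alp. Qed.

Lemma alpXK k : A' ^+ k * A ^+ k = 1.
Proof. by rewrite -exprMn mulrC AA' expr1n. Qed.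

(** [q k] will be the mode in [x1 ^+ k] of the unknown of [solver]. Quotients being unique, one
    choice of [q k] serves for all [n]. *)
Lemma solve_modes e : hord s e -> exists q : nat -> ps,
  forall k, (0 < k)%N -> [/\ isdiag (q k),
    (A ^+ k.*2 - 1) * q k = - (A ^+ k * mdn k e + md k e) &
    forall n, hord (n + s) e -> hord n (q k)].
Proof.
move=> he.
suff /choice[q hq] : forall k, exists q : ps, (0 < k)%N -> [/\ isdiag q,
    (A ^+ k.*2 - 1) * q = - (A ^+ k * mdn k e + md k e) &
    forall n, hord (n + s) e -> hord n q] by exists q.
move=> k.
have [->|k0] := posnP k; first by exists 0.
have [|v vs hv] := @dval_alp k.*2; first by lia.
have hr n : hord (n + s) e -> hord (n + v) (- (A ^+ k * mdn k e + md k e)).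
  move=> h; apply: (@hordW _ (n + s)); first by lia.
  by apply: hordN; apply: hordD; [apply: hordMl; apply: hord_mdn | apply: hord_md].
have [q [eq _]] := dval_div hv (hr 0%N he).
exists q => _; split=> //.
  apply: (dval_diag hv eq); apply: isdiagN; apply: isdiagD; last exact: isdiag_md.
  by apply: isdiagM; [apply: isdiagX | apply: isdiag_mdn].
move=> n hn; have [q' [eq' hq']] := dval_div hv (hr n hn).
by rewrite (dval_cancel hv (etrans eq (esym eq'))).
Qed.

Lemma isdiag_eq p q : isdiag p -> isdiag q -> (forall i, p i i = q i i) -> p = q.
Proof.
move=> hp hq h; apply: psP => a b; have [->|ab] := eqVneq a b; first exact: h.
by rewrite hp ?hq.
Qed.

(** The cohomological equation of the problem. For [k > 0] the condition with [tau] forces the mode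
    in [x2 ^+ k] to be [- A ^+ k] times the one in [x1 ^+ k]; eliminating the conjugate from the two
    mode equations of the other condition leaves a division by [A ^+ k.*2 - 1]. *)
Lemma solver e : cj e = - e -> hord s e -> exists d : ps,
  [/\ forall n, hord (n + s) e -> hord n d,
      d + cmp d tau = md 0 e & cj d - d = - e].
Proof.
move=> ce he; have [q hq] := solve_modes he.
(* On the diagonal half of [e] meets both conditions, since [e] is anti-real. *)
pose d : ps := fun a b => if a == b then 2%:R^-1 * e a b else
  if (b < a)%N then q (a - b)%N b b else - (A ^+ (b - a) * q (b - a)%N) a a.
have d0 : md 0 d = cS 2%:R^-1 * md 0 e.
  apply: isdiag_eq => [||i]; first exact: isdiag_md.
    by apply: isdiagM; [apply: isdiagC | apply: isdiag_md].
  by rewrite coef_cM !md_coef /d !addn0 eqxx.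
have dp k : (0 < k)%N -> md k d = q k.
  move=> k0; have [qd _ _] := hq k k0.
  apply: isdiag_eq => // [|i]; first exact: isdiag_md.
  rewrite md_coef /d; have -> : ((i + k)%N == i) = false by lia.
  by have -> : (i < i + k)%N by [lia]; rewrite addKn.
have dm k : (0 < k)%N -> mdn k d = - (A ^+ k * q k).
  move=> k0; have [qd _ _] := hq k k0.
  apply: isdiag_eq => [||i]; first exact: isdiag_mdn.
    by apply: isdiagN; apply: isdiagM => //; apply: isdiagX.
  rewrite mdn_coef /d; have -> : (i == (i + k)%N) = false by lia.
  by have -> : (i + k < i)%N = false by [lia]; rewrite addKn coefSN.
have half : cS 2%:R^-1 + cS 2%:R^-1 = 1.
  by rewrite -rmorphD -(rmorph1 cS); congr cS; field.
exists d; split.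
- move=> n hn a b ab; rewrite /d; case: eqP => [e1|ne].
    by rewrite hn ?mulr0 //; lia.
  case: ltnP => h.
    have k0 : (0 < a - b)%N by lia.
    by have [_ _ hqn] := hq _ k0; apply: (hqn n hn); lia.
  have k0 : (0 < b - a)%N by lia.
  have [_ _ hqn] := hq _ k0.
  by rewrite [X in - X](hordMl (A ^+ (b - a)) (hqn n hn)) ?oppr0 //; lia.
- have lm k := lcD (md_lcont k); have lmn k := lcD (mdn_lcont k).
  apply: modes_eq => [k|k k0].
    rewrite lm (md_cmp_swap hA hA' AA') (md_diag _ (@isdiag_md 0 e)).
    case: k => [|k]; first by rewrite mul1r md0_mdn d0 -mulrDl half mul1r.
    by rewrite dp // dm // mulrN mulrA alpXK mul1r subrr.
  rewrite lmn (mdn_cmp_swap hA hA' AA') (mdn_diag _ (@isdiag_md 0 e)) //.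
  by rewrite dp // dm // addNr.
have lm k := lcB (md_lcont k); have lmn k := lcB (mdn_lcont k).
have cmd k : cj (md k e) = - md k e by rewrite cj_md ce (lcN (md_lcont k)).
have cmdn k : cj (mdn k e) = - mdn k e by rewrite cj_mdn ce (lcN (mdn_lcont k)).
(* Conjugating the divided equation gives one for [cj (q k)]. As [e] is anti-real and [A'] is the
   conjugate of [A], the two together give back both mode equations from which the conjugate was
   eliminated. *)
have key k : (0 < k)%N ->
    cj (q k) - q k = - md k e /\ - (A' ^+ k * cj (q k)) + A ^+ k * q k = - mdn k e.
  move=> k0; have [qd eq _] := hq k k0.
  have [|v vs hv] := @dval_alp k.*2; first by lia.
  have eA : A ^+ k.*2 = A ^+ k * A ^+ k by rewrite -addnn exprD.
  have K := alpXK k.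
  have := congr1 cj eq; rewrite cjM cjB cj1 cjN cjD cjM !cmd !cmdn eA cjM alpX_conj => ceq.
  rewrite eA in eq hv.
  have ceq2 : (A ^+ k * A ^+ k - 1) * cj (q k) = - (A ^+ k * mdn k e + A ^+ k * A ^+ k * md k e).
    set X := A ^+ k in K eq ceq hv *; set Y := A' ^+ k in K eq ceq hv *.
    have -> : (X * X - 1) * cj (q k) = - (X * X) * ((Y * Y - 1) * cj (q k)) +
       ((Y * X) * (Y * X) - 1) * cj (q k) by ring.
    rewrite ceq K.
    have -> : - (X * X) * - (Y * - mdn k e + - md k e) =
      - ((Y * X) * X * mdn k e + X * X * md k e) by ring.
    by rewrite K; ring.
  split; apply: (dval_cancel hv).
    by rewrite mulrBr ceq2 eq; ring.
  rewrite mulrDr mulrN mulrCA ceq2 mulrCA eq.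
  set X := A ^+ k in K *; set Y := A' ^+ k in K *.
  have -> : - (Y * - (X * mdn k e + X * X * md k e)) + X * - (X * mdn k e + md k e) =
    (Y * X) * mdn k e + (Y * X) * X * md k e - X * X * mdn k e - X * md k e by ring.
  by rewrite K; ring.
apply: modes_eq => [k|k k0].
  rewrite lm (lcN (md_lcont k)) -cj_md; case: k => [|k].
    rewrite d0 cjM cjC cmd fmorphV rmorph_nat.
    have -> : cS 2%:R^-1 * - md 0 e - cS 2%:R^-1 * md 0 e =
      - ((cS 2%:R^-1 + cS 2%:R^-1) * md 0 e) by ring.
    by rewrite half mul1r.
  by rewrite dp //; case: (key k.+1).
rewrite lmn (lcN (mdn_lcont k)) -cj_mdn dm // cjN cjM alpX_conj opprK.
by case: (key k k0).
Qed.

Section Flow.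
Variables (w L : ps).
Hypotheses (w3 : ord 3 w) (wN : hord s.+1 w) (wc : cj w = - w).
Hypotheses (LN : hord s.+1 L) (Lc : L + expo (fl w) (cj L) = 0).
Let X := expo (fl w).
Let lX : lcont X.
Proof. by have [h _] := fl_deriv w; apply: expo_lcont => //; apply: fl_raises1. Qed.

Lemma flow_hord n p : hord n p -> hord n (X p).
Proof.
move=> hp; have -> : X p = (X p - p) + p by rewrite subrK.
by apply: hordD => //; apply: hordW (expo_fl_hord wN hp); lia.
Qed.

(* The defect of [cj u = X u + L], the condition that [x1 * expp u] be a conjugacy to a
   real form; by [err_sym] it is anti-real up to terms of higher order in [hh]. *)
Definition err (u : ps) : ps := cj u - X u - L.

Lemma err_sym u : err u = - X (cj (err u)).
Proof.
rewrite /err !cjB cjK !(lcB lX).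
have -> : X (cj (X u)) = cj u.
  by rewrite /X (cj_expo (A' := fl (- w))) ?(expo_flK w3) //; apply: cj_fl.
have -> : X (cj L) = - L by apply/eqP; rewrite -addr_eq0 addrC Lc.
by ring.
Qed.

(** [c] is the change in the logarithm of alpha that the radial factor has to absorb: anti-real so
    that this factor is real, and of order [s.+1] so that [c] divided by [hh ^+ s] vanishes at the
    origin. *)
Definition good (n : nat) (u : ps) : Prop := hord (n + s.+1) (err u) /\
  exists c, [/\ u + cmp u tau = c, isdiag c, cj c = - c & hord s.+1 c].

(** Only the anti-real part of the error is corrected; by [err_sym] its real part is already [s.+1]
    orders smaller. Of the [n + s.+1] orders the division loses [s], so the correction has order
    [n.+1], and the flow moves it only by terms [s.+1] orders higher. *)
Lemma good_step n u : good n u -> exists v, good n.+1 v /\ hord n.+1 (v - u).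
Proof.
move=> [he [c [ec dc cc hc]]]; set e := err u in he.
pose e' := cS 2%:R^-1 * (e - cj e).
have ce' : cj e' = - e'.
  by rewrite /e' cjM cjB cjK cjC fmorphV rmorph_nat; ring.
have he' : hord (n + s.+1) e' by apply: hordMl; apply: hordB => //; apply: hord_cj.
have [|d [d1 d2 d3]] := solver ce'; first by apply: hordW he'; lia.
have hd : hord n.+1 d by apply: d1; apply: hordW he'; lia.
exists (u + d); split; last by rewrite addrAC subrr add0r.
have [hl _ _] := cmp_hom (@fixes0_swap A A').
split; last first.
  exists (c + md 0 e'); split.
  - by rewrite -ec -d2 (lcD hl) addrACA.
  - by apply: isdiagD => //; apply: isdiag_md.
  - by rewrite cjD cc cj_md ce' (lcN (md_lcont 0)) opprD.
  - by apply: hordD => //; apply: hord_md; apply: hordW he'; lia.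
have half : cS 2%:R^-1 + cS 2%:R^-1 = 1.
  by rewrite -rmorphD -(rmorph1 cS); congr cS; field.
have E : err (u + d) = cS 2%:R^-1 * (e + cj e) - (X d - d).
  have -> : err (u + d) = e + (cj d - d) - (X d - d).
    by rewrite /err cjD (lcD lX) -/(err u) /e /err; ring.
  rewrite d3 /e'; congr (_ - _).
  have -> : e - cS 2%:R^-1 * (e - cj e) = (1 - cS 2%:R^-1) * e + cS 2%:R^-1 * cj e by ring.
  by rewrite -half; ring.
rewrite E; apply: hordB.
  apply: hordMl; rewrite {1}/e err_sym -/e addrC -opprB; apply: hordN.
  by apply: hordW (expo_fl_hord wN (hord_cj he)); lia.
by apply: hordW (expo_fl_hord wN hd); lia.
Qed.

Lemma good0 : good 0 0.
Proof.
have [hl _ _] := cmp_hom (@fixes0_swap A A').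
have cj0 : cj 0 = 0 by rewrite -[0](subrr (0 : ps)) cjB !subrr.
split; first by rewrite /err cj0 (lc0 lX) subrr sub0r; apply: hordN.
by exists 0; split=> //; rewrite ?(lc0 hl) ?addr0 ?cj0 ?oppr0.
Qed.

Lemma good_limit : exists u c : ps, [/\ hord 1 u,
  u + cmp u tau = c, isdiag c, cj c = - c & hord s.+1 c] /\ cj u = X u + L.
Proof.
have [step hstep] := @choice (nat * ps) ps
  (fun x v => good x.1 x.2 -> good x.1.+1 v /\ hord x.1.+1 (v - x.2))
  (fun x => match pselect (good x.1 x.2) with
    | left h => let: ex_intro v hv := good_step h in ex_intro _ v (fun _ => hv)
    | right h => ex_intro _ 0 (fun h' => False_ind _ (h h')) end).
pose U := fix U n := if n is n'.+1 then step (n', U n') else 0.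
have gU n : good n (U n) by elim: n => [|n IH]; [apply: good0 | case: (hstep (n, U n) IH)].
have dU n : hord n.+1 (U n.+1 - U n) by case: (hstep (n, U n) (gU n)).
have cU n m : hord n.+1 (U (n + m)%N - U n).
  elim: m => [|m IH]; first by rewrite addn0 subrr.
  by rewrite addnS; apply: hord_trans IH; apply: hordW (dU _); lia.
(* Coefficients of order [m] in [hh] are frozen from the [m]-th approximation on. *)
pose u : ps := fun a b => U (minn a b) a b.
have hu n : hord n.+1 (u - U n).
  move=> a b ab; rewrite coefSB /u; apply/eqP; rewrite subr_eq0 eq_sym -subr_eq0.
  have -> : n = (minn a b + (n - minn a b))%N by lia.
  by rewrite -coefSB cU.
have [hl _ _] := cmp_hom (@fixes0_swap A A').
have hc n c : U n + cmp (U n) tau = c -> hord n.+1 (u + cmp u tau - c).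
  move=> <-; have -> : u + cmp u tau - (U n + cmp (U n) tau) = (u - U n) + cmp (u - U n) tau.
    by rewrite (lcB hl); ring.
  by apply: hordD => //; apply: (hord_cmp_swap hA hA' AA').
have hcc a b : exists2 c, [/\ isdiag c, cj c = - c & hord s.+1 c] &
    (u + cmp u tau) a b = c a b.
  have [_ [c [ec dc cc hsc]]] := gU (minn a b).
  exists c => //; apply/eqP; rewrite -subr_eq0 -coefSB; apply/eqP.
  by apply: (hc _ _ ec).
exists u, (u + cmp u tau); split; last first.
  apply/eqP; rewrite -subr_eq0 opprD addrA; apply/eqP; apply: (@hord_eq _ 0) => n.
  rewrite subr0 -/(err u).
  have -> : err u = err (U n) + (cj (u - U n) - X (u - U n)).
    by rewrite /err cjB (lcB lX); ring.
  apply: hordD; first by have [h _] := gU n; apply: hordW h; lia.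
  have h : hord n (u - U n) by apply: hordW (hu n); lia.
  by apply: hordB; [apply: hord_cj | apply: flow_hord].
split=> //.
- by have := hu 0%N; rewrite subr0.
- by move=> a b ab; have [c [dc _ _] ->] := hcc a b; apply: dc.
- apply: psP => a b; have [c [_ cc _] e] := hcc a b.
  by rewrite {1}/cj /conjS coefSN e -coefSN -cc.
- by move=> a b ab; have [c [_ _ hsc] ->] := hcc a b; apply: hsc.
Qed.
End Flow.
End Formal.

(** * The formal conjugacy *)

Lemma fmapP (p q p' q' : ps) : p = p' -> q = q' -> (p, q) = (p', q') :> fmap.
Proof. by move=> -> ->. Qed.

Section Conjugacy.
Variables (mu sg : C) (s : nat).
Hypotheses (s0 : (0 < s)%N) (mu1 : `|mu| = 1) (sg1 : sg = 1 \/ sg = -1).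
Let A := alp mu sg s.
Let A' := alpi mu sg s.
Let AA' : A * A' = 1 := alpK sg s0 mu1.
Let hA : isdiag A := @alp_diag mu sg s.
Let hA' : isdiag A' := @alpi_diag mu sg s.
Let tau := swap A A'.
Let ph := phase sg s.

Lemma phase_inj p q : ph * p = ph * q -> p = q.
Proof.
rewrite /ph /phase -!mulrA => e; apply: (@hhX_inj s).
have n0 : sg * 'i != 0 by rewrite mulf_neq0 ?neq0Ci ?sg_neq0.
have K x : cS (sg * 'i)^-1 * (cS (sg * 'i) * x) = x.
  by rewrite mulrA -rmorphM mulVf // rmorph1 mul1r.
by rewrite -[LHS]K e K.
Qed.

(** A map with radial logarithm [l] multiplies h by exp(2 l), hence the phase by exp(2 s l). So [l]
    is log(1 + c / phase) / (2 s), and [c / phase] vanishes at the origin by the order of [c]. *)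
Lemma radial_log (c : ps) : isdiag c -> cj c = - c -> hord s.+1 c ->
  exists l : ps, [/\ ord 1 l, cj l = l, cmp l tau = l,
    forall w, ord 3 w -> expo (fl w) l = l & ph * expp (l *+ s.*2) = ph + c].
Proof.
move=> dc cc hc.
have n0 : sg * 'i != 0 by rewrite mulf_neq0 ?neq0Ci ?sg_neq0.
have [c1 ec1] := @hord_factor s c (hordW (leqnSn s) hc).
pose z := cS (sg * 'i)^-1 * c1.
have ez : ph * z = c.
  rewrite ec1 /ph /phase /z.
  have -> : cS (sg * 'i) * hh ^+ s * (cS (sg * 'i)^-1 * c1) =
    cS (sg * 'i) * cS (sg * 'i)^-1 * (hh ^+ s * c1) by ring.
  by rewrite -rmorphM mulfV // rmorph1 mul1r.
have cz : cj z = z.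
  apply: phase_inj; rewrite ez; have := congr1 cj ez.
  by rewrite cjM cj_phase // cc mulNr => /oppr_inj.
have phd : isdiag ph by apply: isdiagM; [apply: isdiagC | apply: isdiag_hhX].
have dz : isdiag z.
  have : ph * z = ph * md 0 z by rewrite -md_diagM // ez md_diag.
  by move/phase_inj ->; apply: isdiag_md.
have z00 : z 0%N 0%N = 0.
  rewrite /z coef_cM; suff -> : c1 0%N 0%N = 0 by rewrite mulr0.
  have := hc s s; rewrite minnn ltnSn ec1 coef_hhXM leqnn /= subnn.
  by apply.
have v1 : (1 + z : ps) 0%N 0%N = 1 by rewrite coefSD z00 addr0.
have [l0 [o0 e0]] := log_exists v1.
have zz1 : cj (1 + z) = 1 + z by rewrite cjD cj1 cz.
have c0 : cj l0 = l0.
  by apply: expp_inj => //; [apply: cj_ord | rewrite -cj_expp // e0].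
have ft := @fixes0_swap A A'.
have t0 : cmp l0 tau = l0.
  apply: expp_inj => //; first exact: cmp_ord.
  rewrite -cmp_expp // e0; apply: (cmp_swap_diag hA hA' AA').
  by apply: isdiagD => //; apply: isdiag1.
have f0 w : ord 3 w -> expo (fl w) l0 = l0.
  move=> w3; apply: expp_inj => //; first exact: fl_expo_ord.
  rewrite -(hom_expp (fl_hom w3)) //; last by move=> n q; apply: fl_expo_ord.
  by rewrite e0; apply: expo_fl_diag => //; apply: isdiagD => //; apply: isdiag1.
pose k := cS (s.*2%:R)^-1.
have nk : (s.*2%:R : C) != 0 by rewrite pnatr_eq0; lia.
have [hl _ _] := cmp_hom ft.
exists (k * l0); split.
- exact: ordMl.
- by rewrite cjM c0 /k cjC fmorphV rmorph_nat.
- by rewrite (lcZ hl) t0.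
- move=> w w3; have [hfl _ _] := fl_hom w3.
  by rewrite (lcZ hfl) f0.
- have -> : (k * l0) *+ s.*2 = l0.
    rewrite -mulr_natl /k mulrA -(rmorph_nat cS) -rmorphM mulfV //.
    by rewrite rmorph1 mul1r.
  by rewrite e0 mulrDr mulr1 ez.
Qed.

Lemma formal_pert_triple t : t^* = t ->
  formally_equivalent (pert_triple mu sg s t s.+1) (model_triple mu sg s).
Proof.
move=> tr; set w := pert t s.+1.
have w3 : ord 3 w by apply: pert_ord.
have wN : hord s.+1 w by apply: pert_hord.
have wc : cj w = - w by apply: cj_pert.
have [L [L1 LN K1 K2 Lc]] := flow_log (ltn0Sn s) w3 wN wc.
have [u [c [[u1 ec dc cc hc] cu]]] := good_limit s0 mu1 sg1 w3 wN wc LN Lc.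
have [l [l1 cl tl fll el]] := radial_log dc cc hc.
have ft := @fixes0_swap A A'.
have [ht ht1 htM] := cmp_hom ft.
have [hX hX1 hXM] := fl_hom w3.
have ou : ord 1 u by apply: ordW (hord_ord u1).
have oc : ord 1 c by apply: ordW (hord_ord hc); lia.
have oXu : ord 1 (expo (fl w) u) by apply: fl_expo_ord.
have otu : ord 1 (cmp u tau) by apply: cmp_ord.
(* For this shape the conjugacy of the first involution amounts to [u + cmp u tau = c] together with
   alpha being multiplied by [expp c], and that of the real structure to
   [cj u = expo (fl w) u + L]. *)
pose Psi : fmap := (x1 * expp (l + u), x2 * expp (l - u)).
have fP : fixes0 Psi by split; rewrite /= coefM00 mul0r.
have [hP hP1 hPM] := cmp_hom fP.
have cP1 : cmp x1 Psi = x1 * expp (l + u) := cmp_x1 fP.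
have cP2 : cmp x2 Psi = x2 * expp (l - u) := cmp_x2 fP.
have hPC := fun c => homC c (cmp_hom fP).
have ePh : cmp ph Psi = ph + c.
  rewrite -el /ph /phase hPM hPC (homX _ _ (cmp_hom fP)) /hh hPM cP1 cP2.
  have -> : x1 * expp (l + u) * (x2 * expp (l - u)) = x1 * x2 * (expp (l + u) * expp (l - u)) by ring.
  rewrite -exppD; [|exact: ordD|exact: ordB].
  have -> : l + u + (l - u) = l *+ 2 by rewrite mulr2n; ring.
  rewrite exprMn -exppMn; last by rewrite mulr2n; apply: ordD.
  by rewrite -mulrnA mul2n mulrA.
have oph : ord 1 ph by apply: phase_ord.
have eA : cmp A Psi = A * expp c.
  by rewrite /A alpE // (lcZ hP) cmp_expp // -/ph ePh exppD // mulrA.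
have eA' : cmp A' Psi = A' * expp (- c).
  rewrite /A' alpiE // (lcZ hP) cmp_expp -/ph ?(lcN hP) ?ePh //; last exact: ordN.
  by rewrite opprD exppD ?mulrA //; apply: ordN.
have etu : cmp u tau = c - u by rewrite -ec addrC addKr.
have P_tau : compM Psi tau = compM tau Psi.
  rewrite /compM /= -!/(cmp _ _) !htM !hPM.
  rewrite !(cmp_expp ft); [|exact: ordB|exact: ordD].
  rewrite (lcD ht) (lcB ht) tl etu (cmp_x1 ft) (cmp_x2 ft) /= -/A -/A' eA eA' cP1 cP2.
  have oN : ord 1 (- c) by apply: ordN.
  have olu : ord 1 (l + u) by apply: ordD.
  have olu' : ord 1 (l - u) by apply: ordB.
  have -> : l + (c - u) = c + (l - u) by ring.
  have -> : l - (c - u) = - c + (l + u) by ring.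
  by rewrite (exppD oc olu') (exppD oN olu); apply: fmapP; ring.
have P_K : compM Psi (flowM w) = conjM Psi.
  rewrite /compM /conjM /= -!/(cmp _ _) !cmp_flow // !hXM K1 K2 -!/(cj _).
  have hE p : ord 1 p -> expo (fl w) (expp p) = expp (expo (fl w) p).
    by apply: hom_expp (fl_hom w3) _ => n q; apply: fl_expo_ord.
  rewrite !hE; [|exact: ordB|exact: ordD].
  rewrite !cjM cj_x1 cj_x2 !cj_expp; [|exact: ordB|exact: ordD].
  rewrite cjD cjB cl cu (lcD hX) (lcB hX) fll //.
  have oN : ord 1 (- L) by apply: ordN.
  have o1 : ord 1 (l + expo (fl w) u) by apply: ordD.
  have o2 : ord 1 (l - expo (fl w) u) by apply: ordB.
  have -> : l + (expo (fl w) u + L) = L + (l + expo (fl w) u) by ring.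
  have -> : l - (expo (fl w) u + L) = - L + (l - expo (fl w) u) by ring.
  by rewrite (exppD L1 o1) (exppD oN o2); apply: fmapP; ring.
exists Psi; split.
  split=> //.
  have e1 : expp (l + u) 0%N 0%N = 1 by apply: coef00_expp.
  have e2 : expp (l - u) 0%N 0%N = 1 by apply: coef00_expp.
  rewrite det2 !mxE /= !coef_x1M !coef_x2M /= e1 e2 mulr1 mul0r subr0.
  exact: oner_neq0.
have fK : fixes0 (flowM w) by apply: fixes0_flow.
have fK' := fixes0_conjM fK.
have fti := @fixes0_swap A' A.
have cjt : conjM tau = swap A' A by apply: conjM_tau.
rewrite model_tripleE /pert_triple -/A -/A' -/tau -/w cjt; split; [|split] => //.
  (* The second involution is the conjugate of the first by the real structure, so its equation
     follows from the other two. *)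
  have fc := fixes0_compM fti fK'.
  rewrite -(compMA Psi fK fc) P_K -(compMA _ fti fK') -cjt.
  rewrite -conjM_compM // P_tau conjM_compM // cjt.
  rewrite (compMA _ (fixes0_conjM fP) fK') -P_K (compMA _ fK fK').
  by rewrite (K_cjK (ltn0Sn s) tr) compM_idr.
by rewrite P_K compM_idl //; apply: fixes0_conjM.
Qed.
End Conjugacy.

(** * The invariant density *)

Definition density_eq (mu sg : C) (s : nat) (t : C) (J : ps) : Prop :=
  [/\ md 0 J = 1, cmp J (swap (alp mu sg s) (alpi mu sg s)) = J &
      expo (lie (pert t s.+1)) J = cj J].

Lemma bounded_md0 p : bounded p -> bounded (md 0 p).
Proof.
move=> [r [B [r0 h]]]; exists r, B; split=> // n; apply: le_trans (h n).
apply: ler_sum => a _; apply: ler_sum => b _; apply: ler_wpM2r.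
  by rewrite exprn_ge0 // ltW.
by rewrite /md; case: eqP => [<-|_]; rewrite ?addn0 ?normr0.
Qed.

Lemma jac_cj p q : jac (cj p) (cj q) = cj (jac p q).
Proof.
have e1 r : d1 (cj r) = cj (d1 r).
  by apply: psP => a b; rewrite /d1 /cj /conjS rmorphM rmorph_nat.
have e2 r : d2 (cj r) = cj (d2 r).
  by apply: psP => a b; rewrite /d2 /cj /conjS rmorphM rmorph_nat.
by rewrite /jac !e1 !e2 cjB !cjM.
Qed.

Section Invariant.
Variables (mu sg : C) (s : nat).
Hypotheses (s0 : (0 < s)%N) (mu1 : `|mu| = 1) (sg1 : sg = 1 \/ sg = -1).
Let A := alp mu sg s.
Let A' := alpi mu sg s.
Let AA' : A * A' = 1 := alpK sg s0 mu1.
Let hA : isdiag A := @alp_diag mu sg s.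
Let hA' : isdiag A' := @alpi_diag mu sg s.
Let tau := swap A A'.

(** Jacobians are compared in the equations of [Psi] for [tau] and for the flow; the determinant -1
    of [tau] occurs on both sides and cancels. The diagonal part of the Jacobian is real, fixed by
    [tau] and commutes with [lie], so dividing by it preserves all equations. *)
Lemma invariant_density t : t^* = t ->
  analytically_equivalent (pert_triple mu sg s t s.+1) (model_triple mu sg s) ->
  exists J, density_eq mu sg s t J /\ bounded J.
Proof.
move=> tr [Psi [[[fP dP] [cP1 cP2]] [eq1 [_ eq3]]]].
set w := pert t s.+1.
have w3 : ord 3 w by apply: pert_ord.
have ft := @fixes0_swap A A'.
rewrite -/A -/A' -/tau in eq1; rewrite compM_idl in eq3; last exact: fixes0_conjM.
pose J0 := jac Psi.1 Psi.2.
have b0 : bounded J0 by apply: bounded_jac; apply/bounded_conv.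
have J00 : J0 0%N 0%N != 0.
  move: dP; rewrite det2 !mxE /=; congr (_ != 0).
  by rewrite /J0 /jac coefSB !coefM00 /d1 /d2 !mul1r.
have Jt : cmp J0 tau = J0.
  have := jac_cmp Psi.1 Psi.2 ft; have := jac_cmp tau.1 tau.2 fP.
  have -> : cmp tau.1 Psi = cmp Psi.1 tau by have [] := eq1.
  have -> : cmp tau.2 Psi = cmp Psi.2 tau by have [] := eq1.
  move=> ->; rewrite /= (jac_swap hA hA' AA') -/J0.
  have [hl h1 _] := cmp_hom fP.
  by rewrite (lcN hl) h1 mulN1r mulrN1 => /oppr_inj.
have JK : expo (lie w) J0 = cj J0.
  rewrite -(jac_expo_fl _ _ w3) -!(cmp_flow _ w3) -jac_cj.
  by move: eq3; rewrite /compM /conjM => -[e1 e2]; rewrite /cmp e1 e2.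
pose d := md 0 J0.
have dd : isdiag d by apply: isdiag_md.
have cd : cj d = d by rewrite /d cj_md -JK md0_expo_lie.
have d00 : d 0%N 0%N != 0 by rewrite /d md_coef.
have [r dr] := unit_inv d00.
have dv : dval 0 d by split.
have rd : isdiag r by apply: (dval_diag dv dr); apply: isdiag1.
have cr : cj r = r.
  by apply: (dval_cancel dv); rewrite -{1}cd -cjM dr cj1.
have [hl h1 hM] := cmp_hom ft.
exists (r * J0); split; last first.
  by apply: bounded_mul => //; apply: (bounded_inv (bounded_md0 b0) dr).
split.
- by rewrite md_diagM // mulrC.
- by rewrite -/A -/A' hM -/tau Jt (cmp_swap_diag hA hA' AA').
- by rewrite (expo_lie_diagM w3 _ rd) JK cjM cr.
Qed.

(** * Polynomial dependence of the density on [t] *)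

(* [x t J] is a polynomial in [t] of degree at most [d], with constant coefficient [c0]
   and linear coefficient [c1], whenever [J] solves the density equations for [t]. *)
Definition trk (d : nat) (c0 c1 : C) (x : C -> ps -> C) : Prop :=
  exists P : {poly C}, [/\ (size P <= d.+1)%N, P`_0 = c0, P`_1 = c1 &
    forall t J, density_eq mu sg s t J -> x t J = P.[t]].

Lemma trk_ext d c0 c1 x y : trk d c0 c1 x ->
  (forall t J, density_eq mu sg s t J -> y t J = x t J) -> trk d c0 c1 y.
Proof. by move=> [P [h1 h2 h3 h4]] h; exists P; split=> // t J v; rewrite h ?h4. Qed.

Lemma trkW d d' c0 c1 x : (d <= d')%N -> trk d c0 c1 x -> trk d' c0 c1 x.
Proof. by move=> dd [P [h1 h2 h3 h4]]; exists P; split=> //; lia. Qed.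

Lemma trk_cst d c : trk d c 0 (fun _ _ => c).
Proof.
exists c%:P; split; rewrite ?coefC //; last by move=> t J _; rewrite hornerC.
by apply: leq_trans (size_polyC_leq1 c) _.
Qed.

Lemma trkD d a0 a1 b0 b1 x y : trk d a0 a1 x -> trk d b0 b1 y ->
  trk d (a0 + b0) (a1 + b1) (fun t J => x t J + y t J).
Proof.
move=> [P [h1 h2 h3 h4]] [Q [k1 k2 k3 k4]]; exists (P + Q); split.
- by apply: leq_trans (size_polyD _ _) _; rewrite geq_max h1 k1.
- by rewrite coefD h2 k2.
- by rewrite coefD h3 k3.
- by move=> t J v; rewrite hornerD h4 // k4.
Qed.

Lemma trkZ d a0 a1 c x : trk d a0 a1 x -> trk d (c * a0) (c * a1) (fun t J => c * x t J).
Proof.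
move=> [P [h1 h2 h3 h4]]; exists (c *: P); split.
- exact: leq_trans (size_scale_leq _ _) h1.
- by rewrite coefZ h2.
- by rewrite coefZ h3.
- by move=> t J v; rewrite hornerZ h4.
Qed.

Lemma trk_sum d (I : Type) (r : seq I) (a0 a1 : I -> C) (x : I -> C -> ps -> C) :
  (forall i, trk d (a0 i) (a1 i) (x i)) ->
  trk d (\sum_(i <- r) a0 i) (\sum_(i <- r) a1 i) (fun t J => \sum_(i <- r) x i t J).
Proof.
move=> h; elim: r => [|i r IH].
  rewrite !big_nil; apply: trk_ext (trk_cst d 0) _ => t J _.
  by rewrite big_nil.
rewrite !big_cons; apply: trk_ext (trkD (h i) IH) _ => t J _.
by rewrite big_cons.
Qed.

Lemma trk_t d a0 a1 x : trk d a0 a1 x -> trk d.+1 0 a0 (fun t J => t * x t J).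
Proof.
move=> [P [h1 h2 h3 h4]]; exists (P * 'X); split.
- apply: leq_trans (size_polyMleq _ _) _; rewrite size_polyX; lia.
- by rewrite coefMX.
- by rewrite coefMX.
- by move=> t J v; rewrite hornerMX h4 // mulrC.
Qed.

Lemma trk_tX d a0 a1 n x : trk d a0 a1 x ->
  trk (d + n.+1) 0 (if n is 0 then a0 else 0) (fun t J => t ^+ n.+1 * x t J).
Proof.
move=> h; elim: n => [|n IH]; first by rewrite addn1; apply: (trk_t h).
rewrite addnS; have := trk_t IH; case: n {IH} => [|n] h';
  by apply: trk_ext h' _ => t J _; rewrite [in LHS]exprS mulrA.
Qed.

(** The counterpart of [ce] for area forms. *)
Definition lc (p : ps) : ps := Ed (chi * p).

Lemma coef_lc p a b : lc p a b = (a%:R - b%:R) * \sum_(i < a.-1) p i b.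
Proof. by rewrite /lc /Ed coef_chiM. Qed.

Lemma iter_lie_pert t N n p : iter n (lie (pert t N)) p =
  cS (('i * t) ^+ n) * hh ^+ (N * n) * iter n lc p.
Proof.
elim: n => [|n /= ->]; first by rewrite muln0 !expr0 rmorph1 !mul1r.
rewrite /lie mulrCA Ed_diagM; last by apply: isdiagM; [apply: isdiagC | apply: isdiag_hhX].
rewrite /pert -[_ * chi * _]mulrA -/(lc _) Ed_diagM; last first.
  by apply: isdiagM; [apply: isdiagC | apply: isdiag_hhX].
by rewrite -/(lc _) mulnS exprS rmorphM exprD; ring.
Qed.

Let B k : ps := A ^+ k.*2 - 1.
(** The coefficient of [t] in [expo (lie (pert t s.+1)) J - J] for a density equal to 1 at
    [t = 0]. *)
Let rr : ps := cS 'i * hh ^+ s.+1 * lc 1.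

Lemma md_lc1 k : md k (lc 1) = cS (k%:R * (1 < k)%N%:R).
Proof.
apply: isdiag_eq => [||i]; [exact: isdiag_md | exact: isdiagC |].
rewrite md_coef /lc mulr1 /Ed natrD addrAC subrr add0r /chi /cS.
case: i => [|i]; first by rewrite add0n eqxx andbT.
by rewrite andbF mulr0.
Qed.
Lemma mdn_lc1 k : mdn k (lc 1) = 0.
Proof.
apply: psP => a b; rewrite /mdn; case: eqP => // _.
rewrite /lc mulr1 /Ed /chi; case: a => [|a]; first by rewrite mulr0.
by rewrite andbF mulr0.
Qed.

Lemma isdiag_ih c : isdiag (cS c * hh ^+ s.+1).
Proof. by apply: isdiagM; [apply: isdiagC | apply: isdiag_hhX]. Qed.

Lemma md_rr k : md k rr = cS ('i * (k%:R * (1 < k)%N%:R)) * hh ^+ s.+1.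
Proof.
by rewrite /rr md_diagM ?md_lc1; [rewrite rmorphM; ring | apply: isdiag_ih].
Qed.
Lemma mdn_rr k : mdn k rr = 0.
Proof. by rewrite /rr mdn_diagM ?mdn_lc1 ?mulr0 //; apply: isdiag_ih. Qed.

Lemma rr_hord : hord s.+1 rr.
Proof. by apply: hordMr; apply: hordMl; apply: hord_hhX. Qed.

(** [dd] solves the density equations linearised at [t = 0] and [J = 1]; it is the candidate for the
    derivative of the density in [t]. *)
Lemma rr_solution : exists dd : ps, [/\ md 0 dd = 0,
  forall k, (0 < k)%N -> mdn k dd = A ^+ k * md k dd &
  forall k, (0 < k)%N -> B k * md k dd = md k rr].
Proof.
have hN : hord s (- rr) by apply: hordN; apply: hordW rr_hord.
have [q hq] := solve_modes mu s0 sg1 hN.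
pose dd : ps := fun a b => if a == b then 0 else
  if (b < a)%N then q (a - b)%N b b else (A ^+ (b - a) * q (b - a)%N) a a.
have dp k : (0 < k)%N -> md k dd = q k.
  move=> k0; have [qd _ _] := hq k k0.
  apply: isdiag_eq => // [|i]; first exact: isdiag_md.
  rewrite md_coef /dd; have -> : ((i + k)%N == i) = false by lia.
  by have -> : (i < i + k)%N by [lia]; rewrite addKn.
have dm k : (0 < k)%N -> mdn k dd = A ^+ k * q k.
  move=> k0; have [qd _ _] := hq k k0.
  apply: isdiag_eq => [||i]; first exact: isdiag_mdn.
    by apply: isdiagM => //; apply: isdiagX.
  rewrite mdn_coef /dd; have -> : (i == (i + k)%N) = false by lia.
  by have -> : (i + k < i)%N = false by [lia]; rewrite addKn.
exists dd; split.
- by apply: psP => a b; rewrite /md /dd addn0 eqxx; case: eqP.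
- by move=> k k0; rewrite dp // dm.
move=> k k0; rewrite dp //; have [_ -> _] := hq k k0.
by rewrite (lcN (mdn_lcont k)) (lcN (md_lcont k)) mdn_rr; ring.
Qed.

Section Induction.
Variables (dd : ps).
Hypotheses (dd0 : md 0 dd = 0)
  (ddn : forall k, (0 < k)%N -> mdn k dd = A ^+ k * md k dd)
  (ddB : forall k, (0 < k)%N -> B k * md k dd = md k rr).

Let coefJ a b : C -> ps -> C := fun _ J => J a b.

(** A coefficient of [lc J] involves only coefficients of [J] with a smaller first index, so the
    order in [hh] does not grow. The linear coefficient is left unspecified: after multiplication by
    a positive power of [t] only the constant one contributes to the linear part. *)
Lemma lc_trk m n : (forall a b, (minn a b < m)%N ->
    trk (minn a b) ((1 : ps) a b) (dd a b) (coefJ a b)) ->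
  forall a b, (minn a b < m)%N ->
  exists c1, trk (minn a b) (iter n lc 1 a b) c1 (fun _ J => iter n lc J a b).
Proof.
move=> IH; elim: n => [|n IHn] a b ab; first by exists (dd a b); apply: IH.
have [c hc] : exists c : 'I_a.-1 -> C, forall i : 'I_a.-1,
    trk (minn a b) (iter n lc 1 i b) (c i) (fun _ J => iter n lc J i b).
  suff /choice[c hc] : forall i : 'I_a.-1, exists c1 : C,
    trk (minn a b) (iter n lc 1 i b) c1 (fun _ J => iter n lc J i b) by exists c.
  move=> i; have hi := ltn_ord i.
  have [|c1 h] := IHn i b; first by lia.
  by exists c1; apply: trkW h; lia.
exists ((a%:R - b%:R) * \sum_(i < a.-1) c i); rewrite /= coef_lc.
apply: (trk_ext (trkZ (a%:R - b%:R) (trk_sum (index_enum _) hc))) => t J _.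
by rewrite coef_lc.
Qed.

Let R t J : ps := expo (lie (pert t s.+1)) J - J.

(** The term of index [n.+1] of the exponential carries [t ^+ n.+1] and [hh ^+ (s.+1 * n.+1)]. At
    orders up to [m + s] it therefore sees [J] only below order [m], with total degree at most
    [m - s n] in [t]; the linear part comes from [n = 0] alone. *)
Lemma R_trk m : (forall a b, (minn a b < m)%N ->
    trk (minn a b) ((1 : ps) a b) (dd a b) (coefJ a b)) ->
  forall a b, (minn a b <= m + s)%N -> trk m 0 (rr a b) (fun t J => R t J a b).
Proof.
move=> IH a b ab.
pose x n := fun (t : C) (J : ps) => ifact n.+1 * 'i ^+ n.+1 * (t ^+ n.+1 *
  (if (s.+1 * n.+1 <= a)%N && (s.+1 * n.+1 <= b)%N then
     iter n.+1 lc J (a - s.+1 * n.+1)%N (b - s.+1 * n.+1)%N else 0)).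
have hx n : trk m 0 (if n is 0 then rr a b else 0) (x n).
  rewrite /x; case h : ((s.+1 * n.+1 <= a)%N && (s.+1 * n.+1 <= b)%N); last first.
    have -> : (if n is 0 then rr a b else 0) = 0.
      by case: n h => // h; apply: rr_hord; lia.
    by apply: trk_ext (trk_cst m 0) _ => t J _; rewrite !mulr0.
  have hm : (minn (a - s.+1 * n.+1) (b - s.+1 * n.+1) < m)%N by lia.
  have [c1 hc] := lc_trk n.+1 IH hm.
  have := trkZ (ifact n.+1 * 'i ^+ n.+1) (trk_tX n hc); rewrite mulr0.
  case: n h hm hc => [|n] h hm hc h'.
    have -> : rr a b = ifact 1 * 'i ^+ 1 * iter 1 lc 1 (a - s.+1 * 1)%N (b - s.+1 * 1)%N.
      rewrite muln1 in h; rewrite /rr -mulrA coef_cM coef_hhXM muln1 h.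
      by rewrite /ifact invr1 mul1r expr1.
    by apply: trkW h'; lia.
  rewrite mulr0 in h'; apply: trkW h'; nia.
have := trk_sum (index_enum 'I_(a + b)) (fun i : 'I_(a + b) => hx i).
rewrite big1 //.
have -> : \sum_(i < a + b) (if val i is 0 then rr a b else 0) = rr a b.
  case E : (a + b)%N => [|c].
    by rewrite big_ord0 rr_hord //; lia.
  by rewrite big_ord_recl /= big1 ?addr0.
move=> h; apply: trk_ext h _ => t J _.
rewrite /R coefSB /expo /psum big_ord_recl /= coef_cM {1}/ifact fact0 invr1 mul1r.
rewrite addrAC subrr add0r; apply: eq_bigr => i _.
rewrite -[lie _ _]/(iter i.+1 (lie (pert t s.+1)) J) iter_lie_pert.
by rewrite -mulrA !coef_cM coef_hhXM /x exprMn !mulrA.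
Qed.

(** Invariance under [tau] ties the two modes of index [k] together; eliminating the conjugate of
    [md k J] from the two modes of the flow equation leaves a division. *)
Lemma density_modes t J k : density_eq mu sg s t J ->
  mdn k J = A ^+ k * md k J /\
  B k * md k J = md k (R t J) - A ^+ k * mdn k (R t J).
Proof.
move=> [_ Jt JK].
have e1 : mdn k J = A ^+ k * md k J by rewrite -{1}Jt (mdn_cmp_swap hA hA' AA').
split=> //; rewrite /R (lcB (md_lcont k)) (lcB (mdn_lcont k)) JK -cj_md -cj_mdn e1.
rewrite cjM (alpX_conj s0 mu1 sg1) /B -addnn exprD.
have := alpXK sg s0 mu1 k; set X := A ^+ k; set Y := alpi mu sg s ^+ k => K.
have -> : X * (Y * cj (md k J) - X * md k J) = (Y * X) * cj (md k J) - X * X * md k J by ring.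
by rewrite K; ring.
Qed.

(** Induction on the order in [hh]. The perturbation gains [s.+1] orders and the division loses at
    most [s], so the coefficients of order [m] are determined by those of lower order, and each
    order costs at most one degree in [t]. *)
Lemma J_trk a b : trk (minn a b) ((1 : ps) a b) (dd a b) (coefJ a b).
Proof.
have [m] := ubnP (minn a b); elim: m a b => // m IH a b ab.
have pos k : (0 < k)%N -> trk m ((1 : ps) (m + k)%N m) (dd (m + k)%N m) (coefJ (m + k)%N m).
  move=> k0; have [|v vs hv] := @dval_alp mu sg s s0 sg1 k.*2; first by lia.
  have [Bd Bv0 Bv] := hv; rewrite -/A -/(B k) in Bd Bv0 Bv.
  have one0 : (1 : ps) (m + k)%N m = 0 by rewrite coefS1; have -> : ((m + k)%N == 0%N) = false by lia.
  (* The product is read at order [m + v], where [v] is the order of [B k]: there the unknown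
     coefficient of order [m] occurs only with the nonzero factor [B k v v], and the terms with
     [i > v] have lower order. *)
  pose S (p : ps) (i : nat) := B k i i * p (m + v - i + k)%N (m + v - i)%N.
  have split_sum (p : ps) : (B k * md k p) (m + v)%N (m + v)%N =
      \sum_(i < (m + v).+1) (if i == v :> nat then 0 else S p i) + B k v v * p (m + k)%N m.
    have hvm : (v < (m + v).+1)%N by lia.
    rewrite coef_diagM // minnn (bigD1 (Ordinal hvm)) //= md_coef addnK addrC; congr (_ + _).
    rewrite [RHS](bigD1 (Ordinal hvm)) //= eqxx add0r; apply: eq_bigr => i.
    rewrite -val_eqE /= => /negPf ->.
    by rewrite md_coef.
  have tS : trk m 0 (\sum_(i < (m + v).+1) (if i == v :> nat then 0 else S dd i))
      (fun _ J => \sum_(i < (m + v).+1) (if i == v :> nat then 0 else S J i)).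
    have h (i : 'I_(m + v).+1) : trk m 0 (if i == v :> nat then 0 else S dd i)
        (fun _ J => if i == v :> nat then 0 else S J i).
      case: eqP => [_|ne]; first exact: trk_cst.
      have [iv|vi] := ltnP i v.
        rewrite /S Bv0 // mul0r; apply: trk_ext (trk_cst m 0) _ => t J _.
        by rewrite mul0r.
      have hi := ltn_ord i.
      have lt : (minn (m + v - i + k) (m + v - i) < m)%N by lia.
      have := trkZ (B k i i) (IH _ _ lt).
      have -> : (1 : ps) (m + v - i + k)%N (m + v - i)%N = 0.
        by rewrite coefS1; have -> : ((m + v - i + k)%N == 0%N) = false by lia.
      rewrite mulr0; apply: trkW; lia.
    have := trk_sum (index_enum _) h; rewrite big1 //.
  have tR : trk m 0 (md k rr (m + v)%N (m + v)%N)
     (fun t J => (md k (R t J) - A ^+ k * mdn k (R t J)) (m + v)%N (m + v)%N).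
    have h1 : trk m 0 (rr (m + v + k)%N (m + v)%N) (fun t J => R t J (m + v + k)%N (m + v)%N).
      by apply: R_trk => //; lia.
    have h2 (i : 'I_(m + v).+1) : trk m ((A ^+ k) i i * 0) ((A ^+ k) i i * rr (m + v - i)%N (m + v - i + k)%N)
        (fun t J => (A ^+ k) i i * R t J (m + v - i)%N (m + v - i + k)%N).
      by apply: trkZ; apply: R_trk => //; lia.
    have := trkD h1 (trkZ (-1) (trk_sum (index_enum _) h2)).
    rewrite (eq_bigr (fun=> 0)) => [|i _]; last by rewrite mulr0.
    rewrite big1 // mulr0 addr0.
    have -> : \sum_(i < (m + v).+1) (A ^+ k) i i * rr (m + v - i)%N (m + v - i + k)%N = 0.
      apply: big1 => i _; have := mdn_coef k rr (m + v - i)%N; rewrite mdn_rr => <-.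
      by rewrite mulr0.
    rewrite mulr0 addr0 -md_coef => h; apply: trk_ext h _ => t J _.
    rewrite coefSB md_coef coef_diagM; last exact: isdiagX.
    rewrite minnn mulN1r; congr (_ - _); apply: eq_bigr => i _.
    by rewrite mdn_coef.
  have := trkZ (B k v v)^-1 (trkD tR (trkZ (-1) tS)).
  rewrite mulr0 addr0 mulr0 one0 -ddB // split_sum.
  have -> : (B k v v)^-1 * (\sum_(i < (m + v).+1) (if i == v :> nat then 0 else S dd i) +
     B k v v * dd (m + k)%N m + -1 * \sum_(i < (m + v).+1) (if i == v :> nat then 0 else S dd i))
     = dd (m + k)%N m by field.
  move=> h; apply: trk_ext h _ => t J hJ; have [_ <-] := density_modes k hJ.
  by rewrite split_sum /coefJ; field.
have [lt|ge] := ltnP (minn a b) m; first exact: IH.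
have em : minn a b = m by lia.
rewrite em; have [ab'|ba|e] := ltngtP a b.
- have -> : a = m by lia.
  have -> : b = (m + (b - a))%N by lia.
  set k := (b - a)%N; have k0 : (0 < k)%N by rewrite /k; lia.
  have h (i : 'I_m.+1) : trk m ((A ^+ k) i i * 0) ((A ^+ k) i i * dd (m - i + k)%N (m - i)%N)
      (fun _ J => (A ^+ k) i i * J (m - i + k)%N (m - i)%N).
    apply: trkZ; have one0 j : (1 : ps) (j + k)%N j = 0.
      by rewrite coefS1; have -> : ((j + k)%N == 0%N) = false by lia.
    have hi := ltn_ord i; have [i0|i0] := posnP i.
      by rewrite i0 subn0 -(one0 m); apply: pos.
    have lt : (minn (m - i + k) (m - i) < m)%N by lia.
    by have := IH _ _ lt; rewrite one0; apply: trkW; lia.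
  have := trk_sum (index_enum _) h.
  rewrite (eq_bigr (fun=> 0)) => [|i _]; last by rewrite mulr0.
  rewrite big1 //.
  have E (p : ps) : mdn k p = A ^+ k * md k p ->
      \sum_(i < m.+1) (A ^+ k) i i * p (m - i + k)%N (m - i)%N = p m (m + k)%N.
    move=> e; rewrite -mdn_coef e coef_diagM; last exact: isdiagX.
    by rewrite minnn; apply: eq_bigr => i _; rewrite md_coef.
  rewrite E ?ddn // => h'.
  have -> : (1 : ps) m (m + k)%N = 0.
    by rewrite coefS1; have -> : ((m + k)%N == 0%N) = false; [lia | rewrite andbF].
  apply: trk_ext h' _ => t J hJ; rewrite E //.
  by have [] := density_modes k hJ.
- have -> : a = (m + (a - b))%N by lia.
  have -> : b = m by lia.
  by apply: pos; lia.
have -> : b = m by lia.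
have -> : a = m by lia.
have -> : dd m m = 0 by have := md_coef 0 dd m; rewrite dd0 addn0 => <-.
apply: trk_ext (trk_cst m _) _ => t J [h _ _].
by rewrite /coefJ -h md_coef addn0.
Qed.
End Induction.

(** Uniqueness of the density enters in this form: the polynomials are fixed without reference to
    any solution, and give the coefficients of whatever solution exists at a given [t]. *)
Lemma density_polynomials : exists (P : nat -> nat -> {poly C}) (q : nat -> ps),
  (forall k m, (0 < k)%N -> [/\ (size (P k m) <= m.+1)%N, (P k m)`_1 = q k m m &
     forall t J, density_eq mu sg s t J -> J (m + k)%N m = (P k m).[t]]) /\
  (forall k, (1 < k)%N -> isdiag (q k) /\ (A ^+ k.*2 - 1) * q k = cS ('i * k%:R) * hh ^+ s.+1).
Proof.
have [dd [dd0 ddn ddB]] := rr_solution.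
have h (x : nat * nat) : exists P : {poly C}, (0 < x.1)%N ->
    [/\ (size P <= x.2.+1)%N, P`_1 = md x.1 dd x.2 x.2 &
     forall t J, density_eq mu sg s t J -> J (x.2 + x.1)%N x.2 = P.[t]].
  case: x => k m; have [P [h1 h2 h3 h4]] := J_trk dd0 ddn ddB (m + k) m.
  exists P => /= k0; split=> //; last by rewrite md_coef.
  by have -> : m = minn (m + k) m by lia.
have [P hP] := choice h.
exists (fun k m => P (k, m)), (fun k => md k dd); split.
  by move=> k m k0; apply: (hP (k, m)).
move=> k k1; split; first exact: isdiag_md.
by rewrite ddB ?md_rr ?k1 ?mulr1 //; lia.
Qed.
End Invariant.

(** * Polynomial families bounded pointwise *)

Notation RR := Rdefinitions.R.

Lemma nested_intervals (a b : nat -> RR) :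
  (forall n, a n <= a n.+1) -> (forall n, b n.+1 <= b n) -> (forall n, a n <= b n) ->
  exists x, forall n, a n <= x <= b n.
Proof.
move=> ha hb hab.
have amono n m : a n <= a (n + m)%N.
  by elim: m => [|m IH]; rewrite ?addn0 // addnS (le_trans IH).
have bmono n m : b (n + m)%N <= b n.
  by elim: m => [|m IH]; rewrite ?addn0 // addnS (le_trans _ IH).
have ab n m : a n <= b m.
  apply: (le_trans (amono n m)); apply: (le_trans (hab _)); rewrite addnC.
  exact: bmono.
pose E : set RR := fun y => exists n, y = a n.
have E0 : nonempty E by exists (a 0%N), 0%N.
have hE : has_sup E.
  by split=> //; exists (b 0%N) => y [n ->].
exists (sup E) => n; apply/andP; split; first by apply: sup_upper_bound => //; exists n.
by apply: ge_sup => // y [m ->].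
Qed.

(** If the conclusion fails, every subinterval and every [B] admit a smaller interval on which some
    [f i] exceeds [c B i]. Nesting these for [B = 0, 1, 2, ...] produces a point at which no [B]
    works. *)
Lemma baire_interval (I : Type) (f : I -> RR -> RR) (c : nat -> I -> RR) :
  (forall i, exists L, forall x y, 0 <= x <= 1 -> 0 <= y <= 1 ->
     `|f i x - f i y| <= L * `|x - y|) ->
  (forall x, 0 <= x <= 1 -> exists B, forall i, f i x <= c B i) ->
  exists a b B, [/\ 0 <= a, a < b, b <= 1 & forall x i, a <= x <= b -> f i x <= c B i].
Proof.
move=> lip pt; apply: contrapT => nex.
pose ok (I : RR * RR) := [/\ 0 <= I.1, I.1 < I.2 & I.2 <= 1].
have step (x : RR * RR * nat) : exists J : RR * RR, ok x.1 ->
    [/\ ok J, x.1.1 <= J.1, J.2 <= x.1.2 &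
      exists i, forall y, J.1 <= y <= J.2 -> c x.2 i < f i y].
  case: x => [[a b] B] /=.
  have [[a0 ab b1]|nok] := pselect (ok (a, b)); last by exists (0, 0).
  have [x [i [hx hi]]] : exists x i, a <= x <= b /\ c B i < f i x.
    apply: contrapT => h; apply: nex; exists a, b, B; split=> // x i hx.
    by rewrite leNgt; apply/negP => hlt; apply: h; exists x, i.
  have /andP[ax xb] := hx.
  have x01 : 0 <= x <= 1 by rewrite (le_trans a0 ax) (le_trans xb b1).
  have [L hL] := lip i.
  pose e := f i x - c B i; have e0 : 0 < e by rewrite subr_gt0.
  pose M := `|L| + 1; have M0 : 0 < M by rewrite ltr_wpDl.
  (* Within distance [d] of [x] the function moves by at most half of its excess [e] over the
     bound. *)
  pose d := e / (2%:R * M); have d0 : 0 < d by rewrite divr_gt0 // mulr_gt0.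
  exists (Num.max a (x - d), Num.min b (x + d)) => _ /=.
  have le1 : Num.max a (x - d) <= x by rewrite ge_max ax lerBlDr lerDl ltW.
  have le2 : x <= Num.min b (x + d) by rewrite le_min xb lerDl ltW.
  split.
  - split=> /=; first by rewrite le_max a0.
      rewrite lt_min !gt_max ab /=.
      have h1 : a < x + d by apply: (le_lt_trans ax); rewrite ltrDl.
      have h2 : x - d < b by apply: lt_le_trans xb; rewrite ltrBlDr ltrDl.
      rewrite h1 h2 /= ltrBlDr -addrA ltrDl; exact: addr_gt0.
    by rewrite ge_min b1.
  - by rewrite le_max lexx.
  - by rewrite ge_min lexx.
  exists i => y /andP[]; rewrite ge_max le_min => /andP[ay xdy] /andP[yb yxd].
  have y01 : 0 <= y <= 1 by rewrite (le_trans a0 ay) (le_trans yb b1).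
  have hxy : `|x - y| <= d by rewrite ler_distlC xdy yxd.
  have := hL x y x01 y01 => hd.
  have h1 : f i x - f i y <= M * d.
    apply: (le_trans (ler_norm _)); apply: (le_trans hd).
    apply: (@le_trans _ _ (M * `|x - y|)); last by rewrite ler_pM2l.
    by apply: ler_wpM2r => //; apply: (le_trans (ler_norm L)); rewrite lerDl.
  have h2 : M * d = e / 2%:R by rewrite /d; field; rewrite gt_eqF.
  rewrite h2 in h1; have : e / 2%:R < e by rewrite ltr_pdivrMr // ltr_pMr // ltr1n.
  by move=> h3; have := le_lt_trans h1 h3; rewrite /e ltrD2l ltrN2.
have [st hst] := choice step.
pose U := fix U n := if n is n'.+1 then st (U n', n') else (0 : RR, 1 : RR).
have okU n : ok (U n).
  elim: n => [|n IH]; first by split; rewrite //= ?lexx ?ltr01.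
  by have [] := hst (U n, n) IH.
have [x hx] : exists x, forall n, (U n).1 <= x <= (U n).2.
  apply: nested_intervals => n.
  - by have [] := hst (U n, n) (okU n).
  - by have [] := hst (U n, n) (okU n).
  - by have [_ /ltW] := okU n.
have [B hB] := pt x (hx 0%N).
have [_ _ _ [i hi]] := hst (U B, B) (okU B).
by have := hi x (hx B.+1); rewrite ltNge hB.
Qed.

Lemma poly_diff (P : {poly C}) (x y : C) : `|x| <= 1 -> `|y| <= 1 ->
  `|P.[x] - P.[y]| <= (\sum_(i < size P) `|P`_i| * i%:R) * `|x - y|.
Proof.
move=> hx hy; rewrite !horner_coef -sumrB mulr_suml.
apply: (le_trans (ler_norm_sum _ _ _)); apply: ler_sum => i _.
rewrite -mulrBr normrM -mulrA; apply: ler_wpM2l => //.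
elim: (val i) => [|n IH]; first by rewrite !expr0 subrr normr0 mul0r.
have -> : x ^+ n.+1 - y ^+ n.+1 = x * (x ^+ n - y ^+ n) + (x - y) * y ^+ n.
  by rewrite !exprS; ring.
apply: (le_trans (ler_normD _ _)); rewrite -natr1 [leRHS]mulrDl mul1r !normrM.
apply: lerD; first by apply: le_trans IH; apply: ler_piMl.
by apply: ler_piMr => //; rewrite normrX exprn_ile1.
Qed.

Lemma coef_prod_XsubC (r : seq C) n : (forall x, x \in r -> `|x| <= 1) ->
  `|(\prod_(x <- r) ('X - x%:P))`_n| <= 2%:R ^+ size r.
Proof.
elim: r n => [|x r IH] n h.
  by rewrite big_nil coefC; case: eqP; rewrite ?normr1 ?normr0 ?expr0.
rewrite big_cons mulrBl coefB mulrC coefMX coefCM /=.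
have -> : 2%:R ^+ (size r).+1 = 2%:R ^+ size r + 2%:R ^+ size r :> C by rewrite exprS; ring.
have hr y : y \in r -> `|y| <= 1 by move=> yr; apply: h; rewrite inE yr orbT.
apply: (le_trans (ler_normB _ _)); apply: lerD.
  by case: eqP => _; [rewrite normr0; apply: exprn_ge0 | apply: (IH _ hr)].
rewrite normrM; apply: le_trans (IH n hr); apply: ler_piMl => //.
by apply: h; rewrite inE eqxx.
Qed.

Lemma prod_dist d i : (i <= d)%N ->
  \prod_(j < d.+1 | j != i :> nat) `|i%:R - j%:R| = (i`! * (d - i)`!)%:R :> C.
Proof.
move=> hi.
rewrite -(big_mkord (fun j => j != i) (fun j => `|i%:R - j%:R| : C)).
rewrite (@big_cat_nat _ _ _ i) //=; last by lia.
rewrite [X in _ * X]big_ltn_cond; last by lia.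
rewrite eqxx /= natrM; congr (_ * _).
  rewrite big_mkcond /= big_nat_rev /= add0n fact_prod natr_prod.
  rewrite [RHS]big_add1 /=; apply: eq_big_nat => j /andP[_ hj].
  have -> : ((i - j.+1)%N != i) by lia.
  rewrite -natrB; last by lia.
  by rewrite normr_nat; congr (_%:R); lia.
rewrite big_mkcond /= fact_prod natr_prod [RHS]big_add1 /=.
rewrite -{1}(add0n i.+1) big_addn subSS.
apply: eq_big_nat => j /andP[_ hj].
have -> : ((j + i.+1)%N != i) by lia.
rewrite distrC -natrB; last by lia.
by rewrite normr_nat; congr (_%:R); lia.
Qed.

(** [d ^ d] is at most the falling factorial of [2 d] of length [d], which is a binomial coefficient
    times [d]!. *)
Lemma expn_fact d : (d ^ d <= 4 ^ d * d`!)%N.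
Proof.
apply: (@leq_trans ((d + d) ^_ d)).
  rewrite ffact_prod -{2}(card_ord d) -prod_nat_const.
  by apply: leq_prod => i _; have := ltn_ord i; lia.
rewrite -bin_ffact leq_mul2r; apply/orP; right.
by apply: leq_trans (bin_le_exp _ _) _; rewrite addnn -mul2n expnM.
Qed.

(* Interpolation at [d.+1] equally spaced nodes; [32] absorbs [d ^ d / d`!], the
   binomial weights and the size of the node polynomials. *)
Lemma lagrange_coef1 (P : {poly C}) d (a g M : C) : (0 < d)%N -> (size P <= d.+1)%N ->
  0 <= a -> 0 < g -> a + g * d%:R <= 1 -> 0 <= M ->
  (forall i, (i <= d)%N -> `|P.[a + g * i%:R]| <= M) ->
  `|P`_1| <= M * (32%:R / (g * d%:R)) ^+ d.
Proof.
move=> d0 sP a0 g0 b1 M0 hM.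
pose x (i : nat) : C := a + g * i%:R.
have x1 (i : nat) : (i <= d)%N -> `|x i| <= 1.
  move=> hi; have x0 : 0 <= x i by rewrite addr_ge0 // mulr_ge0 // ltW.
  rewrite ger0_norm //; apply: le_trans b1; rewrite lerD2l ler_pM2l // ler_nat //.
have xinj i j : x i = x j -> i = j.
  move/addrI/(mulfI (lt0r_neq0 g0)) => /eqP; rewrite eqr_nat => /eqP //.
pose nodes i := [seq x j | j <- iota 0 d.+1 & j != i].
pose N i : {poly C} := \prod_(y <- nodes i) ('X - y%:P).
have Nx i j : (j <= d)%N -> j != i -> (N i).[x j] = 0.
  move=> hj ij; apply/eqP; rewrite -rootE root_prod_XsubC; apply: map_f.
  by rewrite mem_filter ij mem_iota; lia.
have Ni i : (i <= d)%N -> `|(N i).[x i]| = g ^+ d * (i`! * (d - i)`!)%:R.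
  move=> hi; rewrite -prod_dist // horner_prod big_map big_filter.
  rewrite -[iota 0 d.+1]/(index_iota 0 d.+1) big_mkord normr_prod.
  have E (j : 'I_d.+1) : `|('X - (x j)%:P).[x i]| = g * `|i%:R - j%:R|.
    rewrite !hornerE /x.
    have -> : a + g * i%:R - (a + g * j%:R) = g * (i%:R - j%:R) by ring.
    by rewrite normrM gtr0_norm.
  under eq_bigr do rewrite E.
  rewrite big_split /= prodr_const; congr (g ^+ _ * _).
  have -> : #|(fun j : 'I_d.+1 => (j : nat) != i)| = #|predC1 (Ordinal (hi : (i < d.+1)%N))|.
    by apply: eq_card => j; rewrite !inE -val_eqE.
  by rewrite cardC1 card_ord.
have sN i : (i <= d)%N -> size (nodes i) = d.
  move=> hi; rewrite size_map size_filter -[d in RHS]/(d.+1.-1).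
  have := count_predC (pred1 i) (iota 0 d.+1); rewrite size_iota.
  rewrite (count_uniq_mem _ (iota_uniq _ _)) mem_iota /= add0n ltnS hi /= add1n => -[].
  by [].
have Ni0 i : (i <= d)%N -> (N i).[x i] != 0.
  move=> hi; rewrite -normr_eq0 Ni // mulf_neq0 ?expf_neq0 ?(lt0r_neq0 g0) //.
  by rewrite pnatr_eq0 -lt0n muln_gt0 !fact_gt0.
pose Q : {poly C} := \sum_(i < d.+1) (P.[x i] / (N i).[x i]) *: N i.
have PQ : P = Q.
  apply/eqP; rewrite -subr_eq0; apply/eqP.
  apply: (@roots_geq_poly_eq0 _ _ [seq x i | i <- iota 0 d.+1]).
  - apply/allP => y /mapP[j]; rewrite mem_iota add0n => /andP[_ hj] ->.
    rewrite rootE hornerD hornerN subr_eq0; apply/eqP.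
    rewrite /Q horner_sum (bigD1 (Ordinal hj)) //= hornerZ divfK; last by apply: Ni0; lia.
    rewrite big1 ?addr0 // => i; rewrite -val_eqE /= => ij.
    have Nij : (N i).[x j] = 0 by apply: Nx; [lia | rewrite eq_sym].
    by rewrite hornerZ Nij mulr0.
  - by rewrite map_inj_uniq ?iota_uniq.
  rewrite size_map size_iota; apply: leq_trans (size_polyD _ _) _.
  rewrite geq_max sP size_polyN; apply: leq_trans (size_sum _ _ _) _.
  apply/bigmax_leqP => i _; apply: leq_trans (size_scale_leq _ _) _.
  by rewrite size_prod_XsubC sN // -ltnS.
rewrite PQ coef_sum; apply: (le_trans (ler_norm_sum _ _ _)).
apply: (@le_trans _ _ (\sum_(i < d.+1) M * (16%:R / (g * d%:R)) ^+ d)); last first.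
  rewrite sumr_const card_ord -[X in X <= _]mulr_natr -[leLHS]mulrA; apply: ler_wpM2l => //.
  have -> : 32%:R / (g * d%:R) = (16%:R / (g * d%:R)) * 2%:R :> C.
    by rewrite mulrAC -natrM.
  rewrite [leRHS]exprMn; apply: ler_wpM2l.
    by rewrite exprn_ge0 // divr_ge0 // mulr_ge0 // ltW.
  by rewrite -natrX ler_nat; apply: ltn_expl.
apply: ler_sum => i _; have hi : (i <= d)%N by rewrite -ltnS.
rewrite coefZ normrM normrM normfV Ni // -mulrA; apply: ler_pM => //.
- by rewrite mulr_ge0 // invr_ge0 mulr_ge0 // exprn_ge0 // ltW.
- exact: hM.
have h2 : `|(N i)`_1| <= 2%:R ^+ d.
  rewrite -[X in 2%:R ^+ X](sN i hi); apply: coef_prod_XsubC => y /mapP[j]; rewrite mem_filter mem_iota.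
  by move=> /andP[_ hj] ->; apply: x1; lia.
have p0 : 0 < g ^+ d * (i`! * (d - i)`!)%:R.
  by rewrite mulr_gt0 ?exprn_gt0 // ltr0n muln_gt0 !fact_gt0.
rewrite mulrC ler_pdivrMr //; apply: (le_trans h2).
have dn0 : (d%:R : C) != 0 by rewrite pnatr_eq0 -lt0n.
have -> : (16%:R / (g * d%:R)) ^+ d * (g ^+ d * (i`! * (d - i)`!)%:R) =
   16%:R ^+ d * (i`! * (d - i)`!)%:R / d%:R ^+ d.
  rewrite exprMn exprVn exprMn; field.
  by rewrite !expf_neq0 ?(lt0r_neq0 g0).
rewrite ler_pdivlMr ?exprn_gt0 ?ltr0n // -!natrX -!natrM ler_nat.
apply: (@leq_trans (2 ^ d * (4 ^ d * d`!))); first by rewrite leq_mul2l expn_fact orbT.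
rewrite -(bin_fact hi).
apply: (@leq_trans (2 ^ d * (4 ^ d * (2 ^ d * (i`! * (d - i)`!))))).
  by rewrite !leq_mul2l leq_mul2r bin_le_exp !orbT.
by rewrite !mulnA -!expnMn.
Qed.

Section FamilyBound.
Local Open Scope complex_scope.

Definition nr (z : C) : RR := complex.Re `|z|.

Lemma nrE (z : C) : `|z| = (nr z)%:C.
Proof. by rewrite /nr {1 2}[`|z|]normc_def. Qed.

Lemma norm_realC (r : RR) : `|r%:C : C| = `|r|%:C.
Proof. by rewrite [LHS]normc_def /= expr0n /= addr0 sqrtr_sqr. Qed.

(** The Baire argument provides an interval [a, b] with one base [B] for the whole family.
    Interpolating the member [i] at [wt i + 1] nodes spread over [a, b] costs a factor (32 / (b -
    a))^(wt i), which only enlarges the base. *)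
Lemma poly_family_bound (I : Type) (P : I -> {poly C}) (wt : I -> nat) :
  (forall i, size (P i) <= (wt i).+1)%N ->
  (forall t : RR, 0 <= t <= 1 -> exists B : nat, forall i,
      `|(P i).[t%:C]| <= (B ^ (wt i).+1)%:R) ->
  exists W : nat, forall i, `|(P i)`_1| <= (W ^ (wt i).+1)%:R.
Proof.
move=> sP bP.
pose f i t := nr (P i).[t%:C]; pose c B i : RR := (B ^ (wt i).+1)%:R.
have natC n : (n%:R : C) = (n%:R : RR)%:C by rewrite rmorph_nat.
have n01 (t : RR) : 0 <= t <= 1 -> `|t%:C : C| <= 1.
  move=> /andP[h0 h1]; rewrite ger0_norm; last by rewrite -[0]/(0%:C) lecR.
  by rewrite -[1]/(1%:C) lecR.
have [||a [b [B [a0 ab b1 h]]]] := @baire_interval I f c.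
- move=> i; exists (nr (\sum_(j < size (P i)) `|(P i)`_j| * j%:R)) => x y hx hy.
  rewrite -lecR rmorphM /= -nrE.
  have -> : (`|f i x - f i y|%:C : C) = `| `|(P i).[x%:C]| - `|(P i).[y%:C]| |.
    by rewrite (nrE (P i).[x%:C]) (nrE (P i).[y%:C]) -rmorphB norm_realC.
  apply: (le_trans (ler_dist_dist _ _)); apply: (le_trans (poly_diff _ (n01 _ hx) (n01 _ hy))).
  have e : `|x%:C - y%:C : C| = `|x - y|%:C.
    by rewrite -rmorphB norm_realC.
  rewrite e; apply: ler_wpM2r; first by rewrite -[0]/(0%:C) lecR.
  by rewrite [leRHS]ger0_norm //; apply: sumr_ge0 => j _; rewrite mulr_ge0.
- move=> t ht; have [B hB] := bP t ht; exists B => i.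
  by rewrite -lecR -nrE /c -natC.
have d0 : 0 < b - a by rewrite subr_gt0.
pose n0 := (Num.truncn (32%:R / (b - a))).+1.
have hn0 : 32%:R / (b - a) <= n0%:R.
  by rewrite ltW // /n0 truncnS_gt.
exists (B * n0)%N => i; set d := wt i.
have [e|dpos] := posnP d.
  have -> : (P i)`_1 = 0 by have := sP i; rewrite -/d e => /leq_sizeP; apply.
  by rewrite normr0.
pose g := (b - a) / d%:R; have g0 : 0 < g by rewrite divr_gt0 // ltr0n.
have dr0 : (d%:R : RR) != 0 by rewrite pnatr_eq0 -lt0n.
have gd : g * d%:R = b - a by rewrite /g divfK.
have aC : 0 <= a%:C :> C by rewrite (lecR 0 a).
have gC : 0 < g%:C :> C by rewrite (ltcR 0 g).
have gdC : g%:C * d%:R = (b - a)%:C :> C by rewrite natC -rmorphM /= gd.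
have bC : a%:C + g%:C * d%:R <= 1 :> C.
  by rewrite gdC -rmorphD /= addrC subrK (lecR b 1).
have := @lagrange_coef1 (P i) d a%:C g%:C (B ^ d.+1)%:R dpos (sP i) aC gC bC (ler0n _ _).
rewrite gdC => hl; apply: (le_trans (hl _)).
  move=> j hj; rewrite (natC j) (natC (B ^ _)%N) -rmorphM /= -rmorphD /= nrE lecR; apply: h.
  rewrite lerDl mulr_ge0 ?(ltW g0) //= -[leRHS](subrK a) [leRHS]addrC lerD2l.
  by rewrite -gd ler_pM2l // ler_nat.
rewrite !natC -fmorphV -rmorphM /= -rmorphXn -rmorphM /= lecR expnMn natrM.
apply: ler_wpM2l => //; rewrite natrX.
apply: (@le_trans _ _ (n0%:R ^+ d)).
  by apply: lerXn2r; rewrite ?nnegrE // divr_ge0 // ltW.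
by rewrite ler_weXn2l // ler1n.
Qed.

End FamilyBound.

(** * Growth of the linearised density *)

Lemma sum_odd j : (\sum_(l < j.*2.+3) odd l)%N = j.+1.
Proof.
elim: j => [|j IH]; first by rewrite !big_ord_recl big_ord0.
by rewrite doubleS 2!big_ord_recr /= IH /= odd_double /=; lia.
Qed.

(* The recursion of the Taylor coefficients of solutions of [y' = k (1 + y^2)]. *)
Lemma riccati_growth (k : nat) (b : nat -> C) : 0 <= b 0%N ->
  (forall n, n.+1%:R * b n.+1 = k%:R * ((n == 0%N)%:R + \sum_(l < n.+1) b l * b (n - l)%N)) ->
  forall j, k%:R ^+ j.*2.+1 / 3%:R ^+ j <= b j.*2.+1.
Proof.
move=> b0 rec.
have bp n : 0 <= b n.
  have [m] := ubnP n; elim: m n => // m IH [|n] hn //.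
  have n0 : 0 < (n.+1%:R : C) by rewrite ltr0n.
  rewrite -(pmulr_rge0 _ n0) rec mulr_ge0 // addr_ge0 //.
  by apply: sumr_ge0 => l _; rewrite mulr_ge0 // IH //; have := ltn_ord l; lia.
suff h n j : (j < n)%N -> k%:R ^+ j.*2.+1 / 3%:R ^+ j <= b j.*2.+1 by move=> j; apply: (h j.+1).
elim: n j => // n IH [|j] hj.
  have := rec 0%N; rewrite mul1r => ->.
  rewrite expr0 divr1 expr1 mulrDr mulr1 lerDl mulr_ge0 //.
  by apply: sumr_ge0 => l _; rewrite mulr_ge0.
have n0 : 0 < (j.*2.+3%:R : C) by rewrite ltr0n.
rewrite doubleS -(ler_pM2l n0) (rec j.*2.+2) /= add0r.
(* Only the products of two coefficients of odd index are kept. There are [j.+1] of them, each at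
   least [T], and (j + 1) / (2j + 3) is at least 1/3: this is the 3 of the bound. *)
pose T : C := k%:R ^+ j.*2.+2 / 3%:R ^+ j.
have T0 : 0 <= T by rewrite divr_ge0 // exprn_ge0.
apply: (@le_trans _ _ (k%:R * (j.+1%:R * T))).
  have -> : j.*2.+3%:R * (k%:R ^+ j.*2.+3 / 3%:R ^+ j.+1) = k%:R * (j.*2.+3%:R / 3%:R * T) :> C.
    by rewrite /T exprS [3%:R ^+ _]exprS invfM; ring.
  apply: ler_wpM2l => //; apply: ler_wpM2r => //.
  by rewrite ler_pdivrMr // -natrM ler_nat; lia.
apply: ler_wpM2l => //.
have -> : j.+1%:R * T = \sum_(l < j.*2.+3) (odd l)%:R * T.
  by rewrite -mulr_suml -natr_sum sum_odd.
apply: ler_sum => l _; case: (boolP (odd l)) => ol; last by rewrite mul0r mulr_ge0.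
rewrite mul1r; have hl := ltn_ord l.
pose i := l./2; have el : l = i.*2.+1 :> nat by rewrite -(odd_double_half l) ol.
have ij : (i <= j)%N by lia.
have -> : (j.*2.+2 - l)%N = (j - i).*2.+1 by lia.
rewrite el; apply: (@le_trans _ _ ((k%:R ^+ i.*2.+1 / 3%:R ^+ i) * (k%:R ^+ (j - i).*2.+1 / 3%:R ^+ (j - i)))).
  rewrite mulrACA -exprD -invfM -exprD /T.
  have -> : (i.*2.+1 + (j - i).*2.+1)%N = j.*2.+2 by lia.
  by rewrite subnKC.
by apply: ler_pM; rewrite ?divr_ge0 ?exprn_ge0 //; apply: IH; lia.
Qed.

Section Growth.
Variables (mu sg : C) (s : nat).
Hypotheses (s0 : (0 < s)%N) (mu1 : `|mu| = 1) (sg1 : sg = 1 \/ sg = -1).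
Let A := alp mu sg s.

(** On diagonal series [w1] is h d/dh, so this is the logarithmic derivative of alpha^n. *)
Lemma w1_alpX n : w1 (A ^+ n) = cS (s%:R * (n%:R * (sg * 'i))) * hh ^+ s * A ^+ n.
Proof.
rewrite /A alpX //; set c := n%:R * (sg * 'i).
have hd : isdiag (expS c s) by move=> a b ab; rewrite /expS (negPf ab).
have [hw _] := w1_deriv; rewrite (lcZ hw).
have -> : cS (s%:R * c) * hh ^+ s * (cS (mu ^+ n) * expS c s) =
  cS (mu ^+ n) * (cS (s%:R * c) * (hh ^+ s * expS c s)) by ring.
congr (_ * _); apply: isdiag_eq.
- by move=> a b ab; rewrite /w1 hd // mulr0.
- by apply: isdiagM; [apply: isdiagC | apply: isdiagM => //; apply: isdiag_hhX].
move=> i; rewrite coef_cM coef_hhXM andbb /w1 /expS !eqxx /=.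
have [si|nsi] := leqP s i; last first.
  rewrite mulr0; case: i nsi => [|i] nsi; first by rewrite mul0r.
  by case: ifP => [/dvdn_leq|_]; [lia | rewrite mulr0].
rewrite dvdn_subl //; case: ifP => [/dvdnP[m em]|_]; last by rewrite !mulr0.
case: m em => [|m] em; first by lia.
have -> : (i - s)%N = (m * s)%N by rewrite em mulSn addKn.
rewrite em !mulnK // exprS factS !natrM.
have e : (m.+1%:R : C) / m.+1%:R = 1 by rewrite mulfV // pnatr_eq0.
rewrite invfM; set u := (m`!%:R)^-1; set v := (m.+1%:R)^-1 in e *; set z := m.+1%:R in e *.
by transitivity (z * v * (s%:R * c * (c ^+ m * u))); [ring | rewrite e mul1r].
Qed.

(** Conjugation inverts alpha^(2k), hence sends [F] to [1 - F], and y = - i (2 F - 1) is real. As a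
    function of z = h^s it satisfies y' = - sg k (1 + y^2), which reduces the claim to
    [riccati_growth]; the factor 2 is that of [2 F]. *)
Lemma growth (k : nat) (F : ps) : mu ^+ k.*2 != -1 -> (1 + A ^+ k.*2) * F = 1 ->
  forall j, k%:R ^+ j.*2.+1 / 3%:R ^+ j <= 2%:R * `|F (s * j.*2.+1)%N (s * j.*2.+1)%N|.
Proof.
move=> hk eF; set E := A ^+ k.*2 in eF.
have Ed : isdiag E by apply: isdiagX; apply: alp_diag.
have E00 : (1 + E : ps) 0%N 0%N != 0.
  rewrite coefSD coefS1 /E coef_alpX // dvdn0 div0n expr0 fact0 divr1 mulr1 /=.
  by rewrite addrC addr_eq0.
have dv : dval 0 (1 + E) by split=> //; apply: isdiagD => //; apply: isdiag1.
have Fd : isdiag F by apply: (dval_diag dv eF); apply: isdiag1.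
have EF : E * F = 1 - F by rewrite -eF; ring.
have cF : cj F = 1 - F.
  have K : alpi mu sg s ^+ k.*2 * E = 1 by apply: alpXK.
  have := congr1 cj eF; rewrite cjM cjD cj1 (alpX_conj s0 mu1 sg1) => h.
  apply: (dval_cancel dv); rewrite -EF.
  have -> : (1 + E) * (E * F) = E * ((1 + E) * F) by ring.
  rewrite eF; set Y := alpi mu sg s ^+ k.*2 in K h.
  have -> : (1 + E) * cj F = E * ((1 + Y) * cj F) + (1 - Y * E) * cj F by ring.
  by rewrite h K; ring.
have [hw wM] := w1_deriv.
pose kap : C := k.*2%:R * (sg * 'i).
have wF : w1 F = cS (s%:R * kap) * hh ^+ s * (F * F - F).
  have := congr1 w1 eF; rewrite wM (lcD hw) (derivation1 w1_deriv) add0r w1_alpX -/E -/kap.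
  move=> e0; apply: (dval_cancel dv).
  have -> : (1 + E) * w1 F = - (cS (s%:R * kap) * hh ^+ s * (E * F)).
    by apply/eqP; rewrite -addr_eq0 addrC -e0; apply/eqP; ring.
  have -> : (1 + E) * (cS (s%:R * kap) * hh ^+ s * (F * F - F)) =
    cS (s%:R * kap) * hh ^+ s * ((1 + E) * F) * (F - 1) by ring.
  by rewrite eF EF; ring.
pose y := cS (- 'i) * (F + F - 1).
have ii : cS 'i * cS 'i = -1 by rewrite -rmorphM -expr2 sqrCi rmorphN1.
have Ni : cS (- 'i) = - cS 'i by rewrite rmorphN.
have cy : cj y = y.
  by rewrite /y cjM cjC cjB cjD cj1 cF rmorphN /= conjCi opprK Ni; ring.
have yd : isdiag y.
  apply: isdiagM; [exact: isdiagC | apply: isdiagB; [exact: isdiagD | exact: isdiag1]].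
have wy : w1 y = cS (- (s%:R * k%:R * sg)) * (hh ^+ s * (1 + y * y)).
  rewrite /y (lcZ hw) (lcB hw) (lcD hw) (derivation1 w1_deriv) subr0 wF.
  have -> : cS (- (s%:R * k%:R * sg)) = - (cS s%:R * cS k%:R * cS sg) by rewrite rmorphN !rmorphM.
  have -> : cS (s%:R * kap) = cS s%:R * (cS k%:R + cS k%:R) * cS sg * cS 'i.
    by rewrite /kap -addnn natrD !rmorphM rmorphD /=; ring.
  rewrite Ni.
  have -> : - cS 'i * (cS s%:R * (cS k%:R + cS k%:R) * cS sg * cS 'i * hh ^+ s * (F * F - F) +
      cS s%:R * (cS k%:R + cS k%:R) * cS sg * cS 'i * hh ^+ s * (F * F - F)) =
    - (cS 'i * cS 'i) * (cS s%:R * cS k%:R * cS sg * hh ^+ s * (4%:R * (F * F - F))) by ring.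
  have -> : - cS 'i * (F + F - 1) * (- cS 'i * (F + F - 1)) =
    (cS 'i * cS 'i) * ((F + F - 1) * (F + F - 1)) by ring.
  by rewrite ii; ring.
have ycoef i : i%:R * y i i = - (s%:R * k%:R * sg) *
    (if (s <= i)%N then ((i == s)%:R + \sum_(l < (i - s).+1) y l l * y (i - s - l)%N (i - s - l)%N) else 0).
  have := congr1 (fun p : ps => p i i) wy; rewrite /= {1}/w1 => ->.
  rewrite coef_cM coef_hhXM andbb; congr (_ * _); case: ifP => // si.
  rewrite coefSD coefS1 andbb coef_diagM // minnn; congr (_%:R + _).
  by congr nat_of_bool; apply/eqP/eqP; lia.
have ysup i : ~~ (s %| i)%N -> y i i = 0.
  have [m] := ubnP i; elim: m i => // m IH i hi nd.
  have i0 : (0 < i)%N by case: i nd {hi} => //; rewrite dvdn0.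
  have := ycoef i; case: ifP => si; last first.
    by rewrite mulr0 => /eqP; rewrite mulf_eq0 pnatr_eq0 => /orP[|/eqP //]; lia.
  have -> : (i == s) = false by apply/eqP => e; move: nd; rewrite e dvdnn.
  rewrite big1 => [|l _].
    by rewrite addr0 mulr0 => /eqP; rewrite mulf_eq0 pnatr_eq0 => /orP[|/eqP //]; lia.
  have hl := ltn_ord l; have [dl|ndl] := boolP (s %| l)%N; last by rewrite IH ?mul0r //; lia.
  rewrite [y (i - s - l)%N _]IH ?mulr0 //; first by lia.
  apply: contra nd => h; have -> : i = (s + (l + (i - s - l)))%N by lia.
  by rewrite !dvdn_addr.
have sn0 : (s%:R : C) != 0 by rewrite pnatr_eq0 -lt0n.
pose a n := y (s * n)%N (s * n)%N.
have arec n : n.+1%:R * a n.+1 = - (k%:R * sg) * ((n == 0%N)%:R + \sum_(l < n.+1) a l * a (n - l)%N).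
  apply: (mulfI sn0); have := ycoef (s * n.+1)%N.
  rewrite natrM mulrA -/(a n.+1) => ->.
  have -> : (s <= s * n.+1)%N by rewrite leq_pmulr.
  have -> : (s * n.+1 == s)%N = (n == 0%N) by rewrite -{2}(muln1 s) eqn_pmul2l.
  have -> : (s * n.+1 - s)%N = (s * n)%N by rewrite mulnS addKn.
  have -> : \sum_(l < (s * n).+1) y l l * y (s * n - l)%N (s * n - l)%N =
     \sum_(l < n.+1) a l * a (n - l)%N.
    pose G (l : nat) := y l l * y (s * n - l)%N (s * n - l)%N.
    have -> : \sum_(l < n.+1) a l * a (n - l)%N = \sum_(l < n.+1) G (s * l)%N.
      by apply: eq_bigr => l _; rewrite /G /a mulnBr.
    rewrite -[LHS]/(\sum_(l < (s * n).+1) G l).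
    have hG l : ~~ (s %| l)%N -> G l = 0 by move=> h; rewrite /G ysup ?mul0r.
    elim: (n) => [|p IHp]; first by rewrite muln0 !big_ord1 muln0.
    rewrite [RHS]big_ord_recr /= -IHp mulnS.
    rewrite -(big_mkord xpredT G) -(big_mkord xpredT G).
    rewrite [LHS](@big_cat_nat _ _ _ (s * p).+1) //=; last by lia.
    congr (_ + _); rewrite big_nat_recr /=; last by lia.
    rewrite big1_seq ?add0r // => l /andP[_]; rewrite mem_index_iota => /andP[h1 h2].
    apply: hG; apply/negP => /dvdnP[r er]; rewrite er [(r * s)%N]mulnC in h1 h2.
    have h3 : (p < r)%N by rewrite -(ltn_pmul2l s0).
    have : (s * p.+1 <= s * r)%N by rewrite leq_mul2l h3 orbT.
    by rewrite mulnS; lia.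
  by ring.
pose b0 : C := `|y 0%N 0%N|.
have [sig [sig2 esig]] : exists sig : C, sig * sig = 1 /\ y 0%N 0%N = sig * b0.
  have yr : y 0%N 0%N \is Num.real.
    by apply/CrealP; apply: (congr1 (fun p : ps => p 0%N 0%N) cy).
  have [h|h] := real_ge0P yr.
    by exists 1; rewrite mulr1 mul1r /b0 ger0_norm.
  by exists (-1); rewrite mulrNN mulr1 mulN1r /b0 ltr0_norm // opprK.
have sg2 : sg * sg = 1 by case: sg1 => ->; rewrite ?mulrNN mulr1.
(* The coefficients of sig y(- sig sg z), which satisfies b' = k (1 + b^2) and takes the value
   |y(0)| at 0. *)
pose b n := sig ^+ n.+1 * (- sg) ^+ n * a n.
have brec n : n.+1%:R * b n.+1 = k%:R * ((n == 0%N)%:R + \sum_(l < n.+1) b l * b (n - l)%N).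
  have -> : n.+1%:R * b n.+1 = sig ^+ n.+2 * (- sg) ^+ n.+1 * (n.+1%:R * a n.+1) by rewrite /b; ring.
  rewrite arec.
  have -> : sig ^+ n.+2 * (- sg) ^+ n.+1 * (- (k%:R * sg) * ((n == 0%N)%:R + \sum_(l < n.+1) a l * a (n - l)%N))
    = k%:R * (sg * sg) * (sig ^+ n.+2 * (- sg) ^+ n * (n == 0%N)%:R +
       sig ^+ n.+2 * (- sg) ^+ n * \sum_(l < n.+1) a l * a (n - l)%N).
    by rewrite [(- sg) ^+ n.+1]exprS; ring.
  rewrite sg2 mulr1; congr (_ * (_ + _)).
    by case: n => [|n]; rewrite ?mulr0 // expr0 !mulr1 expr2 sig2.
  rewrite mulr_sumr; apply: eq_bigr => l _; have hl := ltn_ord l.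
  have -> : sig ^+ n.+2 = sig ^+ l.+1 * sig ^+ (n - l).+1.
    by rewrite -exprD; congr (_ ^+ _); lia.
  have -> : (- sg) ^+ n = (- sg) ^+ l * (- sg) ^+ (n - l).
    by rewrite -exprD; congr (_ ^+ _); lia.
  by rewrite /b; ring.
have bb0 : 0 <= b 0%N.
  by rewrite /b expr0 mulr1 expr1 /a muln0 esig mulrA sig2 mul1r /b0.
move=> j; apply: (le_trans (riccati_growth bb0 brec j)).
have nsig : `|sig| = 1.
  by apply/eqP; rewrite -sqrp_eq1 // expr2 -normrM sig2 normr1 eqxx.
have nsg : `|- sg| = 1 by rewrite normrN; case: sg1 => ->; rewrite ?normrN normr1.
apply: (le_trans (real_ler_norm (ger0_real _))).
  by apply: le_trans (riccati_growth bb0 brec j); rewrite divr_ge0 ?exprn_ge0.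
rewrite /b 2!normrM !normrX nsig nsg !expr1n !mul1r /a /y coef_cM normrM normrN normCi mul1r.
rewrite coefSB coefSD coefS1.
have -> : ((s * j.*2.+1)%N == 0%N) = false by rewrite muln_eq0; lia.
by rewrite subr0; apply: (le_trans (ler_normD _ _)); rewrite mulr_natl mulr2n.
Qed.
End Growth.

(** * Choice of the parameters and conclusion *)

Lemma nat_bound (z : C) : exists n : nat, `|z| <= n%:R.
Proof.
exists (Num.truncn (nr z)).+1.
by rewrite nrE -(rmorph_nat (@real_complex RR)) lecR ltW // truncnS_gt.
Qed.

Theorem mainTheorem9 (lam mu sg : C) (s : nat) :
  `|lam| = 1 -> mu ^+ 2 = lam -> (sg = 1 \/ sg = -1) -> (1 <= s)%N ->
  exists T : triple,
    MW_triple T /\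
    formally_equivalent T (model_triple mu sg s) /\
    ~ analytically_equivalent T (model_triple mu sg s).
Proof.
move=> lam1 emu sg1 s0.
have mu1 : `|mu| = 1 by apply/eqP; rewrite -sqrp_eq1 // -normrX emu lam1 eqxx.
apply: contrapT => none.
have realC (t : RR) : ((t%:C)%C : C)^* = (t%:C)%C.
  by apply: conj_Creal; apply/complex_realP; exists t.
have an (t : RR) : analytically_equivalent
    (pert_triple mu sg s (t%:C)%C s.+1) (model_triple mu sg s).
  apply: contrapT => nan; apply: none; exists (pert_triple mu sg s (t%:C)%C s.+1).
  split; first exact: MW_pert_triple.
  by split; [apply: formal_pert_triple|].
have [P [q [hP hq]]] := density_polynomials s0 mu1 sg1.
(* The weight is the total degree of the monomial whose coefficient is tracked, so the convergence
   of J at each [t], whatever its radius, is a bound of the required shape. The first index is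
   shifted by one because modes start at [k = 1]. *)
have [W0 hW0] : exists W : nat, forall x : nat * nat,
    `|(P x.1.+1 x.2)`_1| <= (W ^ (x.1.+1 + x.2.*2).+1)%:R.
  apply: (@poly_family_bound _ (fun x => P x.1.+1 x.2) (fun x => (x.1.+1 + x.2.*2)%N)).
    by case=> k m /=; have [h _ _] := hP k.+1 m (ltn0Sn k); apply: (leq_trans h); lia.
  move=> t _; have [J [hJ /bounded_conv[M [r [r0 bJ]]]]] := invariant_density s0 mu1 (realC t) (an t).
  have [n1 h1] := nat_bound M; have [n2 h2] := nat_bound r.
  have M0 : 0 <= M by have := bJ 0%N 0%N; rewrite expr0 mulr1; apply: le_trans.
  rewrite ger0_norm // in h1; rewrite gtr0_norm // in h2.
  exists (n1 + n2)%N => -[k m] /=.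
  have [_ _ h] := hP k.+1 m (ltn0Sn k); rewrite -(h _ _ hJ).
  apply: (le_trans (bJ _ _)).
  have -> : (m + k.+1 + m = k.+1 + m.*2)%N by lia.
  rewrite expnS natrM; apply: ler_pM => //; first by rewrite exprn_ge0 // ltW.
    by apply: (le_trans h1); rewrite ler_nat leq_addr.
  rewrite natrX; apply: lerXn2r; rewrite ?nnegrE ?(ltW r0) //.
  by apply: (le_trans h2); rewrite ler_nat leq_addl.
pose W := W0.+1.
have hW k m : (0 < k)%N -> `|q k m m| <= (W ^ (k + m.*2).+1)%:R.
  case: k => // k _; have [_ <- _] := hP k.+1 m (ltn0Sn k).
  apply: (le_trans (hW0 (k, m))); rewrite ler_nat /=.
  by rewrite leq_exp2r // /W leqnSn.
(* When [j] increases by one, [m] below increases by [2 s] and the upper bound by [W ^ (4 * s)]; the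
   3 comes from the Riccati bound. *)
pose X := (3 * W ^ (4 * s))%N.
have X0 : (0 < X)%N by rewrite /X muln_gt0 expn_gt0.
(* [k > 2 X] makes [k ^ 2] beat [2 X]. If mu^(2k) were -1 for two consecutive [k], then mu^2 = 1, a
   contradiction. *)
have [k [k2 hk]] : exists k, (X.*2 < k)%N /\ mu ^+ k.*2 != -1.
  have [h1|h1] := eqVneq (mu ^+ X.*2.+1.*2) (-1); last by exists X.*2.+1.
  exists X.*2.+2; split=> //; apply/eqP => h2.
  have m2 : mu ^+ 2 = 1.
    by move: h2; rewrite doubleS -addn2 exprD h1 mulN1r => /oppr_inj.
  move: h1; rewrite -mul2n exprM m2 expr1n => /eqP.
  by rewrite -subr_eq0 opprK -[1 + 1]/(2%:R) pnatr_eq0.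
have k1 : (1 < k)%N by lia.
set E := alp mu sg s ^+ k.*2.
have E00 : (1 + E : ps) 0%N 0%N != 0.
  rewrite coefSD coefS1 /E coef_alpX // dvdn0 div0n expr0 fact0 divr1 mulr1 /=.
  by rewrite addrC addr_eq0.
have [F eF] := unit_inv E00.
have [d1d e1] := hq k k1; rewrite -/E in e1.
have [|_ e2] := hq k.*2; first by lia.
(* This is 2 / (E^2 - 1) - 1 / (E - 1) = - 1 / (E + 1) for E = alpha^(2k). *)
have eG : q k.*2 - q k = - (cS ('i * k%:R) * hh ^+ s.+1 * F).
  have [|v vs hv] := @dval_alp mu sg s s0 sg1 k.*2; first by lia.
  rewrite -/E in hv; apply: (dval_cancel hv).
  have eE : alp mu sg s ^+ k.*2.*2 = E * E by rewrite -addnn exprD.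
  rewrite eE in e2.
  have c2 : cS ('i * k.*2%:R) = cS ('i * k%:R) + cS ('i * k%:R).
    by rewrite -addnn natrD mulrDr rmorphD.
  rewrite c2 in e2; set c := cS ('i * k%:R) in e1 e2 *.
  have -> : (E - 1) * (q k.*2 - q k) = ((1 + E) * F) * ((E - 1) * (q k.*2 - q k)) by rewrite eF mul1r.
  have -> : (1 + E) * F * ((E - 1) * (q k.*2 - q k)) =
    F * ((E * E - 1) * q k.*2 - (1 + E) * ((E - 1) * q k)) by ring.
  by rewrite e1 e2; ring.
have ineq j : (k ^ 2 * (k ^ 2) ^ j <= 4 * W ^ (k.*2 + (s.+1 + s).*2).+1 * X ^ j)%N.
  pose m := (s.+1 + s * j.*2.+1)%N.
  have g := growth s0 mu1 sg1 hk eF j.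
  have eGm := congr1 (fun p : ps => p m m) eG; rewrite /= in eGm.
  have nF : `|F (s * j.*2.+1)%N (s * j.*2.+1)%N| * k%:R <= 2%:R * (W ^ (k.*2 + m.*2).+1)%:R.
    have <- : `|(q k.*2 - q k) m m| = `|F (s * j.*2.+1)%N (s * j.*2.+1)%N| * k%:R.
      rewrite eGm coefSN normrN -mulrA coef_cM coef_hhXM /m leq_addr /= addKn.
      by rewrite !normrM normCi mul1r normr_nat mulrC.
    rewrite coefSB; apply: (le_trans (ler_normB _ _)); rewrite mulr_natl mulr2n; apply: lerD.
      by apply: hW; lia.
    apply: (le_trans (hW k m (ltnW k1))).
    by rewrite ler_nat; apply: leq_pexp2l => //; lia.
  have h : (k ^ (j.*2.+1).+1)%:R <= (4 * W ^ (k.*2 + m.*2).+1 * 3 ^ j)%:R :> C.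
    have t0 : 0 < (3%:R : C) ^+ j by rewrite exprn_gt0.
    rewrite ler_pdivrMr // in g.
    rewrite expnSr natrM natrX; apply: (@le_trans _ _ (2%:R * `|F (s * j.*2.+1)%N (s * j.*2.+1)%N| * 3%:R ^+ j * k%:R)).
      by apply: ler_wpM2r.
    rewrite !natrM !natrX.
    have -> : 4%:R = 2%:R * 2%:R :> C by rewrite -natrM.
    have -> : 2%:R * `|F (s * j.*2.+1)%N (s * j.*2.+1)%N| * 3%:R ^+ j * k%:R =
      2%:R * 3%:R ^+ j * (`|F (s * j.*2.+1)%N (s * j.*2.+1)%N| * k%:R) by ring.
    have -> : 2%:R * 2%:R * W%:R ^+ (k.*2 + m.*2).+1 * 3%:R ^+ j =
      2%:R * 3%:R ^+ j * (2%:R * (W ^ (k.*2 + m.*2).+1)%:R) :> C by rewrite natrX; ring.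
    by apply: ler_wpM2l => //; rewrite mulr_ge0 // ltW.
  rewrite ler_nat in h.
  have -> : (k ^ 2 * (k ^ 2) ^ j = k ^ (j.*2.+1).+1)%N.
    by rewrite -expnM -expnD; congr (_ ^ _)%N; lia.
  apply: (leq_trans h); rewrite /X expnMn -expnM.
  have -> : (k.*2 + m.*2).+1 = ((k.*2 + (s.+1 + s).*2).+1 + 4 * s * j)%N by rewrite /m; lia.
  by rewrite expnD; lia.
set D := (4 * W ^ (k.*2 + (s.+1 + s).*2).+1)%N in ineq.
have D0 : (0 < D)%N by rewrite muln_gt0 expn_gt0.
(* The left side grows in [j] at least like [(2 X) ^ j] and the right side like [D * X ^ j]; at
   [j = D] this would give [2 ^ D <= D]. *)
have h := ineq D.
have hX : (X * 2 <= k ^ 2)%N by rewrite muln2; nia.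
have h1 : (2 ^ D * X ^ D <= D * X ^ D)%N.
  apply: leq_trans h; rewrite -expnMn [(2 * X)%N]mulnC.
  apply: (@leq_trans ((k ^ 2) ^ D)); first by rewrite leq_exp2r.
  by rewrite leq_pmull // expn_gt0; lia.
rewrite leq_pmul2r ?expn_gt0 ?X0 // in h1.
by have := leq_trans (ltn_expl D (isT : (1 < 2)%N)) h1; rewrite ltnn.
Qed.
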